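(* For every large prime $q$ there exists a Dirichlet character $\chi$ modulo $q$ such that $$|L(\chi,1/2)|\ \ge\ \exp\left(\left(\frac{1}{\sqrt{3}}+o(1)\right)\mathcal{L}\right),\qquad \mathcal{L}=\sqrt{\frac{\log q}{\log\log q}},$$ where $o(1)$ denotes a quantity tending to $0$ as $q\to\infty$ through primes. Moreover, such a character can be picked to be even, and such a character can also be picked to be odd.
   Context: For a Dirichlet character $\chi$ modulo $q$, $L(\chi,s)=\sum_{n\ge1}\chi(n)n^{-s}$ for $\Re s>1$, continued meromorphically to $\mathbb{C}$ (entire if $\chi$ is not principal, with a pole only at $s=1$ if $\chi$ is principal); $L(\chi,1/2)$ is the value of this continuation at $s=1/2$. A character $\chi$ is even if $\chi(-1)=1$ and odd if $\chi(-1)=-1$. $\log$ is the natural logarithm. *)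

(* Defs.v *)
From Stdlib Require Import Reals ZArith Znumtheory ClassicalEpsilon.
From Coquelicot Require Import Coquelicot.

Open Scope R_scope.

(* The values at all integers: [chi] vanishes exactly off the residues prime
   to [q], and chi(1) = 1 follows from the last two fields. *)
Record DirichletCharacter (q : nat) : Type := {
  chi_val :> Z -> C;
  chi_periodic : forall n : Z, chi_val (n + Z.of_nat q)%Z = chi_val n;
  chi_mult : forall m n : Z,
    chi_val (m * n)%Z = Cmult (chi_val m) (chi_val n);
  chi_support : forall n : Z,
    chi_val n <> RtoC 0 <-> rel_prime n (Z.of_nat q)
}.

Definition principal {q : nat} (chi : DirichletCharacter q) : Prop :=
  forall n : Z, rel_prime n (Z.of_nat q) -> chi n = RtoC 1.

Definition even_char {q : nat} (chi : DirichletCharacter q) : Prop :=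
  chi (-1)%Z = RtoC 1.

Definition odd_char {q : nat} (chi : DirichletCharacter q) : Prop :=
  chi (-1)%Z = RtoC (-1).

(* Complex exponential, as exp (Re z) * (cos (Im z) + i sin (Im z)). *)
Definition Cexp (z : C) : C :=
  (exp (Re z) * cos (Im z), exp (Re z) * sin (Im z)).

(* n^(-s) for n >= 1, with the real logarithm of n. *)
Definition nat_Cpow_opp (n : nat) (s : C) : C :=
  Cexp (Cmult (Copp s) (RtoC (ln (INR n)))).

(* The series starts at n = 1, so its term of index k is chi(k+1) (k+1)^(-s). *)
Definition dirichlet_term {q : nat} (chi : DirichletCharacter q) (s : C)
    (k : nat) : C :=
  Cmult (chi (Z.of_nat (S k))) (nat_Cpow_opp (S k) s).

Definition entire (F : C -> C) : Prop :=
  forall s : C, ex_derive (K := C_AbsRing) (V := C_NormedModule) F s.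

(* Holomorphic on C minus {1}, with at most a pole at 1; nothing is said about
   the value F 1. *)
Definition meromorphic_pole_at_1 (F : C -> C) : Prop :=
  exists (k : nat) (G : C -> C), entire G /\
    forall s : C, s <> RtoC 1 ->
      F s = Cdiv (G s) (Cpow (Cminus s (RtoC 1)) k).

Definition is_L_function {q : nat} (chi : DirichletCharacter q)
    (F : C -> C) : Prop :=
  (forall s : C, 1 < Re s ->
     is_series (K := C_AbsRing) (V := C_NormedModule)
       (dirichlet_term chi s) (F s)) /\
  meromorphic_pole_at_1 F /\
  (~ principal chi -> entire F).

(* The continuation is unique away from s = 1 (and everywhere if chi is not
   principal) by the identity theorem.  The fallback value 0 is for the case
   where there is no continuation, so that a positive lower bound for
   |L chi s| forces the continuation to exist. *)
Definition L {q : nat} (chi : DirichletCharacter q) : C -> C :=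
  match excluded_middle_informative (exists F, is_L_function chi F) with
  | left h => proj1_sig (constructive_indefinite_description _ h)
  | right _ => fun _ => RtoC 0
  end.

Definition scrL (q : nat) : R := sqrt (ln (INR q) / ln (ln (INR q))).

Definition prime_nat (q : nat) : Prop := prime (Z.of_nat q).

(* Main.v *)
Require Import Defs.
From Stdlib Require Import Reals ZArith Znumtheory ClassicalEpsilon Lra Lia List Permutation.
From Coquelicot Require Import Coquelicot.
Open Scope R_scope.
Import ListNotations.

(** The proof is the resonance method.  For nonnegative weights r supported on integers
    n <= N = q^(1/3), put R(chi) = sum r(n) chi(n) and average L(chi, 1/2) |R(chi)|^2 over
    the characters of a given parity.  If the average is large compared with that of
    |R(chi)|^2, some value L(chi, 1/2) is large.

    The central value.  Since a nonprincipal chi has mean zero over a period,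
    L(chi, 1/2) is exactly the sum over 1 <= a < q of chi(a) w(a), with weights
    a^(-1/2) - q^(-1/2) <= w(a) <= a^(-1/2), w(a) >= 0 ([central_value_formula]).
    This requires the entire continuation, obtained by iterated summation by parts
    ([periodic_series_continuation]), and its uniqueness: an entire function vanishing for
    Re s > 1 vanishes at 1/2 ([holo_zero_half_plane]), which follows from Goursat's
    theorem through a mean value inequality.

    The moments.  By orthogonality the average of L(chi, 1/2) |R(chi)|^2 over a parity
    eps is a sum of w(a) r(m) r(n) over a m = n, plus eps times the same sum over
    a m = -n modulo q.  The first sum contains all exact equations a m = n.  In the second
    one a >= q/(2N), so it is at most N (2N/q)^(1/2) sum r^2 = O(sum r^2); for odd
    characters it is subtracted, and this is what forces N <= q^(1/3).  Hence
    ([resonance]) some chi of each parity satisfies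

      |L(chi, 1/2)| >= num / den - 11,

    with num the sum of r(m) r(n) (m/n)^(1/2) over m | n, and den the sum of r(n)^2.

    The resonator.  Let X = log N.  Divide the primes above X into finitely many classes
    from X^((1+d)^i) to X^((1+d)^(i+1)), and let n run over products of at most k_i primes
    of the i-th class, with r(n) = rho_i^j n^(-1/2) on products of j primes of that class.
    The ratio num / den is at least multiplicative over classes ([block_product]).
    For a single class whose primes have sum of reciprocals s, the choice rho^2 = k/s
    makes the products of exactly k primes dominant, and the ratio is at least about
    (1 + (s/k)^(1/2))^k / (k+1), or exp ((s k)^(1/2)) ([class_gain]).  By Mertens' theorem
    s is close to d/(1+d).  With k_i proportional to (1+d)^(-2i) X / log X, the sizes
    and the exponents are geometric progressions, of sums at most X and close to
    (X / log X)^(1/2) when d is small and there are many classes ([resonator_exists]).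
    As X = (log q)/3, the last quantity is asymptotically 3^(-1/2) times
    ((log q) / log log q)^(1/2). *)

(** * Complex differentiability *)

(** The epsilon-delta form is stated with the modulus, so that it does not depend
    on which of the two uniform structures of the complex plane is in use. *)
Definition cdiff (f : C -> C) (z l : C) : Prop :=
  forall eps, 0 < eps -> exists delta, 0 < delta /\
    forall w : C, Cmod (w - z) < delta ->
      Cmod (f w - f z - l * (w - z)) <= eps * Cmod (w - z).

Definition holo (f : C -> C) : Prop := forall z, exists l, cdiff f z l.

Lemma ex_derive_cdiff (f : C -> C) (z : C) :
  ex_derive (K := C_AbsRing) (V := C_NormedModule) f z <->
  exists l, cdiff f z l.
Proof.
  split.
  - intros [l [_ Hd]]. exists l. intros eps Heps.
    destruct (Hd z (fun P H => H) (mkposreal eps Heps)) as [d Hdd].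
    exists d. split; [apply cond_pos|]. intros w Hw.
    specialize (Hdd w Hw). simpl in Hdd.
    rewrite (Cmult_comm l). exact Hdd.
  - intros [l Hl]. exists l. split.
    + apply (@is_linear_scal_l C_AbsRing C_NormedModule l).
    + intros x Hx.
      apply (@is_filter_lim_locally_unique C_AbsRing (AbsRing_NormedModule C_AbsRing)) in Hx. subst x.
      intros [eps Heps]. destruct (Hl eps Heps) as [d [Hd Hdd]].
      exists (mkposreal d Hd). intros w Hw. simpl.
      specialize (Hdd w Hw).
      rewrite (Cmult_comm l) in Hdd. exact Hdd.
Qed.

Lemma entire_holo (f : C -> C) : entire f <-> holo f.
Proof. split; intros H z; apply ex_derive_cdiff, H. Qed.

Lemma cdiff_lipschitz (f : C -> C) (z l : C) : cdiff f z l ->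
  exists delta, 0 < delta /\ forall w, Cmod (w - z) < delta ->
    Cmod (f w - f z) <= (1 + Cmod l) * Cmod (w - z).
Proof.
  intros H. destruct (H 1 Rlt_0_1) as [d [Hd Hw]].
  exists d. split; [assumption|]. intros w Hwz. specialize (Hw w Hwz).
  replace (f w - f z)%C with ((f w - f z - l * (w - z)) + l * (w - z))%C by ring.
  eapply Rle_trans; [apply Cmod_triangle|]. rewrite Cmod_mult. lra.
Qed.

Lemma cdiff_cont (f : C -> C) (z l : C) : cdiff f z l ->
  forall eps, 0 < eps -> exists delta, 0 < delta /\
    forall w, Cmod (w - z) < delta -> Cmod (f w - f z) < eps.
Proof.
  intros H eps Heps. destruct (cdiff_lipschitz f z l H) as [d [Hd Hw]].
  assert (HM : 0 < 1 + Cmod l) by (pose proof (Cmod_ge_0 l); lra).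
  exists (Rmin d (eps / (1 + Cmod l))). split.
  - apply Rmin_pos; [assumption|]. now apply Rdiv_lt_0_compat.
  - intros w Hlt. eapply Rle_lt_trans; [apply Hw|].
    + eapply Rlt_le_trans; [apply Hlt|apply Rmin_l].
    + assert (Cmod (w - z) < eps / (1 + Cmod l))
        by (eapply Rlt_le_trans; [apply Hlt|apply Rmin_r]).
      apply (Rmult_lt_compat_l (1 + Cmod l)) in H0; [|assumption].
      replace ((1 + Cmod l) * (eps / (1 + Cmod l))) with eps in H0; [assumption|].
      field; lra.
Qed.

Lemma cdiff_const (c z : C) : cdiff (fun _ => c) z (RtoC 0).
Proof.
  intros eps Heps. exists 1. split; [lra|]. intros w _.
  replace (c - c - RtoC 0 * (w - z))%C with (RtoC 0) by ring.
  rewrite Cmod_0. apply Rmult_le_pos; [lra|apply Cmod_ge_0].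
Qed.

Lemma cdiff_id (z : C) : cdiff (fun w => w) z (RtoC 1).
Proof.
  intros eps Heps. exists 1. split; [lra|]. intros w _.
  replace (w - z - RtoC 1 * (w - z))%C with (RtoC 0) by ring.
  rewrite Cmod_0. apply Rmult_le_pos; [lra|apply Cmod_ge_0].
Qed.

Lemma cdiff_plus (f g : C -> C) (z l m : C) :
  cdiff f z l -> cdiff g z m -> cdiff (fun w => (f w + g w)%C) z (l + m)%C.
Proof.
  intros Hf Hg eps Heps.
  destruct (Hf (eps / 2)) as [d1 [Hd1 H1]]; [lra|].
  destruct (Hg (eps / 2)) as [d2 [Hd2 H2]]; [lra|].
  exists (Rmin d1 d2). split; [now apply Rmin_pos|]. intros w Hw.
  specialize (H1 w (Rlt_le_trans _ _ _ Hw (Rmin_l _ _))).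
  specialize (H2 w (Rlt_le_trans _ _ _ Hw (Rmin_r _ _))).
  replace (f w + g w - (f z + g z) - (l + m) * (w - z))%C
    with ((f w - f z - l * (w - z)) + (g w - g z - m * (w - z)))%C by ring.
  eapply Rle_trans; [apply Cmod_triangle|]. lra.
Qed.

Lemma cdiff_comp (f g : C -> C) (z l m : C) :
  cdiff g z m -> cdiff f (g z) l -> cdiff (fun w => f (g w)) z (l * m)%C.
Proof.
  intros Hg Hf eps Heps.
  destruct (cdiff_lipschitz g z m Hg) as [d0 [Hd0 H0]].
  set (M := 1 + Cmod m) in *.
  assert (HM : 0 < M) by (unfold M; pose proof (Cmod_ge_0 m); lra).
  set (N := 1 + Cmod l).
  assert (HN : 0 < N) by (unfold N; pose proof (Cmod_ge_0 l); lra).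
  destruct (Hf (eps / 2 / M)) as [d1 [Hd1 H1]].
  { repeat apply Rdiv_lt_0_compat; lra. }
  destruct (Hg (eps / 2 / N)) as [d2 [Hd2 H2]].
  { repeat apply Rdiv_lt_0_compat; lra. }
  exists (Rmin (Rmin d0 d2) (d1 / M)). split.
  { repeat apply Rmin_pos; try assumption. now apply Rdiv_lt_0_compat. }
  intros w Hw.
  assert (Hw0 : Cmod (w - z) < d0).
  { eapply Rlt_le_trans; [apply Hw|]. eapply Rle_trans; [apply Rmin_l|apply Rmin_l]. }
  assert (Hw2 : Cmod (w - z) < d2).
  { eapply Rlt_le_trans; [apply Hw|]. eapply Rle_trans; [apply Rmin_l|apply Rmin_r]. }
  assert (Hw1 : Cmod (w - z) < d1 / M).
  { eapply Rlt_le_trans; [apply Hw|]. apply Rmin_r. }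
  specialize (H0 w Hw0). specialize (H2 w Hw2).
  assert (Hg1 : Cmod (g w - g z) < d1).
  { eapply Rle_lt_trans; [apply H0|].
    apply (Rmult_lt_compat_l M) in Hw1; [|assumption].
    replace (M * (d1 / M)) with d1 in Hw1; [assumption|field; lra]. }
  specialize (H1 (g w) Hg1).
  replace (f (g w) - f (g z) - l * m * (w - z))%C
    with ((f (g w) - f (g z) - l * (g w - g z)) + l * (g w - g z - m * (w - z)))%C by ring.
  eapply Rle_trans; [apply Cmod_triangle|]. rewrite Cmod_mult.
  assert (A1 : Cmod (f (g w) - f (g z) - l * (g w - g z)) <= eps / 2 * Cmod (w - z)).
  { eapply Rle_trans; [apply H1|].
    apply Rle_trans with (eps / 2 / M * (M * Cmod (w - z))).
    - apply Rmult_le_compat_l; [|assumption].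
      left; repeat apply Rdiv_lt_0_compat; lra.
    - right. field. lra. }
  assert (A2 : Cmod l * Cmod (g w - g z - m * (w - z)) <= eps / 2 * Cmod (w - z)).
  { apply Rle_trans with (N * (eps / 2 / N * Cmod (w - z))).
    - apply Rmult_le_compat; try apply Cmod_ge_0; [unfold N; lra|assumption].
    - right. field. lra. }
  lra.
Qed.

Lemma cdiff_sqr (z : C) : cdiff (fun w => (w * w)%C) z (RtoC 2 * z)%C.
Proof.
  intros eps Heps. exists eps. split; [assumption|]. intros w Hw.
  replace (w * w - z * z - RtoC 2 * z * (w - z))%C with ((w - z) * (w - z))%C by ring.
  rewrite Cmod_mult. apply Rmult_le_compat_r; [apply Cmod_ge_0|lra].
Qed.

Lemma cdiff_scal (c : C) (f : C -> C) (z l : C) :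
  cdiff f z l -> cdiff (fun w => (c * f w)%C) z (c * l)%C.
Proof.
  intros Hf.
  apply (cdiff_comp (fun w => (c * w)%C) f z c l Hf).
  intros eps Heps. exists 1. split; [lra|]. intros w _.
  replace (c * w - c * f z - c * (w - f z))%C with (RtoC 0) by ring.
  rewrite Cmod_0. apply Rmult_le_pos; [lra|apply Cmod_ge_0].
Qed.

Lemma holo_const c : holo (fun _ => c).
Proof. intros z; eexists; apply cdiff_const. Qed.

Lemma holo_id : holo (fun w => w).
Proof. intros z; eexists; apply cdiff_id. Qed.

Lemma holo_plus f g : holo f -> holo g -> holo (fun w => (f w + g w)%C).
Proof.
  intros Hf Hg z. destruct (Hf z) as [l Hl], (Hg z) as [m Hm].
  eexists; apply cdiff_plus; eassumption.
Qed.

Lemma holo_comp f g : holo f -> holo g -> holo (fun w => f (g w)).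
Proof.
  intros Hf Hg z. destruct (Hg z) as [m Hm], (Hf (g z)) as [l Hl].
  eexists; apply cdiff_comp; eassumption.
Qed.

Lemma holo_scal c f : holo f -> holo (fun w => (c * f w)%C).
Proof. intros Hf z. destruct (Hf z) as [l Hl]. eexists; apply cdiff_scal, Hl. Qed.

Lemma holo_minus f g : holo f -> holo g -> holo (fun w => (f w - g w)%C).
Proof.
  intros Hf Hg z.
  destruct (holo_plus f _ Hf (holo_scal (RtoC (-1)) g Hg) z) as [l Hl].
  exists l. intros eps Heps. destruct (Hl eps Heps) as [d [Hd H]].
  exists d. split; [assumption|]. intros w Hw. specialize (H w Hw).
  replace (f w - g w - (f z - g z) - l * (w - z))%C
    with (f w + RtoC (-1) * g w - (f z + RtoC (-1) * g z) - l * (w - z))%C by ring.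
  assumption.
Qed.

(** Polarization reduces the product rule to the derivative of a square. *)
Lemma holo_mult f g : holo f -> holo g -> holo (fun w => (f w * g w)%C).
Proof.
  intros Hf Hg z.
  assert (Hsq : holo (fun w => (w * w)%C)) by (intros u; eexists; apply cdiff_sqr).
  pose proof (holo_scal (RtoC (/ 4)) _ (holo_minus _ _
    (holo_comp _ _ Hsq (holo_plus f g Hf Hg))
    (holo_comp _ _ Hsq (holo_minus f g Hf Hg)))) as H.
  destruct (H z) as [l Hl]. exists l.
  assert (E : forall a b : C, (RtoC (/ 4) * ((a + b) * (a + b) - (a - b) * (a - b)) = a * b)%C).
  { intros [a1 a2] [b1 b2]. apply injective_projections; simpl; field. }
  intros eps Heps. destruct (Hl eps Heps) as [d [Hd Hw]].
  exists d. split; [assumption|]. intros w Hwz. specialize (Hw w Hwz).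
  cbv beta in Hw. rewrite !E in Hw. exact Hw.
Qed.

(** * Goursat's theorem for rectangles *)

Definition curve_continuous (f : R -> C) : Prop :=
  forall t eps, 0 < eps -> exists delta, 0 < delta /\
    forall t', Rabs (t' - t) < delta -> Cmod (f t' - f t) < eps.

Definition CRInt (f : R -> C) (a b : R) : C := RInt (V := C_R_CompleteNormedModule) f a b.

Lemma curve_continuous_continuous f t : curve_continuous f -> continuous (U := C_R_CompleteNormedModule) f t.
Proof.
  intros Hf. apply (filterlim_locally (U := C_R_CompleteNormedModule) f (f t)).
  intros [eps Heps]. destruct (Hf t eps Heps) as [d [Hd H]].
  exists (mkposreal d Hd). intros t' Ht'.
  apply (C_NormedModule_mixin_compat1 (f t) (f t') eps). apply (H t' Ht').
Qed.

Lemma curve_continuous_ex f a b : curve_continuous f -> ex_RInt (V := C_R_CompleteNormedModule) f a b.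
Proof.
  intros Hf. apply (ex_RInt_continuous (V := C_R_CompleteNormedModule)).
  intros t _. now apply curve_continuous_continuous.
Qed.

Lemma norm_CR (z : C) : norm (V := C_R_NormedModule) z = Cmod z.
Proof.
  unfold norm; simpl. unfold prod_norm, Cmod, norm; simpl. unfold abs; simpl.
  f_equal. rewrite !Rmult_1_r, <- !Rabs_mult.
  rewrite !Rabs_right by apply Rle_ge, Rle_0_sqr. reflexivity.
Qed.

Lemma CRInt_bound (f : R -> C) a b M : a <= b -> curve_continuous f ->
  (forall t, a <= t <= b -> Cmod (f t) <= M) -> Cmod (CRInt f a b) <= (b - a) * M.
Proof.
  intros Hab Hf HM. unfold CRInt. rewrite <- norm_CR.
  apply (norm_RInt_le_const (V := C_R_NormedModule) f a b); [assumption|..].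
  - intros x Hx. rewrite norm_CR. now apply HM.
  - apply (RInt_correct (V := C_R_CompleteNormedModule)). now apply curve_continuous_ex.
Qed.

Lemma CRInt_chasles (f : R -> C) a b c : curve_continuous f ->
  (CRInt f a b + CRInt f b c = CRInt f a c)%C.
Proof.
  intros Hf. apply (RInt_Chasles (V := C_R_CompleteNormedModule)); now apply curve_continuous_ex.
Qed.

Lemma CRInt_minus (f g : R -> C) a b : curve_continuous f -> curve_continuous g ->
  (CRInt (fun t => (f t - g t)%C) a b = CRInt f a b - CRInt g a b)%C.
Proof.
  intros Hf Hg. apply (RInt_minus (V := C_R_CompleteNormedModule)); now apply curve_continuous_ex.
Qed.

Lemma CRInt_ext (f g : R -> C) a b : (forall t, f t = g t) -> CRInt f a b = CRInt g a b.
Proof. intros H. apply (RInt_ext (V := C_R_CompleteNormedModule)). intros t _. apply H. Qed.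

Lemma is_CRInt_affine (u v : C) a b :
  is_RInt (V := C_R_NormedModule) (fun t => (u + RtoC t * v)%C) a b
    (RtoC (b - a) * u + RtoC ((b * b - a * a) / 2) * v)%C.
Proof.
  assert (P : forall p q : R, is_RInt (fun t => p + t * q) a b
                ((b - a) * p + (b * b - a * a) / 2 * q)).
  { intros p q.
    replace ((b - a) * p + (b * b - a * a) / 2 * q)
      with (minus (b * p + b * b / 2 * q) (a * p + a * a / 2 * q))
      by (unfold minus, plus, opp; simpl; field).
    apply (is_RInt_derive (fun t => t * p + t * t / 2 * q)).
    - intros x _. auto_derive; [easy|field].
    - intros x _. apply (ex_derive_continuous (V := R_NormedModule)). auto_derive. easy. }
  destruct u as [u1 u2], v as [v1 v2].
  apply (is_RInt_ext (V := C_R_NormedModule) (fun t => (u1 + t * v1, u2 + t * v2))).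
  { intros t _. apply injective_projections; simpl; ring. }
  replace (RtoC (b - a) * (u1, u2) + RtoC ((b * b - a * a) / 2) * (v1, v2))%C
    with ((b - a) * u1 + (b * b - a * a) / 2 * v1, (b - a) * u2 + (b * b - a * a) / 2 * v2)
    by (apply injective_projections; simpl; ring).
  apply (is_RInt_fct_extend_pair (U := R_NormedModule) (V := R_NormedModule)); simpl; apply P.
Qed.

Lemma CRInt_affine (u v : C) a b :
  CRInt (fun t => (u + RtoC t * v)%C) a b
  = (RtoC (b - a) * u + RtoC ((b * b - a * a) / 2) * v)%C.
Proof. apply (is_RInt_unique (V := C_R_CompleteNormedModule)), is_CRInt_affine. Qed.

Definition plane_continuous (h : C -> C) : Prop :=
  forall z eps, 0 < eps -> exists delta, 0 < delta /\
    forall w, Cmod (w - z) < delta -> Cmod (h w - h z) < eps.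

Lemma holo_plane_continuous h : holo h -> plane_continuous h.
Proof. intros Hh z. destruct (Hh z) as [l Hl]. exact (cdiff_cont h z l Hl). Qed.

Lemma curve_continuous_hor h y : plane_continuous h -> curve_continuous (fun x => h (x, y)).
Proof.
  intros Hh t eps Heps. destruct (Hh (t, y) eps Heps) as [d [Hd H]].
  exists d. split; [assumption|]. intros t' Ht'. apply H.
  replace ((t', y) - (t, y))%C with (RtoC (t' - t))
    by (apply injective_projections; simpl; ring).
  now rewrite Cmod_R.
Qed.

Lemma curve_continuous_ver h x : plane_continuous h -> curve_continuous (fun y => h (x, y)).
Proof.
  intros Hh t eps Heps. destruct (Hh (x, t) eps Heps) as [d [Hd H]].
  exists d. split; [assumption|]. intros t' Ht'. apply H.
  replace ((x, t') - (x, t))%C with (Ci * RtoC (t' - t))%C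
    by (apply injective_projections; simpl; ring).
  now rewrite Cmod_mult, Cmod_Ci, Cmod_R, Rmult_1_l.
Qed.

Definition hor (h : C -> C) a b y := CRInt (fun x => h (x, y)) a b.
Definition ver (h : C -> C) x c d := CRInt (fun y => h (x, y)) c d.
Definition rect_int (h : C -> C) a b c d : C :=
  (hor h a b c + Ci * ver h b c d - hor h a b d - Ci * ver h a c d)%C.

Lemma rect_int_split h a m b c n d : plane_continuous h ->
  rect_int h a b c d = (rect_int h a m c n + rect_int h m b c n
    + rect_int h a m n d + rect_int h m b n d)%C.
Proof.
  intros Hh. unfold rect_int, hor, ver.
  rewrite <- (CRInt_chasles _ a m b (curve_continuous_hor h c Hh)).
  rewrite <- (CRInt_chasles _ a m b (curve_continuous_hor h d Hh)).
  rewrite <- (CRInt_chasles _ c n d (curve_continuous_ver h a Hh)).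
  rewrite <- (CRInt_chasles _ c n d (curve_continuous_ver h b Hh)).
  ring.
Qed.

Lemma rect_int_minus h k a b c d : plane_continuous h -> plane_continuous k ->
  rect_int (fun z => (h z - k z)%C) a b c d = (rect_int h a b c d - rect_int k a b c d)%C.
Proof.
  intros Hh Hk. unfold rect_int, hor, ver.
  rewrite (CRInt_minus _ _ a b (curve_continuous_hor h c Hh) (curve_continuous_hor k c Hk)).
  rewrite (CRInt_minus _ _ a b (curve_continuous_hor h d Hh) (curve_continuous_hor k d Hk)).
  rewrite (CRInt_minus _ _ c d (curve_continuous_ver h a Hh) (curve_continuous_ver k a Hk)).
  rewrite (CRInt_minus _ _ c d (curve_continuous_ver h b Hh) (curve_continuous_ver k b Hk)).
  ring.
Qed.

(** An affine function has a primitive; here the four sides are evaluated. *)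
Lemma rect_int_affine (u v : C) a b c d :
  rect_int (fun z => (u + v * z)%C) a b c d = RtoC 0.
Proof.
  unfold rect_int, hor, ver.
  assert (H : forall y, CRInt (fun x => (u + v * (x, y))%C) a b
     = (RtoC (b - a) * (u + v * (Ci * RtoC y)) + RtoC ((b * b - a * a) / 2) * v)%C).
  { intros y. rewrite <- (CRInt_affine _ _ a b).
    apply CRInt_ext. intros x.
    replace (x, y) with (RtoC x + Ci * RtoC y)%C
      by (apply injective_projections; simpl; ring). ring. }
  assert (V : forall x, CRInt (fun y => (u + v * (x, y))%C) c d
     = (RtoC (d - c) * (u + v * RtoC x) + RtoC ((d * d - c * c) / 2) * (v * Ci))%C).
  { intros x. rewrite <- (CRInt_affine _ _ c d).
    apply CRInt_ext. intros y.
    replace (x, y) with (RtoC x + Ci * RtoC y)%C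
      by (apply injective_projections; simpl; ring). ring. }
  rewrite !H, !V. destruct u as [u1 u2], v as [v1 v2].
  apply injective_projections; simpl; field.
Qed.

Lemma rect_int_bound h a b c d M : a <= b -> c <= d -> plane_continuous h ->
  (forall x y, a <= x <= b -> c <= y <= d -> Cmod (h (x, y)) <= M) ->
  Cmod (rect_int h a b c d) <= 2 * ((b - a) + (d - c)) * M.
Proof.
  intros Hab Hcd Hh HM. unfold rect_int, Cminus.
  assert (H1 : Cmod (hor h a b c) <= (b - a) * M).
  { apply CRInt_bound; [lra|now apply curve_continuous_hor|]. intros t Ht. apply HM; lra. }
  assert (H2 : Cmod (hor h a b d) <= (b - a) * M).
  { apply CRInt_bound; [lra|now apply curve_continuous_hor|]. intros t Ht. apply HM; lra. }
  assert (H3 : Cmod (ver h a c d) <= (d - c) * M).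
  { apply CRInt_bound; [lra|now apply curve_continuous_ver|]. intros t Ht. apply HM; lra. }
  assert (H4 : Cmod (ver h b c d) <= (d - c) * M).
  { apply CRInt_bound; [lra|now apply curve_continuous_ver|]. intros t Ht. apply HM; lra. }
  eapply Rle_trans; [apply Cmod_triangle|].
  eapply Rle_trans; [apply Rplus_le_compat_r, Cmod_triangle|].
  eapply Rle_trans; [apply Rplus_le_compat_r, Rplus_le_compat_r, Cmod_triangle|].
  rewrite !Cmod_opp, !Cmod_mult, Cmod_Ci. lra.
Qed.

(** Dependent choice selects the rectangles; their corners are monotone and bounded,
    so completeness supplies the common point. *)
Lemma nested_rectangles (Q : R -> R -> nat -> Prop) A B x0 y0 :
  0 <= A -> 0 <= B -> Q x0 y0 O ->
  (forall x y n, Q x y n -> exists x' y', Q x' y' (S n) /\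
     (x' = x \/ x' = x + A * (/ 2) ^ S n) /\ (y' = y \/ y' = y + B * (/ 2) ^ S n)) ->
  exists X Y, forall n, exists x y, Q x y n /\
    x <= X <= x + A * (/ 2) ^ n /\ y <= Y <= y + B * (/ 2) ^ n.
Proof.
  intros HA HB H0 Hstep.
  assert (S0 : {p : nat -> R * R | (forall n, Q (fst (p n)) (snd (p n)) n) /\
     forall n, (fst (p (S n)) = fst (p n) \/ fst (p (S n)) = fst (p n) + A * (/ 2) ^ S n) /\
               (snd (p (S n)) = snd (p n) \/ snd (p (S n)) = snd (p n) + B * (/ 2) ^ S n)}).
  { assert (nx : forall n (p : {p : R * R | Q (fst p) (snd p) n}),
      {p' : {p' : R * R | Q (fst p') (snd p') (S n)} |
        (fst (proj1_sig p') = fst (proj1_sig p) \/ fst (proj1_sig p') = fst (proj1_sig p) + A * (/ 2) ^ S n) /\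
        (snd (proj1_sig p') = snd (proj1_sig p) \/ snd (proj1_sig p') = snd (proj1_sig p) + B * (/ 2) ^ S n)}).
    { intros n [[x y] Hp]. apply constructive_indefinite_description.
      destruct (Hstep x y n Hp) as [x' [y' [HQ [Hx Hy]]]].
      exists (exist _ (x', y') HQ). simpl in *. auto. }
    set (s := fix s n : {p : R * R | Q (fst p) (snd p) n} :=
       match n with O => exist _ (x0, y0) H0 | S m => proj1_sig (nx m (s m)) end).
    exists (fun n => proj1_sig (s n)). split.
    - intros n. exact (proj2_sig (s n)).
    - intros n. exact (proj2_sig (nx n (s n))). }
  destruct S0 as [p [HQ Hp]].
  assert (lim : forall (u : nat -> R) D, 0 <= D ->
     (forall n, u (S n) = u n \/ u (S n) = u n + D * (/ 2) ^ S n) ->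
     exists X, forall n, u n <= X <= u n + D * (/ 2) ^ n).
  { intros u D HD Hu.
    assert (pw : forall n, 0 <= D * (/ 2) ^ n)
      by (intros n; apply Rmult_le_pos; [lra|apply pow_le; lra]).
    assert (up : forall n k, u n <= u (n + k)%nat /\
               u (n + k)%nat + D * (/ 2) ^ (n + k) <= u n + D * (/ 2) ^ n).
    { intros n k. induction k as [|k IH].
      - rewrite Nat.add_0_r. lra.
      - rewrite Nat.add_succ_r. pose proof (pw (S (n + k))) as P.
        destruct (Hu (n + k)%nat) as [E|E]; rewrite E; simpl in *; lra. }
    destruct (completeness (fun x => exists n, x = u n)) as [X [HX1 HX2]].
    - exists (u O + D). intros x [n ->]. destruct (up O n) as [_ E]. simpl in E.
      pose proof (pw n). lra.
    - exists (u O), O. reflexivity.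
    - exists X. intros n. split.
      + apply HX1. now exists n.
      + apply HX2. intros x [m ->].
        destruct (Nat.le_ge_cases n m) as [L|L].
        * replace m with (n + (m - n))%nat by lia.
          destruct (up n (m - n)%nat) as [_ E]. pose proof (pw (n + (m - n))%nat). lra.
        * destruct (up m (n - m)%nat) as [E _].
          replace (m + (n - m))%nat with n in E by lia. pose proof (pw n). lra. }
  destruct (lim (fun n => fst (p n)) A HA (fun n => proj1 (Hp n))) as [X HX].
  destruct (lim (fun n => snd (p n)) B HB (fun n => proj2 (Hp n))) as [Y HY].
  exists X, Y. intros n. exists (fst (p n)), (snd (p n)). auto.
Qed.

Lemma Cmod_le_sum (x y : R) : Cmod (x, y) <= Rabs x + Rabs y.
Proof.
  replace (x, y) with (RtoC x + Ci * RtoC y)%C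
    by (apply injective_projections; simpl; ring).
  eapply Rle_trans; [apply Cmod_triangle|].
  rewrite Cmod_mult, Cmod_Ci, !Cmod_R. lra.
Qed.

(** If the integral over a rectangle were nonzero, repeated quartering would
    produce rectangles shrinking to a point on which the integral stays at least
    proportional to the area; the affine approximation at that point forbids it. *)
Lemma goursat h a b c d : holo h -> a < b -> c < d -> rect_int h a b c d = RtoC 0.
Proof.
  intros Hh Hab Hcd. pose proof (holo_plane_continuous h Hh) as Hc.
  apply NNPP. intros Hne. apply Cmod_gt_0 in Hne.
  set (A := b - a) in *. set (B := d - c) in *.
  assert (HA : 0 < A) by (unfold A; lra). assert (HB : 0 < B) by (unfold B; lra).
  (* Halved so that the inequality of Q is strict at the start. *)
  set (e := Cmod (rect_int h a b c d) / (A * B) / 2).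
  assert (HAB : 0 < A * B) by now apply Rmult_lt_0_compat.
  assert (He : 0 < e).
  { unfold e. repeat apply Rdiv_lt_0_compat; lra. }
  set (Q := fun x y n => e * (A * B * (/ 4) ^ n)
     < Cmod (rect_int h x (x + A * (/ 2) ^ n) y (y + B * (/ 2) ^ n))).
  destruct (nested_rectangles Q A B a c) as [X [Y HXY]]; try lra.
  - unfold Q. simpl. rewrite !Rmult_1_r.
    replace (a + A) with b by (unfold A; ring). replace (c + B) with d by (unfold B; ring).
    replace (e * (A * B)) with (Cmod (rect_int h a b c d) / 2) by (unfold e; field; lra).
    lra.
  - intros x y n HQ. apply NNPP. intros Hno.
    set (sA := A * (/ 2) ^ S n) in *. set (sB := B * (/ 2) ^ S n) in *.
    assert (HN : forall x' y', (x' = x \/ x' = x + sA) -> (y' = y \/ y' = y + sB) ->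
      Cmod (rect_int h x' (x' + sA) y' (y' + sB)) <= e * (A * B * (/ 4) ^ S n)).
    { intros x' y' Hx Hy. apply Rnot_lt_le. intros Hlt. apply Hno.
      exists x', y'. auto. }
    unfold Q in HQ.
    replace (A * (/ 2) ^ n) with (sA + sA) in HQ by (unfold sA; simpl; field).
    replace (B * (/ 2) ^ n) with (sB + sB) in HQ by (unfold sB; simpl; field).
    rewrite <- !Rplus_assoc in HQ.
    rewrite (rect_int_split h x (x + sA) (x + sA + sA) y (y + sB) (y + sB + sB) Hc) in HQ.
    pose proof (HN x y (or_introl eq_refl) (or_introl eq_refl)) as K1.
    pose proof (HN (x + sA) y (or_intror eq_refl) (or_introl eq_refl)) as K2.
    pose proof (HN x (y + sB) (or_introl eq_refl) (or_intror eq_refl)) as K3.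
    pose proof (HN (x + sA) (y + sB) (or_intror eq_refl) (or_intror eq_refl)) as K4.
    match type of HQ with _ < Cmod (?p + ?q + ?r + ?s) =>
      pose proof (Cmod_triangle (p + q + r) s);
      pose proof (Cmod_triangle (p + q) r); pose proof (Cmod_triangle p q) end.
    simpl in K1, K2, K3, K4. lra.
  - destruct (Hh (X, Y)) as [l Hl].
    (* A perimeter 2 (A + B) t and a diameter at most (A + B) t give the factor
       2 (A + B)^2 t^2; this eta makes the product half of e times the area. *)
    set (eta := e * (A * B) / (4 * (A + B) * (A + B))).
    assert (Heta : 0 < eta).
    { unfold eta. apply Rdiv_lt_0_compat; [now apply Rmult_lt_0_compat|].
      repeat apply Rmult_lt_0_compat; lra. }
    destruct (Hl eta Heta) as [del [Hdel Hd]].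
    destruct (pow_lt_1_zero (/ 2)) with (y := del / (A + B)) as [n Hn].
    { rewrite Rabs_right; lra. }
    { apply Rdiv_lt_0_compat; lra. }
    specialize (Hn n (le_n n)). rewrite Rabs_right in Hn by (apply Rle_ge, pow_le; lra).
    set (t := (/ 2) ^ n) in *.
    assert (Ht : 0 < t) by (unfold t; apply pow_lt; lra).
    assert (Htd : (A + B) * t < del).
    { apply (Rmult_lt_compat_l (A + B)) in Hn; [|lra].
      replace ((A + B) * (del / (A + B))) with del in Hn; [assumption|field; lra]. }
    destruct (HXY n) as [x [y [HQ [Hx Hy]]]]. fold t in HQ, Hx, Hy. unfold Q in HQ. fold t in HQ.
    assert (At : 0 < A * t) by now apply Rmult_lt_0_compat.
    assert (Bt : 0 < B * t) by now apply Rmult_lt_0_compat.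
    set (k := fun z : C => ((h (X, Y) - l * (X, Y)) + l * z)%C).
    assert (Hk : plane_continuous k).
    { apply holo_plane_continuous, holo_plus; [apply holo_const|apply holo_scal, holo_id]. }
    assert (E : Cmod (rect_int (fun z => (h z - k z)%C) x (x + A * t) y (y + B * t))
                <= 2 * ((x + A * t - x) + (y + B * t - y)) * (eta * ((A + B) * t))).
    { apply rect_int_bound; [lra|lra| |].
      - apply holo_plane_continuous, holo_minus; [assumption|].
        apply holo_plus; [apply holo_const|apply holo_scal, holo_id].
      - intros u v Hu Hv.
        assert (Hm : Cmod ((u, v) - (X, Y)) <= (A + B) * t).
        { replace ((u, v) - (X, Y))%C with (u - X, v - Y)
            by (apply injective_projections; simpl; ring).
          eapply Rle_trans; [apply Cmod_le_sum|].
          assert (Rabs (u - X) <= A * t) by (apply Rabs_le; lra).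
          assert (Rabs (v - Y) <= B * t) by (apply Rabs_le; lra). lra. }
        replace (h (u, v) - k (u, v))%C with
          (h (u, v) - h (X, Y) - l * ((u, v) - (X, Y)))%C by (unfold k; ring).
        eapply Rle_trans; [apply Hd; lra|].
        apply Rmult_le_compat_l; lra. }
    rewrite rect_int_minus in E by assumption.
    unfold k in E. rewrite rect_int_affine in E.
    replace (rect_int h x (x + A * t) y (y + B * t) - RtoC 0)%C
      with (rect_int h x (x + A * t) y (y + B * t)) in E by ring.
    replace (2 * (x + A * t - x + (y + B * t - y)) * (eta * ((A + B) * t)))
      with (e * (A * B * (t * t)) / 2) in E
      by (unfold eta; field; lra).
    assert (F : (/ 4) ^ n = t * t).
    { unfold t. rewrite <- Rpow_mult_distr. f_equal. field. }
    rewrite F in HQ.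
    assert (0 < e * (A * B * (t * t))).
    { apply Rmult_lt_0_compat; [exact He|]. apply Rmult_lt_0_compat; [exact HAB|].
      now apply Rmult_lt_0_compat. }
    lra.
Qed.

(** * The complex exponential *)

Lemma Cexp_add z w : Cexp (z + w) = (Cexp z * Cexp w)%C.
Proof.
  destruct z as [a b], w as [c d]. unfold Cexp; simpl.
  rewrite exp_plus, cos_plus, sin_plus. apply injective_projections; simpl; ring.
Qed.

Lemma Cexp_0 : Cexp (RtoC 0) = RtoC 1.
Proof.
  unfold Cexp; simpl. rewrite exp_0, cos_0, sin_0.
  apply injective_projections; simpl; ring.
Qed.

Lemma Cmod_Cexp z : Cmod (Cexp z) = exp (Re z).
Proof.
  destruct z as [a b]. unfold Cexp, Cmod; simpl.
  replace (exp a * cos b * (exp a * cos b * 1) + exp a * sin b * (exp a * sin b * 1))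
    with (exp a * exp a).
  - apply sqrt_square. left; apply exp_pos.
  - pose proof (sin2_cos2 b) as E. unfold Rsqr in E.
    transitivity (exp a * exp a * (sin b * sin b + cos b * cos b)); [rewrite E|]; ring.
Qed.

Lemma Rabs_sin_le u : Rabs (sin u) <= Rabs u.
Proof.
  destruct (MVT_gen sin 0 u cos) as [c [_ Hc]].
  - intros x _. auto_derive; [easy|ring].
  - intros x _. apply continuity_sin.
  - rewrite sin_0, !Rminus_0_r in Hc. rewrite Hc, Rabs_mult.
    rewrite <- (Rmult_1_l (Rabs u)) at 2. apply Rmult_le_compat_r; [apply Rabs_pos|].
    apply Rabs_le. apply COS_bound.
Qed.

Lemma one_minus_cos_bounds y : 0 <= 1 - cos y /\ 1 - cos y <= y * y /\ 1 - cos y <= Rabs y.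
Proof.
  assert (E : 1 - cos y = 2 * (sin (y / 2) * sin (y / 2))).
  { replace (cos y) with (cos (2 * (y / 2))) by (f_equal; field). rewrite cos_2a_sin. ring. }
  assert (E2 : sin (y / 2) * sin (y / 2) = Rabs (sin (y / 2)) * Rabs (sin (y / 2))).
  { rewrite <- Rabs_mult. symmetry. apply Rabs_right, Rle_ge, Rle_0_sqr. }
  pose proof (Rabs_sin_le (y / 2)) as H.
  pose proof (Rabs_pos (sin (y / 2))) as H0.
  assert (H1 : Rabs (sin (y / 2)) <= 1) by (apply Rabs_le, SIN_bound).
  assert (E3 : Rabs (y / 2) = Rabs y / 2).
  { unfold Rdiv. rewrite Rabs_mult. f_equal. apply Rabs_right. lra. }
  assert (E4 : Rabs y * Rabs y = y * y).
  { rewrite <- Rabs_mult. apply Rabs_right, Rle_ge, Rle_0_sqr. }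
  rewrite E, E2. rewrite E3 in H. repeat split; nra.
Qed.

Lemma Rabs_sin_minus_le y : Rabs (sin y - y) <= y * y.
Proof.
  destruct (MVT_gen (fun t => sin t - t) 0 y (fun t => cos t - 1)) as [c [Hc1 Hc]].
  - intros x _. auto_derive; [easy|ring].
  - intros x _. apply continuity_pt_filterlim.
    apply (ex_derive_continuous (V := R_NormedModule) (fun t => sin t - t) x).
    auto_derive. easy.
  - rewrite sin_0, !Rminus_0_r in Hc. rewrite Hc, Rabs_mult.
    destruct (one_minus_cos_bounds c) as [H0 [_ H1]].
    assert (Hcy : Rabs c <= Rabs y).
    { destruct (Rle_dec 0 y) as [L|L].
      - rewrite Rmin_left, Rmax_right in Hc1 by lra. rewrite !Rabs_right; lra.
      - rewrite Rmin_right, Rmax_left in Hc1 by lra. rewrite !Rabs_left1; lra. }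
    assert (E4 : Rabs y * Rabs y = y * y).
    { rewrite <- Rabs_mult. apply Rabs_right, Rle_ge, Rle_0_sqr. }
    rewrite <- E4. apply Rmult_le_compat_r; [apply Rabs_pos|].
    rewrite Rabs_left1; lra.
Qed.

Lemma exp_minus_1_bounds x : x <= exp x - 1 <= x * exp x.
Proof.
  split; [pose proof (exp_ineq1_le x); lra|].
  pose proof (exp_ineq1_le (- x)) as H. pose proof (exp_pos x).
  apply (Rmult_le_compat_r (exp x)) in H; [|lra].
  rewrite <- exp_plus, Rplus_opp_l, exp_0 in H. lra.
Qed.

Lemma exp_le_mono x y : x <= y -> exp x <= exp y.
Proof. intros [H|H]; [left; now apply exp_increasing|right; now subst]. Qed.

(** The real and imaginary parts are estimated separately, with
    [exp x cos y - 1 - x = (exp x - 1 - x) - exp x (1 - cos y)] and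
    [exp x sin y - y = (exp x - 1) y + exp x (sin y - y)]. *)
Lemma Cexp_remainder w : Cmod (Cexp w - RtoC 1 - w) <= 2 * (Cmod w * Cmod w) * exp (Cmod w).
Proof.
  destruct w as [x y].
  assert (HC : Cmod (x, y) * Cmod (x, y) = x * x + y * y).
  { unfold Cmod. simpl. rewrite sqrt_sqrt; [ring|]. nra. }
  pose proof (re_le_Cmod (x, y)) as Hx. simpl in Hx.
  assert (E1 : exp x <= exp (Cmod (x, y))).
  { apply exp_le_mono. pose proof (Rle_abs x). lra. }
  set (m := exp (Cmod (x, y))) in *. rewrite HC.
  assert (Hm : 1 <= m).
  { unfold m. pose proof (exp_ineq1_le (Cmod (x, y))). pose proof (Cmod_ge_0 (x, y)). lra. }
  replace (Cexp (x, y) - RtoC 1 - (x, y))%C with (exp x * cos y - 1 - x, exp x * sin y - y)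
    by (apply injective_projections; simpl; ring).
  eapply Rle_trans; [apply Cmod_le_sum|].
  pose proof (exp_minus_1_bounds x) as Ex. pose proof (exp_pos x).
  destruct (one_minus_cos_bounds y) as [Hc0 [Hc1 _]].
  pose proof (Rabs_sin_minus_le y) as Hs.
  assert (Ea : Rabs (exp x - 1) <= Rabs x * m).
  { apply Rabs_le. destruct (Rle_dec 0 x); [rewrite Rabs_right by lra|rewrite Rabs_left by lra]; nra. }
  assert (Ec : 0 <= 1 - cos y <= y * y / 2).
  { split; [lra|].
    replace (cos y) with (cos (2 * (y / 2))) by (f_equal; field). rewrite cos_2a_sin.
    pose proof (Rabs_sin_le (y / 2)) as H1.
    assert (H2 : Rabs (sin (y / 2)) * Rabs (sin (y / 2)) <= Rabs (y / 2) * Rabs (y / 2)).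
    { apply Rmult_le_compat; try apply Rabs_pos; assumption. }
    rewrite <- !Rabs_mult in H2.
    rewrite (Rabs_right (sin (y / 2) * _)) in H2 by apply Rle_ge, Rle_0_sqr.
    rewrite (Rabs_right (y / 2 * _)) in H2 by apply Rle_ge, Rle_0_sqr. lra. }
  assert (A1 : Rabs (exp x * cos y - 1 - x) <= x * x * m + y * y / 2 * m).
  { replace (exp x * cos y - 1 - x) with ((exp x - 1 - x) - exp x * (1 - cos y)) by ring.
    assert (0 <= exp x - 1 - x <= x * x * m).
    { split; [lra|]. apply Rle_trans with (x * (exp x - 1)); [lra|].
      replace (x * x * m) with (x * (x * m)) by ring.
      destruct (Rle_dec 0 x).
      - apply Rmult_le_compat_l; [assumption|].
        apply Rle_trans with (x * exp x); [lra|]. now apply Rmult_le_compat_l.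
      - apply Rmult_le_compat_neg_l; nra. }
    assert (0 <= exp x * (1 - cos y) <= y * y / 2 * m) by nra.
    apply Rabs_le. nra. }
  assert (A2 : Rabs (exp x * sin y - y) <= Rabs x * Rabs y * m + y * y * m).
  { replace (exp x * sin y - y) with ((exp x - 1) * y + exp x * (sin y - y)) by ring.
    eapply Rle_trans; [apply Rabs_triang|]. rewrite !Rabs_mult.
    rewrite (Rabs_right (exp x)) by lra.
    pose proof (Rabs_pos y). pose proof (Rabs_pos (sin y - y)). nra. }
  assert (A3 : Rabs x * Rabs y <= (x * x + y * y) / 2).
  { assert (E4 : forall u, Rabs u * Rabs u = u * u).
    { intros u. rewrite <- Rabs_mult. apply Rabs_right, Rle_ge, Rle_0_sqr. }
    pose proof (E4 x). pose proof (E4 y).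
    pose proof (Rle_0_sqr (Rabs x - Rabs y)) as Sq. unfold Rsqr in Sq. lra. }
  assert (A4 : Rabs x * Rabs y * m <= (x * x + y * y) / 2 * m) by (apply Rmult_le_compat_r; lra).
  assert (0 <= x * x * m) by (apply Rmult_le_pos; [apply Rle_0_sqr|lra]).
  nra.
Qed.

Lemma cdiff_Cexp z : cdiff Cexp z (Cexp z).
Proof.
  intros eps Heps.
  set (K := Cmod (Cexp z) * (2 * exp 1)).
  assert (HK : 0 < K).
  { unfold K. rewrite Cmod_Cexp. pose proof (exp_pos (Re z)). pose proof (exp_pos 1).
    apply Rmult_lt_0_compat; lra. }
  exists (Rmin 1 (eps / K)). split.
  { apply Rmin_pos; [lra|now apply Rdiv_lt_0_compat]. }
  intros w Hw.
  pose proof (Rlt_le_trans _ _ _ Hw (Rmin_l _ _)) as H1.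
  pose proof (Rlt_le_trans _ _ _ Hw (Rmin_r _ _)) as H2.
  replace (Cexp w) with (Cexp z * Cexp (w - z))%C
    by (rewrite <- Cexp_add; f_equal; ring).
  replace (Cexp z * Cexp (w - z) - Cexp z - Cexp z * (w - z))%C
    with (Cexp z * (Cexp (w - z) - RtoC 1 - (w - z)))%C by ring.
  rewrite Cmod_mult. pose proof (Cexp_remainder (w - z)) as HR.
  pose proof (Cmod_ge_0 (w - z)) as Hp.
  assert (He : exp (Cmod (w - z)) <= exp 1) by (apply exp_le_mono; lra).
  apply Rle_trans with (K * Cmod (w - z) * Cmod (w - z)).
  - unfold K. replace (Cmod (Cexp z) * (2 * exp 1) * Cmod (w - z) * Cmod (w - z))
      with (Cmod (Cexp z) * (2 * (Cmod (w - z) * Cmod (w - z)) * exp 1)) by ring.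
    apply Rmult_le_compat_l; [apply Cmod_ge_0|].
    eapply Rle_trans; [apply HR|]. apply Rmult_le_compat_l; [nra|assumption].
  - apply Rmult_le_compat_r; [assumption|].
    apply (Rmult_lt_compat_l K) in H2; [|assumption].
    replace (K * (eps / K)) with eps in H2 by (field; lra). lra.
Qed.

Lemma holo_Cexp : holo Cexp.
Proof. intros z. eexists. apply cdiff_Cexp. Qed.

(** * The identity theorem *)

Lemma Cmod_triangle_rev a b : Rabs (Cmod a - Cmod b) <= Cmod (a - b).
Proof.
  pose proof (Cmod_triangle (a - b) b) as H1. pose proof (Cmod_triangle (b - a) a) as H2.
  replace (a - b + b)%C with a in H1 by ring. replace (b - a + a)%C with b in H2 by ring.
  replace (b - a)%C with (- (a - b))%C in H2 by ring. rewrite Cmod_opp in H2.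
  apply Rabs_le. lra.
Qed.

Lemma curve_continuous_bounded (f : R -> C) a b : a <= b -> curve_continuous f ->
  exists M, forall t, a <= t <= b -> Cmod (f t) <= M.
Proof.
  intros Hab Hf.
  destruct (continuity_ab_maj (fun t => Cmod (f t)) a b Hab) as [m [Hm _]].
  - intros t _ eps Heps. destruct (Hf t eps Heps) as [d [Hd H]].
    exists d. split; [assumption|]. intros t' [_ Ht']. simpl in *. unfold Rdist in *.
    eapply Rle_lt_trans; [apply Cmod_triangle_rev|]. now apply H.
  - exists (Cmod (f m)). exact Hm.
Qed.

(** Goursat's theorem for [G (exp w)] on the rectangle with sides [-T, 0] and
    [0, 2 pi]: its horizontal sides cancel, and its left side tends to
    [2 pi G(0)] as T grows. *)
Lemma mean_value_bound G M : holo G ->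
  (forall t, Cmod (G (cos t, sin t)) <= M) -> Cmod (G (RtoC 0)) <= M.
Proof.
  intros HG HM.
  set (h := fun w => G (Cexp w)).
  assert (Hh : holo h) by exact (holo_comp G Cexp HG holo_Cexp).
  pose proof (holo_plane_continuous h Hh) as Hc. pose proof PI_RGT_0 as Hpi.
  assert (HV : forall T, 0 < T -> ver h 0 0 (2 * PI) = ver h (- T) 0 (2 * PI)).
  { intros T HT. pose proof (goursat h (- T) 0 0 (2 * PI) Hh ltac:(lra) ltac:(lra)) as E.
    unfold rect_int in E.
    assert (E1 : hor h (- T) 0 0 = hor h (- T) 0 (2 * PI)).
    { apply CRInt_ext. intros x. unfold h, Cexp; simpl.
      rewrite cos_0, sin_0, cos_2PI, sin_2PI. reflexivity. }
    rewrite E1 in E.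
    assert (E2 : (Ci * (ver h 0 0 (2 * PI) - ver h (- T) 0 (2 * PI)) = RtoC 0)%C).
    { rewrite <- E. ring. }
    assert (E3 : (Ci * (Ci * (ver h 0 0 (2 * PI) - ver h (- T) 0 (2 * PI))) = RtoC 0)%C).
    { rewrite E2. ring. }
    assert (E4 : (Ci * Ci = - RtoC 1)%C) by (apply injective_projections; simpl; ring).
    rewrite Cmult_assoc, E4 in E3.
    set (u := ver h 0 0 (2 * PI)) in *. set (v := ver h (- T) 0 (2 * PI)) in *.
    replace u with (v - (- RtoC 1 * (u - v)))%C by ring. rewrite E3. ring. }
  apply Rnot_lt_le. intros Hlt. set (e := Cmod (G (RtoC 0)) - M).
  destruct (holo_plane_continuous G HG (RtoC 0) (e / 2)) as [d [Hd HGd]]; [unfold e; lra|].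
  set (T := Rmax 1 (1 - ln d)).
  assert (HT : 0 < T) by (unfold T; pose proof (Rmax_l 1 (1 - ln d)); lra).
  assert (Hexp : exp (- T) < d).
  { rewrite <- (exp_ln d Hd). apply exp_increasing.
    unfold T; pose proof (Rmax_r 1 (1 - ln d)); lra. }
  assert (Hv0 : Cmod (ver h 0 0 (2 * PI)) <= (2 * PI - 0) * M).
  { apply CRInt_bound; [lra|now apply curve_continuous_ver|]. intros t _.
    unfold h, Cexp; simpl. rewrite exp_0, !Rmult_1_l. apply HM. }
  assert (Hd0 : Cmod (ver (fun w => (h w - G (RtoC 0))%C) (- T) 0 (2 * PI))
                <= (2 * PI - 0) * (e / 2)).
  { apply CRInt_bound; [lra| |].
    - apply (curve_continuous_ver (fun w => (h w - G (RtoC 0))%C)), holo_plane_continuous, holo_minus;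
        [assumption|apply holo_const].
    - intros t _. left. unfold h. apply HGd.
      replace (Cexp ((- T)%R, t) - RtoC 0)%C with (Cexp ((- T)%R, t)) by ring.
      rewrite Cmod_Cexp. exact Hexp. }
  assert (Hk : ver (fun _ => G (RtoC 0)) (- T) 0 (2 * PI) = (RtoC (2 * PI) * G (RtoC 0))%C).
  { unfold ver. transitivity (CRInt (fun t => (G (RtoC 0) + RtoC t * RtoC 0)%C) 0 (2 * PI)).
    - apply CRInt_ext. intros t. ring.
    - rewrite CRInt_affine, Rminus_0_r. ring. }
  assert (Ed : ver (fun w => (h w - G (RtoC 0))%C) (- T) 0 (2 * PI)
     = (ver h (- T) 0 (2 * PI) - RtoC (2 * PI) * G (RtoC 0))%C).
  { rewrite <- Hk. apply CRInt_minus; [now apply curve_continuous_ver|].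
    exact (curve_continuous_ver (fun _ => G (RtoC 0)) (- T) (holo_plane_continuous _ (holo_const _))). }
  rewrite Ed, <- (HV T HT) in Hd0.
  pose proof (Cmod_triangle_rev (ver h 0 0 (2 * PI)) (RtoC (2 * PI) * G (RtoC 0))) as Htr.
  rewrite (Cmod_mult (RtoC _)), Cmod_R, (Rabs_right (2 * PI)) in Htr by lra.
  apply Rabs_le_between in Htr. unfold e in *.
  assert (2 * PI * Cmod (G (RtoC 0)) <= 2 * PI * M + 2 * PI * ((Cmod (G (RtoC 0)) - M) / 2)) by lra.
  assert (0 < 2 * PI * ((Cmod (G (RtoC 0)) - M) / 2)) by (apply Rmult_lt_0_compat; lra).
  lra.
Qed.

(** On the unit circle, [Re (u + u^2 / 2) <= -1/4] wherever [1/2 + 4 u] lies in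
    the half plane [Re <= 1].  Multiplying D by a large power of the exponential
    of this polynomial therefore makes it small on the whole circle without
    changing its value at the centre. *)
Lemma holo_zero_half_plane D : holo D -> (forall z, 1 < Re z -> D z = RtoC 0) ->
  D (RtoC (1 / 2)) = RtoC 0.
Proof.
  intros HD H0.
  set (p := fun u : C => (RtoC (1 / 2) + RtoC 4 * u)%C).
  set (P := fun u : C => (u + RtoC (1 / 2) * (u * u))%C).
  assert (Hp : holo p) by (apply holo_plus; [apply holo_const|apply holo_scal, holo_id]).
  assert (HP : holo P).
  { apply holo_plus; [apply holo_id|]. apply holo_scal, holo_mult; apply holo_id. }
  assert (HDp : holo (fun u => D (p u))) by exact (holo_comp D p HD Hp).
  assert (Hcirc : curve_continuous (fun t => D (p (cos t, sin t)))).
  { pose proof (curve_continuous_ver _ 0 (holo_plane_continuous _ (holo_comp (fun u => D (p u)) Cexp HDp holo_Cexp))) as Hv.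
    intros t eps Heps. destruct (Hv t eps Heps) as [d [Hd H]]. exists d. split; [assumption|].
    intros t' Ht'. specialize (H t' Ht'). unfold Cexp in H; simpl in H.
    rewrite exp_0, !Rmult_1_l in H. exact H. }
  destruct (curve_continuous_bounded _ 0 (2 * PI) ltac:(pose proof PI_RGT_0; lra) Hcirc) as [M HM].
  assert (HM0 : 0 <= M).
  { eapply Rle_trans; [apply Cmod_ge_0|]. apply (HM 0). pose proof PI_RGT_0. lra. }
  assert (HM' : forall t, Cmod (D (p (cos t, sin t))) <= M).
  { intros t. pose proof PI_RGT_0 as Hpi.
    (* Compactness gives a bound on one period only. *)
    set (k := Int_part (t / (2 * PI))).
    destruct (base_Int_part (t / (2 * PI))) as [B1 B2]. fold k in B1, B2.
    assert (Et : t = t / (2 * PI) * (2 * PI)) by (field; lra).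
    set (t0 := t - IZR k * (2 * PI)).
    assert (T0 : 0 <= t0 <= 2 * PI).
    { unfold t0. rewrite Et. split.
      - assert (0 <= (t / (2 * PI) - IZR k) * (2 * PI)) by (apply Rmult_le_pos; lra). lra.
      - assert ((t / (2 * PI) - IZR k) * (2 * PI) <= 1 * (2 * PI))
          by (apply Rmult_le_compat_r; lra). lra. }
    assert (per : forall x (n : nat), cos (x + INR n * (2 * PI)) = cos x /\
               sin (x + INR n * (2 * PI)) = sin x).
    { intros x n. replace (INR n * (2 * PI)) with (2 * INR n * PI) by ring.
      split; [apply cos_period|apply sin_period]. }
    assert (perZ : cos t = cos t0 /\ sin t = sin t0).
    { destruct (Z_le_gt_dec 0 k) as [L|L].
      - destruct (per t0 (Z.to_nat k)) as [P1 P2].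
        rewrite INR_IZR_INZ, Z2Nat.id in P1, P2 by assumption.
        replace (t0 + IZR k * (2 * PI)) with t in P1, P2 by (unfold t0; ring). auto.
      - destruct (per t (Z.to_nat (- k))) as [P1 P2].
        rewrite INR_IZR_INZ, Z2Nat.id in P1, P2 by lia. rewrite opp_IZR in P1, P2.
        replace (t + - IZR k * (2 * PI)) with t0 in P1, P2 by (unfold t0; ring). auto. }
    destruct perZ as [-> ->]. now apply HM. }
  assert (Hl : forall lam, 0 <= lam -> Cmod (D (RtoC (1 / 2))) <= M * exp (- (lam / 4))).
  { intros lam Hlam.
    set (G := fun u => (D (p u) * Cexp (RtoC lam * P u))%C).
    assert (HG : holo G).
    { apply holo_mult; [assumption|].
      apply (holo_comp Cexp (fun u => (RtoC lam * P u)%C)); [apply holo_Cexp|now apply holo_scal]. }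
    assert (E0 : G (RtoC 0) = D (RtoC (1 / 2))).
    { unfold G, p, P.
      replace (RtoC (1 / 2) + RtoC 4 * RtoC 0)%C with (RtoC (1 / 2)) by ring.
      replace (RtoC lam * (RtoC 0 + RtoC (1 / 2) * (RtoC 0 * RtoC 0)))%C with (RtoC 0) by ring.
      rewrite Cexp_0. ring. }
    rewrite <- E0. apply mean_value_bound; [assumption|]. intros t. unfold G.
    destruct (Rlt_dec (1 / 8) (cos t)) as [L|L].
    - rewrite H0 by (unfold p; simpl; lra).
      rewrite Cmult_0_l, Cmod_0. apply Rmult_le_pos; [assumption|left; apply exp_pos].
    - rewrite Cmod_mult. apply Rmult_le_compat; try apply Cmod_ge_0; [apply HM'|].
      rewrite Cmod_Cexp. apply exp_le_mono.
      pose proof (sin2_cos2 t) as E. unfold Rsqr in E.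
      pose proof (COS_bound t) as Cb. unfold P; simpl.
      assert (A : cos t + (cos t * cos t - sin t * sin t) / 2 <= - (1 / 4)).
      { nra. }
      assert (lam * (cos t + (cos t * cos t - sin t * sin t) / 2) <= lam * (- (1 / 4)))
        by now apply Rmult_le_compat_l.
      lra. }
  apply NNPP. intros Hne. apply Cmod_gt_0 in Hne. set (v := Cmod (D (RtoC (1 / 2)))) in *.
  set (lam := 4 * (M / v)).
  assert (Hlam : 0 <= M / v) by (apply Rmult_le_pos; [assumption|left; now apply Rinv_0_lt_compat]).
  assert (HL : v <= M * exp (- (lam / 4))) by (apply Hl; unfold lam; lra).
  replace (lam / 4) with (M / v) in HL by (unfold lam; field; lra).
  pose proof (exp_ineq1_le (M / v)) as Hx. pose proof (exp_pos (- (M / v))) as Hp'.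
  assert (E1 : exp (- (M / v)) * exp (M / v) = 1)
    by (rewrite <- exp_plus, Rplus_opp_l; apply exp_0).
  assert (Mv : M = M / v * v) by (field; lra).
  apply (Rmult_le_compat_r (exp (M / v))) in HL; [|left; apply exp_pos].
  rewrite Rmult_assoc, E1, Rmult_1_r in HL.
  assert (v * (M / v + 1) <= M).
  { eapply Rle_trans; [|apply HL]. apply Rmult_le_compat_l; lra. }
  lra.
Qed.

(** * Limits and partial sums of complex sequences *)

Definition clim (f : nat -> C) (l : C) : Prop :=
  forall eps, 0 < eps -> exists N, forall n, (N <= n)%nat -> Cmod (f n - l) < eps.

Lemma clim_unique f l m : clim f l -> clim f m -> l = m.
Proof.
  intros Hl Hm. apply NNPP. intros Hne.
  assert (Hp : 0 < Cmod (l - m)).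
  { apply Cmod_gt_0. intros E. apply Hne.
    replace l with ((l - m) + m)%C by ring. rewrite E. ring. }
  destruct (Hl (Cmod (l - m) / 2)) as [N1 H1]; [lra|].
  destruct (Hm (Cmod (l - m) / 2)) as [N2 H2]; [lra|].
  specialize (H1 (N1 + N2)%nat ltac:(lia)). specialize (H2 (N1 + N2)%nat ltac:(lia)).
  pose proof (Cmod_triangle (f (N1 + N2)%nat - m) (- (f (N1 + N2)%nat - l))) as T.
  rewrite Cmod_opp in T.
  replace (f (N1 + N2)%nat - m + - (f (N1 + N2)%nat - l))%C with (l - m)%C in T by ring.
  lra.
Qed.

Lemma clim_const c : clim (fun _ => c) c.
Proof.
  intros eps He. exists O. intros n _. replace (c - c)%C with (RtoC 0) by ring.
  now rewrite Cmod_0.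
Qed.

Lemma clim_ext f g l : (forall n, f n = g n) -> clim f l -> clim g l.
Proof.
  intros E H eps He. destruct (H eps He) as [N HN]. exists N. intros n Hn.
  rewrite <- E. now apply HN.
Qed.

Lemma clim_plus f g l m : clim f l -> clim g m -> clim (fun n => (f n + g n)%C) (l + m)%C.
Proof.
  intros Hf Hg eps He.
  destruct (Hf (eps / 2)) as [N1 H1]; [lra|]. destruct (Hg (eps / 2)) as [N2 H2]; [lra|].
  exists (N1 + N2)%nat. intros n Hn.
  specialize (H1 n ltac:(lia)). specialize (H2 n ltac:(lia)).
  replace (f n + g n - (l + m))%C with ((f n - l) + (g n - m))%C by ring.
  eapply Rle_lt_trans; [apply Cmod_triangle|]. lra.
Qed.

Lemma clim_bounded_0 f g B : (forall n, Cmod (f n) <= B) -> clim g (RtoC 0) ->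
  clim (fun n => (f n * g n)%C) (RtoC 0).
Proof.
  intros HB Hg eps He.
  assert (HB0 : 0 <= B) by (eapply Rle_trans; [apply Cmod_ge_0|apply (HB O)]).
  destruct (Hg (eps / (B + 1))) as [N HN]; [apply Rdiv_lt_0_compat; lra|].
  exists N. intros n Hn. specialize (HN n Hn).
  replace (f n * g n - RtoC 0)%C with (f n * (g n - RtoC 0))%C by ring.
  rewrite Cmod_mult. apply Rle_lt_trans with (B * (eps / (B + 1))).
  - apply Rmult_le_compat; try apply Cmod_ge_0; [apply HB|lra].
  - apply Rlt_le_trans with ((B + 1) * (eps / (B + 1))).
    + apply Rmult_lt_compat_r; [apply Rdiv_lt_0_compat; lra|lra].
    + right; field; lra.
Qed.

Lemma clim_scal c f l : clim f l -> clim (fun n => (c * f n)%C) (c * l)%C.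
Proof.
  intros Hf.
  assert (H0 : clim (fun n => (f n - l)%C) (RtoC 0)).
  { intros eps He. destruct (Hf eps He) as [N HN]. exists N. intros n Hn.
    replace (f n - l - RtoC 0)%C with (f n - l)%C by ring. now apply HN. }
  pose proof (clim_bounded_0 (fun _ => c) _ (Cmod c) (fun _ => Rle_refl _) H0) as H1.
  pose proof (clim_plus _ _ _ _ H1 (clim_const (c * l)%C)) as H2.
  replace (c * l)%C with (RtoC 0 + c * l)%C by ring.
  eapply clim_ext; [|exact H2]. intros n. simpl. ring.
Qed.

Lemma clim_Cmod_le f l M : clim f l -> (forall n, Cmod (f n) <= M) -> Cmod l <= M.
Proof.
  intros Hf HM. apply Rnot_lt_le. intros Hlt.
  destruct (Hf (Cmod l - M)) as [N HN]; [lra|]. specialize (HN N (le_n _)).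
  pose proof (Cmod_triangle_rev (f N) l) as T. apply Rabs_le_between in T.
  specialize (HM N). lra.
Qed.

Lemma clim_shift f l : clim f l -> clim (fun n => f (S n)) l.
Proof.
  intros H eps He. destruct (H eps He) as [N HN]. exists N. intros n Hn. apply HN. lia.
Qed.

Fixpoint csum (f : nat -> C) (n : nat) : C :=
  match n with O => RtoC 0 | S m => (csum f m + f m)%C end.

Lemma csum_ext f g n : (forall k, (k < n)%nat -> f k = g k) -> csum f n = csum g n.
Proof.
  induction n as [|n IH]; intros H; [reflexivity|]. simpl. rewrite IH, H; auto.
Qed.

Lemma csum_plus f g n : csum (fun k => (f k + g k)%C) n = (csum f n + csum g n)%C.
Proof. induction n as [|n IH]; simpl; [ring|rewrite IH; ring]. Qed.

Lemma csum_scal c f n : csum (fun k => (c * f k)%C) n = (c * csum f n)%C.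
Proof. induction n as [|n IH]; simpl; [ring|rewrite IH; ring]. Qed.

Lemma csum_const c n : csum (fun _ => c) n = (RtoC (INR n) * c)%C.
Proof.
  induction n as [|n IH]; [simpl; ring|].
  rewrite S_INR, RtoC_plus. simpl csum. rewrite IH. ring.
Qed.

Lemma csum_add f n m : csum f (n + m) = (csum f n + csum (fun k => f (n + k)%nat) m)%C.
Proof.
  induction m as [|m IH]; [rewrite Nat.add_0_r; simpl; ring|].
  rewrite Nat.add_succ_r. simpl. rewrite IH. ring.
Qed.

(** Telescoping, by [1/x^2 <= 2 (1/x - 1/(x+1))] for [x >= 1]. *)
Lemma csum_quadratic_tail f c n m : 0 <= c ->
  (forall k, Cmod (f k) <= c * / (INR (S k) * INR (S k))) ->
  Cmod (csum f (n + m) - csum f n) <= 2 * c * (/ INR (S n) - / INR (S (n + m))).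
Proof.
  intros Hc Hf. induction m as [|m IH].
  - rewrite Nat.add_0_r. replace (csum f n - csum f n)%C with (RtoC 0) by ring.
    rewrite Cmod_0. lra.
  - rewrite Nat.add_succ_r. simpl csum.
    set (k := (n + m)%nat) in *.
    replace (csum f k + f k - csum f n)%C with ((csum f k - csum f n) + f k)%C by ring.
    eapply Rle_trans; [apply Cmod_triangle|]. specialize (Hf k).
    assert (Hk : 1 <= INR (S k)) by (rewrite S_INR; pose proof (pos_INR k); lra).
    assert (E : / (INR (S k) * INR (S k)) <= 2 * (/ INR (S k) - / INR (S (S k)))).
    { rewrite (S_INR (S k)). set (x := INR (S k)) in *.
      replace (2 * (/ x - / (x + 1))) with (2 / (x * (x + 1))) by (field; lra).
      apply Rmult_le_reg_r with (x * x * (x * (x + 1))).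
      { repeat apply Rmult_lt_0_compat; lra. }
      replace (/ (x * x) * (x * x * (x * (x + 1)))) with (x * (x + 1)) by (field; lra).
      replace (2 / (x * (x + 1)) * (x * x * (x * (x + 1)))) with (2 * (x * x)) by (field; lra).
      nra. }
    assert (c * / (INR (S k) * INR (S k)) <= c * (2 * (/ INR (S k) - / INR (S (S k)))))
      by now apply Rmult_le_compat_l.
    lra.
Qed.

Lemma csum_quadratic_bound f c n : 0 <= c ->
  (forall k, Cmod (f k) <= c * / (INR (S k) * INR (S k))) -> Cmod (csum f n) <= 2 * c.
Proof.
  intros Hc Hf. pose proof (csum_quadratic_tail f c 0 n Hc Hf) as H. simpl in H.
  replace (csum f n - RtoC 0)%C with (csum f n) in H by ring.
  assert (0 < / match n with O => 1 | S _ => INR n + 1 end).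
  { apply Rinv_0_lt_compat. destruct n; [lra|]. pose proof (pos_INR (S n)). lra. }
  rewrite Rinv_1 in H. nra.
Qed.

Lemma nat_above x : exists n, x < INR n.
Proof. destruct (INR_unbounded x) as [n Hn]. exists n. lra. Qed.

(** The tail bound gives the Cauchy property. *)
Lemma csum_quadratic_conv f c : 0 <= c ->
  (forall k, Cmod (f k) <= c * / (INR (S k) * INR (S k))) -> exists l, clim (csum f) l.
Proof.
  intros Hc Hf.
  assert (HC : forall eps, 0 < eps -> exists N, forall n m, (N <= n)%nat -> (N <= m)%nat ->
     Cmod (csum f n - csum f m) < eps).
  { intros eps He. destruct (nat_above (4 * c / eps)) as [N HN].
    assert (HN' : 4 * c < eps * INR (S N)).
    { rewrite S_INR. apply (Rmult_lt_compat_r eps) in HN; [|assumption].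
      replace (4 * c / eps * eps) with (4 * c) in HN by (field; lra). lra. }
    assert (HS : 0 < INR (S N)) by (apply lt_0_INR; lia).
    assert (B : forall n, (N <= n)%nat -> Cmod (csum f n - csum f N) < eps / 2).
    { intros n Hn. replace n with (N + (n - N))%nat by lia.
      eapply Rle_lt_trans; [apply (csum_quadratic_tail f c); assumption|].
      assert (0 < / INR (S (N + (n - N)))) by (apply Rinv_0_lt_compat, lt_0_INR; lia).
      assert (2 * c * / INR (S N) < eps / 2).
      { apply Rmult_lt_reg_r with (INR (S N)); [assumption|].
        rewrite Rmult_assoc, Rinv_l by lra. lra. }
      assert (0 <= 2 * c * / INR (S (N + (n - N)))) by (apply Rmult_le_pos; lra).
      lra. }
    exists N. intros n m Hn Hm. pose proof (B n Hn). pose proof (B m Hm).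
    pose proof (Cmod_triangle (csum f n - csum f N) (- (csum f m - csum f N))) as T.
    rewrite Cmod_opp in T.
    replace (csum f n - csum f N + - (csum f m - csum f N))%C
      with (csum f n - csum f m)%C in T by ring. lra. }
  assert (CR : Cauchy_crit (fun n => Re (csum f n))).
  { intros eps He. destruct (HC eps He) as [N HN]. exists N. intros n m Hn Hm.
    unfold Rdist. eapply Rle_lt_trans; [|apply (HN n m); lia].
    eapply Rle_trans; [|apply re_le_Cmod]. simpl. right. reflexivity. }
  assert (CI : Cauchy_crit (fun n => Im (csum f n))).
  { intros eps He. destruct (HC eps He) as [N HN]. exists N. intros n m Hn Hm.
    unfold Rdist. eapply Rle_lt_trans; [|apply (HN n m); lia].
    pose proof (Rmax_Cmod (csum f n - csum f m)%C) as T.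
    eapply Rle_trans; [|apply T]. eapply Rle_trans; [|apply Rmax_r]. right. reflexivity. }
  destruct (Rcomplete.R_complete _ CR) as [x Hx], (Rcomplete.R_complete _ CI) as [y Hy].
  exists (x, y). intros eps He.
  destruct (Hx (eps / 2)) as [N1 H1]; [lra|]. destruct (Hy (eps / 2)) as [N2 H2]; [lra|].
  exists (N1 + N2)%nat. intros n Hn.
  specialize (H1 n ltac:(lia)). specialize (H2 n ltac:(lia)). unfold Rdist in *.
  replace (csum f n - (x, y))%C with (Re (csum f n) - x, Im (csum f n) - y)
    by (unfold Re, Im; apply injective_projections; simpl; ring).
  eapply Rle_lt_trans; [apply Cmod_le_sum|]. lra.
Qed.

Lemma sum_n_csum (f : nat -> C) n : sum_n (G := C_AbelianMonoid) f n = csum f (S n).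
Proof.
  induction n as [|n IH].
  - rewrite sum_O. simpl. ring.
  - rewrite sum_Sn, IH. reflexivity.
Qed.

Lemma is_series_clim (f : nat -> C) l :
  is_series (K := C_AbsRing) (V := C_NormedModule) f l <-> clim (csum f) l.
Proof.
  split.
  - intros H eps He.
    pose proof (proj1 (filterlim_locally (U := C_NormedModule) _ l) H) as H1.
    assert (He2 : 0 < eps / 2) by lra.
    destruct (H1 (mkposreal _ He2)) as [N HN]. exists (S N). intros n Hn.
    destruct n as [|n]; [lia|]. specialize (HN n ltac:(lia)).
    apply (C_NormedModule_mixin_compat2 l) in HN. simpl in HN.
    rewrite sum_n_csum in HN. eapply Rlt_le_trans; [exact HN|].
    assert (sqrt 2 <= 2).
    { rewrite <- (sqrt_square 2) at 2 by lra. apply sqrt_le_1_alt. lra. }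
    nra.
  - intros H. apply (proj2 (filterlim_locally (U := C_NormedModule) _ l)).
    intros [eps He]. destruct (H eps He) as [N HN]. exists N. intros n Hn.
    apply (C_NormedModule_mixin_compat1 l). rewrite sum_n_csum. apply HN. lia.
Qed.

(** * Iterated summation by parts for periodic sequences of mean zero *)

Definition periodic (q : nat) (a : nat -> C) : Prop := forall k, a (k + q)%nat = a k.

(** The constant which, subtracted from the summatory function of [a], leaves a
    sequence of mean zero again, so that summation by parts can be repeated. *)
Definition cmean (q : nat) (a : nat -> C) : C :=
  (RtoC (/ INR q) * csum (fun k => csum a (S k)) q)%C.

Definition antidiff (q : nat) (a : nat -> C) : nat -> C :=
  fun k => (csum a (S k) - cmean q a)%C.

Definition delta (u : nat -> C) : nat -> C := fun k => (u k - u (S k))%C.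

Definition mean_zero (q : nat) (a : nat -> C) : Prop := periodic q a /\ csum a q = RtoC 0.

Lemma antidiff_mean_zero q a : (0 < q)%nat -> mean_zero q a -> mean_zero q (antidiff q a).
Proof.
  intros Hq [Hp Hz].
  assert (Hs : forall k, csum a (k + q) = csum a k).
  { intros k. rewrite Nat.add_comm, csum_add, Hz, Cplus_0_l. apply csum_ext.
    intros i _. rewrite Nat.add_comm. apply Hp. }
  split.
  - intros k. unfold antidiff. rewrite <- Nat.add_succ_l, Hs. reflexivity.
  - unfold antidiff, Cminus.
    rewrite (csum_plus (fun k => csum a (S k)) (fun _ => (- cmean q a)%C)), csum_const.
    unfold cmean.
    assert (E : (RtoC (INR q) * RtoC (/ INR q) = RtoC 1)%C).
    { rewrite <- RtoC_mult, Rinv_r; [reflexivity|]. apply not_0_INR. lia. }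
    set (X := csum (fun k => csum a (S k)) q).
    replace (X + RtoC (INR q) * - (RtoC (/ INR q) * X))%C
      with (X - RtoC (INR q) * RtoC (/ INR q) * X)%C by ring.
    rewrite E. ring.
Qed.

Lemma periodic_bounded q a : (0 < q)%nat -> periodic q a ->
  exists B, 0 <= B /\ forall k, Cmod (a k) <= B.
Proof.
  intros Hq Hp.
  assert (Hb : forall n, exists B, 0 <= B /\ forall k, (k < n)%nat -> Cmod (a k) <= B).
  { induction n as [|n [B [HB IH]]].
    - exists 0. split; [lra|]. intros k Hk. lia.
    - exists (Rmax B (Cmod (a n))). split; [eapply Rle_trans; [exact HB|apply Rmax_l]|].
      intros k Hk. destruct (Nat.eq_dec k n) as [->|]; [apply Rmax_r|].
      eapply Rle_trans; [apply IH; lia|apply Rmax_l]. }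
  destruct (Hb q) as [B [HB H]]. exists B. split; [assumption|]. intros k.
  rewrite (Nat.div_mod_eq k q).
  assert (E : forall m r, a (q * m + r)%nat = a r).
  { induction m as [|m IH]; intros r; [now rewrite Nat.mul_0_r|].
    replace (q * S m + r)%nat with (q * m + r + q)%nat by lia. now rewrite Hp. }
  rewrite E. apply H. apply Nat.mod_upper_bound. lia.
Qed.

Lemma summation_by_parts q a u n :
  csum (fun k => (a k * u k)%C) n
  = (cmean q a * u O + csum (fun k => (antidiff q a k * delta u k)%C) n
     + (csum a n - cmean q a) * u n)%C.
Proof.
  induction n as [|n IH]; [simpl; ring|].
  simpl csum. rewrite IH. unfold antidiff at 3, delta at 3. simpl csum. ring.
Qed.

Definition adiff (q K : nat) (a : nat -> C) : nat -> C := Nat.iter K (antidiff q) a.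
Definition deltas (K : nat) (u : nat -> C) : nat -> C := Nat.iter K delta u.

(** The contributions of the index 0 of the first K summations by parts. *)
Definition boundary (q K : nat) (a u : nat -> C) : C :=
  csum (fun i => (cmean q (adiff q i a) * deltas i u O)%C) K.

Lemma deltas_ext K u v : (forall k, u k = v k) -> forall k, deltas K u k = deltas K v k.
Proof.
  intros H. induction K as [|K IH]; intros k; [apply H|].
  simpl. unfold delta. now rewrite !IH.
Qed.

Lemma deltas_lin K c u v k :
  deltas K (fun i => (u i + c * v i)%C) k = (deltas K u k + c * deltas K v k)%C.
Proof.
  revert k. induction K as [|K IH]; intros k; [reflexivity|].
  simpl. unfold delta. rewrite !IH. ring.
Qed.

Lemma adiff_mean_zero q K a : (0 < q)%nat -> mean_zero q a -> mean_zero q (adiff q K a).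
Proof. intros Hq H. induction K as [|K IH]; [exact H|]. now apply antidiff_mean_zero. Qed.

Lemma clim_delta u : clim u (RtoC 0) -> clim (delta u) (RtoC 0).
Proof.
  intros H.
  pose proof (clim_plus _ _ _ _ H (clim_scal (RtoC (-1)) _ _ (clim_shift _ _ H))) as H1.
  replace (RtoC 0) with (RtoC 0 + RtoC (-1) * RtoC 0)%C by ring.
  eapply clim_ext; [|exact H1]. intros n. simpl. unfold delta. ring.
Qed.

(** The difference is the boundary term of a summation by parts: a periodic, hence
    bounded, factor times a sequence tending to 0. *)
Lemma regularized_step q a K u : (0 < q)%nat -> mean_zero q a -> clim (deltas K u) (RtoC 0) ->
  clim (fun n => (boundary q (S K) a u + csum (fun k => (adiff q (S K) a k * deltas (S K) u k)%C) n
     - (boundary q K a u + csum (fun k => (adiff q K a k * deltas K u k)%C) n))%C) (RtoC 0).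
Proof.
  intros Hq Ha Hu.
  destruct (adiff_mean_zero q K a Hq Ha) as [Hp Hz].
  assert (Hbd : exists B, 0 <= B /\
     forall n, Cmod (cmean q (adiff q K a) - csum (adiff q K a) n) <= B).
  { apply (periodic_bounded q (fun n => (cmean q (adiff q K a) - csum (adiff q K a) n)%C) Hq).
    intros k. rewrite Nat.add_comm, csum_add, Hz, Cplus_0_l.
    rewrite (csum_ext _ (adiff q K a) k); [reflexivity|].
    intros i _. rewrite Nat.add_comm. apply Hp. }
  destruct Hbd as [B [_ HB]].
  eapply clim_ext; [|exact (clim_bounded_0 _ _ B HB Hu)].
  intros n. rewrite (summation_by_parts q (adiff q K a) (deltas K u) n).
  unfold boundary; simpl csum. fold (boundary q K a u).
  change (adiff q (S K) a) with (antidiff q (adiff q K a)).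
  change (deltas (S K) u) with (delta (deltas K u)). ring.
Qed.

(** * Iterated differences of complex powers *)

Definition derives (g g' : R -> C) : Prop := forall x, 0 < x ->
  is_derive (fun t => Re (g t)) x (Re (g' x)) /\
  is_derive (fun t => Im (g t)) x (Im (g' x)).

Definition fdiff (g : R -> C) : R -> C := fun x => (g x - g (x + 1)%R)%C.
Definition fdiffs (K : nat) (g : R -> C) : R -> C := Nat.iter K fdiff g.

Lemma derives_fdiff g g' : derives g g' -> derives (fdiff g) (fdiff g').
Proof.
  intros H x Hx.
  assert (H1 : 0 < x + 1) by lra.
  destruct (H x Hx) as [A1 A2]. destruct (H (x + 1) H1) as [B1 B2].
  assert (sh : forall (f : R -> R) l, is_derive f (x + 1) l ->
     is_derive (fun t => f (t + 1)) x l).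
  { intros f l Hf.
    replace l with (scal (V := R_NormedModule) 1 l) by (unfold scal; simpl; unfold mult; simpl; ring).
    apply (is_derive_comp f (fun t => t + 1) x l 1 Hf). auto_derive; [easy|ring]. }
  split.
  - apply (is_derive_minus (V := R_NormedModule) (fun t => Re (g t)) (fun t => Re (g (t + 1))));
      [exact A1|]. exact (sh (fun t => Re (g t)) _ B1).
  - apply (is_derive_minus (V := R_NormedModule) (fun t => Im (g t)) (fun t => Im (g (t + 1))));
      [exact A2|]. exact (sh (fun t => Im (g t)) _ B2).
Qed.

Lemma derives_fdiffs K g g' : derives g g' -> derives (fdiffs K g) (fdiffs K g').
Proof. intros H. induction K as [|K IH]; [exact H|]. now apply derives_fdiff. Qed.

Lemma fdiffs_lin K c d g k x :
  fdiffs K (fun t => (c * g t + d * k t)%C) x = (c * fdiffs K g x + d * fdiffs K k x)%C.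
Proof.
  revert x. induction K as [|K IH]; intros x; [reflexivity|].
  simpl. unfold fdiff. rewrite !IH. ring.
Qed.

Lemma Rpower_shift_le e x t : 1 <= x -> x <= t <= x + 1 ->
  Rpower t e <= Rpower 2 (Rabs e) * Rpower x e.
Proof.
  intros Hx Ht. unfold Rpower. rewrite <- exp_plus. apply exp_le_mono.
  assert (L : ln x <= ln t <= ln 2 + ln x).
  { rewrite <- ln_mult by lra. split; apply ln_le; lra. }
  assert (0 <= ln 2) by (rewrite <- ln_1; apply ln_le; lra).
  assert (Q : Rabs (ln t - ln x) <= ln 2) by (apply Rabs_le; lra).
  assert (e * (ln t - ln x) <= Rabs e * ln 2).
  { eapply Rle_trans; [apply Rle_abs|]. rewrite Rabs_mult.
    apply Rmult_le_compat_l; [apply Rabs_pos|assumption]. }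
  lra.
Qed.

(** By the mean value theorem, a difference of step 1 is bounded by the derivative;
    applied K times, this gains the factor [x^(-K)] for powers of x. *)
Lemma derives_fdiff_bound g g' C e : 0 <= C -> derives g g' ->
  (forall t, 1 <= t -> Cmod (g' t) <= C * Rpower t e) ->
  forall x, 1 <= x -> Cmod (fdiff g x) <= 2 * C * Rpower 2 (Rabs e) * Rpower x e.
Proof.
  intros HC Hd Hg x Hx.
  assert (M : forall t, x <= t <= x + 1 -> Cmod (g' t) <= C * (Rpower 2 (Rabs e) * Rpower x e)).
  { intros t Ht. eapply Rle_trans; [apply Hg; lra|].
    apply Rmult_le_compat_l; [assumption|]. now apply Rpower_shift_le. }
  assert (mv : forall (f f' : R -> R) B, (forall t, 0 < t -> is_derive f t (f' t)) ->
     (forall t, x <= t <= x + 1 -> Rabs (f' t) <= B) -> Rabs (f x - f (x + 1)) <= B).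
  { intros f f' B Hf HB.
    destruct (MVT_gen f x (x + 1) f') as [c [Hc E]].
    - intros t Ht. rewrite Rmin_left in Ht by lra. apply Hf. lra.
    - intros t Ht. rewrite Rmin_left in Ht by lra.
      apply continuity_pt_filterlim. apply (ex_derive_continuous (V := R_NormedModule) f t).
      exists (f' t). apply Hf. lra.
    - rewrite Rmin_left, Rmax_right in Hc by lra. rewrite Rabs_minus_sym, E.
      replace (f' c * (x + 1 - x)) with (f' c) by ring. now apply HB. }
  replace (fdiff g x) with (Re (g x) - Re (g (x + 1)), Im (g x) - Im (g (x + 1)))
    by (unfold fdiff, Re, Im; apply injective_projections; simpl; ring).
  eapply Rle_trans; [apply Cmod_le_sum|].
  assert (R1 : Rabs (Re (g x) - Re (g (x + 1))) <= C * (Rpower 2 (Rabs e) * Rpower x e)).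
  { apply (mv (fun t => Re (g t)) (fun t => Re (g' t))).
    - intros t Ht. apply Hd, Ht.
    - intros t Ht. eapply Rle_trans; [apply re_le_Cmod|now apply M]. }
  assert (R2 : Rabs (Im (g x) - Im (g (x + 1))) <= C * (Rpower 2 (Rabs e) * Rpower x e)).
  { apply (mv (fun t => Im (g t)) (fun t => Im (g' t))).
    - intros t Ht. apply Hd, Ht.
    - intros t Ht. eapply Rle_trans; [|apply (M t Ht)].
      eapply Rle_trans; [|apply Rmax_Cmod]. apply Rmax_r. }
  lra.
Qed.

Definition cpow (s : C) (x : R) : C := Cexp (- s * RtoC (ln x))%C.
Definition lpow (s : C) (x : R) : C := (RtoC (ln x) * cpow s x)%C.

(** Second order Taylor remainder of the complex power in its exponent. *)
Definition rpow (s h : C) (x : R) : C := (cpow (s + h) x - cpow s x + h * lpow s x)%C.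

Lemma cpow_S s x : 0 < x -> cpow (s + RtoC 1) x = (RtoC (/ x) * cpow s x)%C.
Proof.
  intros Hx. unfold cpow.
  replace (- (s + RtoC 1) * RtoC (ln x))%C with (RtoC (- ln x) + (- s * RtoC (ln x)))%C
    by (rewrite RtoC_opp; ring).
  rewrite Cexp_add. f_equal. unfold Cexp; simpl.
  rewrite cos_0, sin_0, exp_Ropp, exp_ln by assumption.
  apply injective_projections; simpl; ring.
Qed.

Lemma cpow_eq s x : cpow s x
  = (exp (- Re s * ln x) * cos (- Im s * ln x), exp (- Re s * ln x) * sin (- Im s * ln x)).
Proof.
  destruct s as [a b]. unfold cpow, Cexp; simpl.
  replace (- a * ln x - - b * 0) with (- a * ln x) by ring.
  replace (- a * 0 + - b * ln x) with (- b * ln x) by ring. reflexivity.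
Qed.

Lemma derives_cpow s : derives (cpow s) (fun x => (- s * cpow (s + RtoC 1) x)%C).
Proof.
  intros x Hx. rewrite cpow_S by assumption. split.
  - apply (is_derive_ext (fun t => exp (- Re s * ln t) * cos (- Im s * ln t))).
    { intros t. now rewrite cpow_eq. }
    rewrite cpow_eq. destruct s as [a b]. simpl. auto_derive; [lra|]. field. lra.
  - apply (is_derive_ext (fun t => exp (- Re s * ln t) * sin (- Im s * ln t))).
    { intros t. now rewrite cpow_eq. }
    rewrite cpow_eq. destruct s as [a b]. simpl. auto_derive; [lra|]. field. lra.
Qed.

Lemma derives_lin c d g g' k k' : derives g g' -> derives k k' ->
  derives (fun x => (c * g x + d * k x)%C) (fun x => (c * g' x + d * k' x)%C).
Proof.
  intros Hg Hk x Hx. destruct (Hg x Hx) as [G1 G2], (Hk x Hx) as [K1 K2].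
  destruct c as [c1 c2], d as [d1 d2].
  assert (lin4 : forall (f1 f2 f3 f4 : R -> R) l1 l2 l3 l4 e1 e2 e3 e4,
    is_derive f1 x l1 -> is_derive f2 x l2 -> is_derive f3 x l3 -> is_derive f4 x l4 ->
    is_derive (fun t => e1 * f1 t + e2 * f2 t + (e3 * f3 t + e4 * f4 t)) x
       (e1 * l1 + e2 * l2 + (e3 * l3 + e4 * l4))).
  { intros f1 f2 f3 f4 l1 l2 l3 l4 e1 e2 e3 e4 D1 D2 D3 D4.
    apply (is_derive_plus (V := R_NormedModule) (fun t => e1 * f1 t + e2 * f2 t)
      (fun t => e3 * f3 t + e4 * f4 t));
    [apply (is_derive_plus (V := R_NormedModule) (fun t => e1 * f1 t) (fun t => e2 * f2 t))
    |apply (is_derive_plus (V := R_NormedModule) (fun t => e3 * f3 t) (fun t => e4 * f4 t))];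
    now apply is_derive_scal. }
  split.
  - apply (is_derive_ext (fun t => c1 * Re (g t) + - c2 * Im (g t)
        + (d1 * Re (k t) + - d2 * Im (k t)))).
    { intros t. unfold Re, Im. simpl. ring. }
    replace (Re ((c1, c2) * g' x + (d1, d2) * k' x)%C) with
      (c1 * Re (g' x) + - c2 * Im (g' x) + (d1 * Re (k' x) + - d2 * Im (k' x)))
      by (unfold Re, Im; simpl; ring).
    now apply lin4.
  - apply (is_derive_ext (fun t => c1 * Im (g t) + c2 * Re (g t)
        + (d1 * Im (k t) + d2 * Re (k t)))).
    { intros t. unfold Re, Im. simpl. ring. }
    replace (Im ((c1, c2) * g' x + (d1, d2) * k' x)%C) with
      (c1 * Im (g' x) + c2 * Re (g' x) + (d1 * Im (k' x) + d2 * Re (k' x)))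
      by (unfold Re, Im; simpl; ring).
    now apply lin4.
Qed.

Lemma derives_lpow s : derives (lpow s)
  (fun x => (RtoC 1 * cpow (s + RtoC 1) x + - s * lpow (s + RtoC 1) x)%C).
Proof.
  intros x Hx. destruct (derives_cpow s x Hx) as [D1 D2].
  assert (P : forall (f : R -> R) l, is_derive f x l ->
     is_derive (fun t => ln t * f t) x (/ x * f x + ln x * l)).
  { intros f l Hf.
    assert (Hln : is_derive ln x (/ x)) by (auto_derive; [assumption|field; lra]).
    pose proof (is_derive_mult (K := R_AbsRing) ln f x (/ x) l Hln Hf Rmult_comm) as H.
    exact H. }
  split.
  - apply (is_derive_ext (fun t => ln t * Re (cpow s t))).
    { intros t. unfold lpow, Re. simpl. ring. }
    replace (Re _) with (/ x * Re (cpow s x) + ln x * Re (- s * cpow (s + RtoC 1) x)%C);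
      [now apply P|].
    unfold lpow. rewrite cpow_S by assumption. unfold Re. simpl. ring.
  - apply (is_derive_ext (fun t => ln t * Im (cpow s t))).
    { intros t. unfold lpow, Im. simpl. ring. }
    replace (Im _) with (/ x * Im (cpow s x) + ln x * Im (- s * cpow (s + RtoC 1) x)%C);
      [now apply P|].
    unfold lpow. rewrite cpow_S by assumption. unfold Im. simpl. ring.
Qed.

(** The derivative involves only the remainder and the logarithmic power at s + 1,
    which lets the bound on iterated differences go by induction, for all s at once. *)
Lemma derives_rpow s h : derives (rpow s h)
  (fun x => (- (s + h) * rpow (s + RtoC 1) h x + h * h * lpow (s + RtoC 1) x)%C).
Proof.
  pose proof (derives_lin (RtoC 1) (RtoC 1) _ _ _ _
    (derives_lin (RtoC 1) (- RtoC 1)%C _ _ _ _ (derives_cpow (s + h)) (derives_cpow s))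
    (derives_lin h (RtoC 0) _ _ _ _ (derives_lpow s) (derives_cpow s))) as H.
  intros x Hx. specialize (H x Hx). destruct H as [H1 H2].
  assert (E : forall t, (RtoC 1 * (RtoC 1 * cpow (s + h) t + - RtoC 1 * cpow s t) +
            RtoC 1 * (h * lpow s t + RtoC 0 * cpow s t) = rpow s h t)%C).
  { intros t. unfold rpow. ring. }
  assert (E' : (- (s + h) * rpow (s + RtoC 1) h x + h * h * lpow (s + RtoC 1) x =
    RtoC 1 * (RtoC 1 * (- (s + h) * cpow (s + h + RtoC 1) x) + - RtoC 1 * (- s * cpow (s + RtoC 1) x))
    + RtoC 1 * (h * (RtoC 1 * cpow (s + RtoC 1) x + - s * lpow (s + RtoC 1) x)
       + RtoC 0 * (- s * cpow (s + RtoC 1) x)))%C).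
  { unfold rpow. replace (s + h + RtoC 1)%C with (s + RtoC 1 + h)%C by ring. ring. }
  rewrite E'. split.
  - eapply is_derive_ext; [|exact H1]. intros t. cbv beta. now rewrite E.
  - eapply is_derive_ext; [|exact H2]. intros t. cbv beta. now rewrite E.
Qed.

Lemma Cmod_cpow s x : Cmod (cpow s x) = Rpower x (- Re s).
Proof.
  unfold cpow. rewrite Cmod_Cexp. unfold Rpower, Re. f_equal. simpl. ring.
Qed.

Lemma ln_bounds x : 1 <= x -> 0 <= ln x <= x.
Proof.
  intros Hx. split.
  - rewrite <- ln_1. apply ln_le; lra.
  - assert (H : ln x <= ln (exp x)) by (apply ln_le; [lra|]; pose proof (exp_ineq1_le x); lra).
    now rewrite ln_exp in H.
Qed.

Lemma Rpower_le_exp x e1 e2 : 1 <= x -> e1 <= e2 -> Rpower x e1 <= Rpower x e2.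
Proof.
  intros Hx He. apply exp_le_mono. apply Rmult_le_compat_r; [|assumption].
  now apply ln_bounds.
Qed.

(** The slack 3 absorbs two logarithms and the factor [x^|h|], [|h| <= 1], of the
    remainder in h. *)
Definition decay (s : C) (K : nat) : R := 3 - Re s - INR K.

Lemma decay_S s K : decay (s + RtoC 1) K = decay s (S K).
Proof. unfold decay, Re. rewrite S_INR. simpl. ring. Qed.

Lemma fdiffs_cpow_bound K s : exists C, 0 <= C /\
  forall x, 1 <= x -> Cmod (fdiffs K (cpow s) x) <= C * Rpower x (decay s K).
Proof.
  revert s. induction K as [|K IH]; intros s.
  - exists 1. split; [lra|]. intros x Hx. simpl. rewrite Cmod_cpow, Rmult_1_l.
    apply Rpower_le_exp; [assumption|]. unfold decay; simpl. lra.
  - destruct (IH (s + RtoC 1)%C) as [C [HC H]].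
    eexists. split; [|intros x Hx;
      apply (derives_fdiff_bound (fdiffs K (cpow s)) _ (Cmod s * C) _) with (2 := derives_fdiffs K _ _ (derives_cpow s))].
    + repeat apply Rmult_le_pos; try lra; try apply Cmod_ge_0. left; apply exp_pos.
    + apply Rmult_le_pos; [apply Cmod_ge_0|assumption].
    + intros t Ht. specialize (H t Ht). rewrite decay_S in H.
      assert (E : fdiffs K (fun x => (- s * cpow (s + RtoC 1) x)%C) t
                  = (- s * fdiffs K (cpow (s + RtoC 1)) t)%C).
      { pose proof (fdiffs_lin K (- s)%C (RtoC 0) (cpow (s + RtoC 1)) (cpow s) t) as E.
        rewrite Cmult_0_l, Cplus_0_r in E. rewrite <- E. f_equal.
        apply FunctionalExtensionality.functional_extensionality. intros y. ring. }
      rewrite E, Cmod_mult, Cmod_opp, Rmult_assoc.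
      apply Rmult_le_compat_l; [apply Cmod_ge_0|exact H].
    + assumption.
Qed.

Lemma fdiffs_lpow_bound K s : exists C, 0 <= C /\
  forall x, 1 <= x -> Cmod (fdiffs K (lpow s) x) <= C * Rpower x (decay s K).
Proof.
  revert s. induction K as [|K IH]; intros s.
  - exists 1. split; [lra|]. intros x Hx. simpl. unfold lpow.
    rewrite Cmod_mult, Cmod_cpow, Cmod_R, Rmult_1_l.
    destruct (ln_bounds x Hx) as [L1 L2]. rewrite Rabs_right by lra.
    apply Rle_trans with (Rpower x 1 * Rpower x (- Re s)).
    + rewrite Rpower_1 by lra. apply Rmult_le_compat_r; [left; apply exp_pos|assumption].
    + rewrite <- Rpower_plus. apply Rpower_le_exp; [assumption|]. unfold decay; simpl. lra.
  - destruct (IH (s + RtoC 1)%C) as [C [HC H]].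
    destruct (fdiffs_cpow_bound K (s + RtoC 1)%C) as [C1 [HC1 H1]].
    assert (H0 : 0 <= C1 + Cmod s * C).
    { pose proof (Rmult_le_pos _ _ (Cmod_ge_0 s) HC). lra. }
    eexists. split; [|intros x Hx;
      apply (derives_fdiff_bound (fdiffs K (lpow s)) _ (C1 + Cmod s * C) _) with (2 := derives_fdiffs K _ _ (derives_lpow s))].
    + repeat apply Rmult_le_pos; try lra. left; apply exp_pos.
    + assumption.
    + intros t Ht. specialize (H t Ht). specialize (H1 t Ht). rewrite decay_S in H, H1.
      rewrite fdiffs_lin. eapply Rle_trans; [apply Cmod_triangle|].
      rewrite !Cmod_mult, Cmod_opp, Cmod_1, Rmult_1_l, Rmult_plus_distr_r.
      apply Rplus_le_compat; [exact H1|]. rewrite Rmult_assoc.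
      apply Rmult_le_compat_l; [apply Cmod_ge_0|exact H].
    + assumption.
Qed.

Lemma fdiffs_rpow_bound K s : exists C, 0 <= C /\
  forall h, Cmod h <= 1 -> forall x, 1 <= x ->
  Cmod (fdiffs K (rpow s h) x) <= C * (Cmod h * Cmod h) * Rpower x (decay s K).
Proof.
  revert s. induction K as [|K IH]; intros s.
  - exists 2. split; [lra|]. intros h Hh x Hx. simpl.
    assert (E : rpow s h x = (cpow s x * (Cexp (- h * RtoC (ln x)) - RtoC 1 - (- h * RtoC (ln x))))%C).
    { unfold rpow, lpow, cpow.
      replace (- (s + h) * RtoC (ln x))%C with (- s * RtoC (ln x) + - h * RtoC (ln x))%C by ring.
      rewrite Cexp_add. ring. }
    rewrite E, Cmod_mult, Cmod_cpow.
    destruct (ln_bounds x Hx) as [L1 L2].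
    pose proof (Cexp_remainder (- h * RtoC (ln x))%C) as HR.
    rewrite Cmod_mult, Cmod_opp, Cmod_R, (Rabs_right (ln x)) in HR by lra.
    assert (Ex : exp (Cmod h * ln x) <= x).
    { rewrite <- (exp_ln x) at 2 by lra. apply exp_le_mono. nra. }
    pose proof (Cmod_ge_0 h) as H0.
    apply Rle_trans with (Rpower x (- Re s) * (2 * (Cmod h * Cmod h) * Rpower x 3)).
    + apply Rmult_le_compat_l; [left; apply exp_pos|].
      eapply Rle_trans; [apply HR|].
      replace (Rpower x 3) with (x * x * x).
      * replace (2 * (Cmod h * ln x * (Cmod h * ln x)) * exp (Cmod h * ln x))
          with (2 * (Cmod h * Cmod h) * (ln x * ln x * exp (Cmod h * ln x))) by ring.
        apply Rmult_le_compat_l; [nra|]. apply Rmult_le_compat; try nra. left; apply exp_pos.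
      * replace 3 with (INR 3) by (simpl; ring). rewrite Rpower_pow by lra. simpl. ring.
    + replace (decay s 0) with (- Re s + 3) by (unfold decay; simpl; ring).
      rewrite Rpower_plus. right; ring.
  - destruct (IH (s + RtoC 1)%C) as [C [HC H]].
    destruct (fdiffs_lpow_bound K (s + RtoC 1)%C) as [C1 [HC1 H1]].
    set (M := (Cmod s + 1) * C + C1).
    assert (HM : 0 <= M).
    { unfold M. pose proof (Cmod_ge_0 s). assert (0 <= (Cmod s + 1) * C) by (apply Rmult_le_pos; lra). lra. }
    exists (2 * M * Rpower 2 (Rabs (decay s (S K)))). split.
    { repeat apply Rmult_le_pos; try lra. left; apply exp_pos. }
    intros h Hh x Hx. pose proof (Cmod_ge_0 h) as H0.
    replace (2 * M * Rpower 2 (Rabs (decay s (S K))) * (Cmod h * Cmod h))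
      with (2 * (M * (Cmod h * Cmod h)) * Rpower 2 (Rabs (decay s (S K)))) by ring.
    apply (derives_fdiff_bound (fdiffs K (rpow s h)) _ (M * (Cmod h * Cmod h)) _)
      with (2 := derives_fdiffs K _ _ (derives_rpow s h)); [|intros t Ht|assumption].
    + apply Rmult_le_pos; [assumption|nra].
    + specialize (H h Hh t Ht). specialize (H1 t Ht). rewrite decay_S in H, H1.
      rewrite fdiffs_lin. eapply Rle_trans; [apply Cmod_triangle|].
      rewrite !Cmod_mult, Cmod_opp.
      set (P := Rpower t (decay s (S K))) in *.
      assert (HP : 0 < P) by apply exp_pos.
      assert (A1 : Cmod (s + h) <= Cmod s + 1).
      { eapply Rle_trans; [apply Cmod_triangle|]. lra. }
      assert (A2 : Cmod (s + h) * Cmod (fdiffs K (rpow (s + RtoC 1) h) t)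
                <= (Cmod s + 1) * (C * (Cmod h * Cmod h) * P)).
      { apply Rmult_le_compat; try apply Cmod_ge_0; assumption. }
      assert (A3 : Cmod h * Cmod h * Cmod (fdiffs K (lpow (s + RtoC 1)) t)
                <= Cmod h * Cmod h * (C1 * P)).
      { apply Rmult_le_compat_l; [nra|assumption]. }
      unfold M. nra.
Qed.

(** * Entire continuation of Dirichlet series with periodic coefficients of mean zero *)

Definition sample (g : R -> C) : nat -> C := fun k => g (INR (S k)).

Lemma deltas_sample K g k : deltas K (sample g) k = fdiffs K g (INR (S k)).
Proof.
  revert k. induction K as [|K IH]; intros k; [reflexivity|].
  simpl deltas. simpl fdiffs. unfold delta, fdiff. rewrite !IH.
  now rewrite (S_INR (S k)).
Qed.

(** The partial sums of [a u] after K summations by parts, without the terms that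
    vanish in the limit. *)
Definition regular (q : nat) (a : nat -> C) (K : nat) (u : nat -> C) (n : nat) : C :=
  (boundary q K a u + csum (fun k => (adiff q K a k * deltas K u k)%C) n)%C.

Lemma regular_lin q a K c u v n :
  regular q a K (fun k => (u k + c * v k)%C) n = (regular q a K u n + c * regular q a K v n)%C.
Proof.
  unfold regular, boundary.
  rewrite (csum_ext _ (fun i => (cmean q (adiff q i a) * deltas i u O
       + c * (cmean q (adiff q i a) * deltas i v O))%C) K)
    by (intros i _; rewrite deltas_lin; ring).
  rewrite (csum_ext _ (fun k => (adiff q K a k * deltas K u k
       + c * (adiff q K a k * deltas K v k))%C) n)
    by (intros i _; rewrite deltas_lin; ring).
  rewrite !csum_plus, !csum_scal. ring.
Qed.

Lemma regular_ext q a K u v n : (forall k, u k = v k) -> regular q a K u n = regular q a K v n.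
Proof.
  intros H. unfold regular, boundary. f_equal; apply csum_ext; intros i _; f_equal;
    now apply deltas_ext.
Qed.

Lemma INR_S_ge_1 k : 1 <= INR (S k).
Proof. rewrite S_INR. pose proof (pos_INR k). lra. Qed.

Lemma Rpower_quadratic k e : e <= -2 -> Rpower (INR (S k)) e <= / (INR (S k) * INR (S k)).
Proof.
  intros He. pose proof (INR_S_ge_1 k) as H.
  eapply Rle_trans; [apply (Rpower_le_exp _ e (- (2)) H); lra|].
  rewrite Rpower_Ropp. right. f_equal.
  replace 2 with (INR 2) by (simpl; ring). rewrite Rpower_pow by lra. simpl. ring.
Qed.

Lemma adiff_bounded q a K : (0 < q)%nat -> mean_zero q a ->
  exists B, 0 <= B /\ forall k, Cmod (adiff q K a k) <= B.
Proof.
  intros Hq Ha. apply (periodic_bounded q); [assumption|]. now apply adiff_mean_zero.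
Qed.

Lemma regular_conv q a K g M e : (0 < q)%nat -> mean_zero q a -> 0 <= M -> e <= -2 ->
  (forall x, 1 <= x -> Cmod (fdiffs K g x) <= M * Rpower x e) ->
  exists l, clim (regular q a K (sample g)) l.
Proof.
  intros Hq Ha HM He Hg. destruct (adiff_bounded q a K Hq Ha) as [B [HB Hb]].
  destruct (csum_quadratic_conv (fun k => (adiff q K a k * deltas K (sample g) k)%C) (B * M)) as [l Hl].
  - now apply Rmult_le_pos.
  - intros k. rewrite Cmod_mult, deltas_sample, Rmult_assoc.
    apply Rmult_le_compat; try apply Cmod_ge_0; [apply Hb|].
    eapply Rle_trans; [apply Hg, INR_S_ge_1|].
    apply Rmult_le_compat_l; [assumption|now apply Rpower_quadratic].
  - exists (boundary q K a (sample g) + l)%C. apply clim_plus; [apply clim_const|exact Hl].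
Qed.

Lemma clim_of_Cmod_le (f : nat -> C) (M : R) : 0 <= M ->
  (forall k, Cmod (f k) <= M * / INR (S k)) -> clim f (RtoC 0).
Proof.
  intros HM Hf eps He. destruct (nat_above (M / eps)) as [N HN]. exists N. intros n Hn.
  replace (f n - RtoC 0)%C with (f n) by ring. eapply Rle_lt_trans; [apply Hf|].
  assert (HS : INR N <= INR (S n)) by (apply le_INR; lia).
  pose proof (INR_S_ge_1 n).
  apply Rmult_lt_reg_r with (INR (S n)); [lra|].
  rewrite Rmult_assoc, Rinv_l, Rmult_1_r by lra.
  apply (Rmult_lt_compat_r eps) in HN; [|assumption].
  replace (M / eps * eps) with M in HN by (field; lra). nra.
Qed.

(** The depths at which the regularized series at s is dominated by [1/k^2]. *)
Definition deep (s : C) (K : nat) : Prop := decay s K <= -2.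

Lemma deep_le s K K' : (K <= K')%nat -> deep s K -> deep s K'.
Proof. intros H. apply le_INR in H. unfold deep, decay. lra. Qed.

Lemma deep_exists s : exists K, deep s K.
Proof.
  destruct (nat_above (5 - Re s)) as [K HK]. exists K. unfold deep, decay. lra.
Qed.

Lemma deltas_cpow_0 s K : deep s K -> clim (deltas K (sample (cpow s))) (RtoC 0).
Proof.
  intros Hd. destruct (fdiffs_cpow_bound K s) as [M [HM H]].
  apply (clim_of_Cmod_le _ M HM). intros k. rewrite deltas_sample.
  eapply Rle_trans; [apply H, INR_S_ge_1|]. apply Rmult_le_compat_l; [assumption|].
  eapply Rle_trans; [now apply Rpower_quadratic|].
  pose proof (INR_S_ge_1 k). apply Rinv_le_contravar; nra.
Qed.

Lemma regular_clim_step q a K u l : (0 < q)%nat -> mean_zero q a -> clim (deltas K u) (RtoC 0) ->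
  (clim (regular q a K u) l <-> clim (regular q a (S K) u) l).
Proof.
  intros Hq Ha Hu. pose proof (regularized_step q a K u Hq Ha Hu) as H. split; intros Hl.
  - pose proof (clim_plus _ _ _ _ H Hl) as P. rewrite Cplus_0_l in P.
    eapply clim_ext; [|exact P]. intros n. unfold regular. ring.
  - pose proof (clim_plus _ _ _ _ Hl (clim_scal (RtoC (-1)) _ _ H)) as P.
    replace (l + RtoC (-1) * RtoC 0)%C with l in P by ring.
    eapply clim_ext; [|exact P]. intros n. unfold regular. ring.
Qed.

Lemma regular_value q a s : (0 < q)%nat -> mean_zero q a ->
  exists l, forall K, deep s K -> clim (regular q a K (sample (cpow s))) l.
Proof.
  intros Hq Ha. destruct (deep_exists s) as [K0 HK0].
  assert (ex : forall K, deep s K -> exists l, clim (regular q a K (sample (cpow s))) l).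
  { intros K HK. destruct (fdiffs_cpow_bound K s) as [M [HM H]].
    exact (regular_conv q a K (cpow s) M _ Hq Ha HM HK H). }
  assert (up : forall K l m, deep s K -> clim (regular q a K (sample (cpow s))) l ->
     clim (regular q a (m + K) (sample (cpow s))) l).
  { intros K l m HK Hl. induction m as [|m IH]; [exact Hl|]. simpl.
    apply (regular_clim_step q a (m + K) (sample (cpow s)) l Hq Ha); [|exact IH].
    apply deltas_cpow_0, (deep_le s K); [lia|assumption]. }
  destruct (ex K0 HK0) as [l Hl]. exists l. intros K HK. destruct (ex K HK) as [l' Hl'].
  assert (E : l = l').
  { apply (clim_unique (regular q a (K + K0) (sample (cpow s)))); [now apply up|].
    rewrite Nat.add_comm. now apply up. }
  now rewrite E.
Qed.

(** The bound is quadratic in h and uniform in n, so it passes to the limit and makes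
    the regularized series differentiable in s. *)
Lemma regular_rpow_bound q a K s : (0 < q)%nat -> mean_zero q a -> deep s K ->
  exists M, 0 <= M /\ forall h, Cmod h <= 1 ->
    forall n, Cmod (regular q a K (sample (rpow s h)) n) <= M * (Cmod h * Cmod h).
Proof.
  intros Hq Ha HK.
  assert (Hh : forall J, exists M, 0 <= M /\ forall h, Cmod h <= 1 ->
     Cmod (boundary q J a (sample (rpow s h))) <= M * (Cmod h * Cmod h)).
  { induction J as [|J [M [HM IH]]].
    - exists 0. split; [lra|]. intros h _. unfold boundary; simpl. rewrite Cmod_0. lra.
    - destruct (fdiffs_rpow_bound J s) as [C [HC H]].
      exists (M + Cmod (cmean q (adiff q J a)) * C). split.
      { pose proof (Rmult_le_pos _ _ (Cmod_ge_0 (cmean q (adiff q J a))) HC). lra. }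
      intros h Hh. specialize (IH h Hh). unfold boundary in *. simpl csum.
      eapply Rle_trans; [apply Cmod_triangle|]. rewrite Cmod_mult, deltas_sample.
      specialize (H h Hh 1 (Rle_refl _)). simpl INR.
      assert (E : forall e, Rpower 1 e = 1).
      { intros e. unfold Rpower. now rewrite ln_1, Rmult_0_r, exp_0. }
      rewrite E, Rmult_1_r in H.
      rewrite Rmult_plus_distr_r, Rmult_assoc. apply Rplus_le_compat; [exact IH|].
      apply Rmult_le_compat_l; [apply Cmod_ge_0|exact H]. }
  destruct (Hh K) as [M1 [HM1 H1]].
  destruct (fdiffs_rpow_bound K s) as [C [HC H]].
  destruct (adiff_bounded q a K Hq Ha) as [B [HB Hb]].
  exists (M1 + 2 * (B * C)). split.
  { pose proof (Rmult_le_pos _ _ HB HC). lra. }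
  intros h Hh1 n. unfold regular. eapply Rle_trans; [apply Cmod_triangle|].
  rewrite Rmult_plus_distr_r. apply Rplus_le_compat; [now apply H1|].
  replace (2 * (B * C) * (Cmod h * Cmod h)) with (2 * (B * C * (Cmod h * Cmod h))) by ring.
  pose proof (Cmod_ge_0 h).
  apply csum_quadratic_bound.
  - repeat apply Rmult_le_pos; assumption.
  - intros k. rewrite Cmod_mult, deltas_sample.
    replace (B * C * (Cmod h * Cmod h) * / (INR (S k) * INR (S k)))
      with (B * (C * (Cmod h * Cmod h) * / (INR (S k) * INR (S k)))) by ring.
    apply Rmult_le_compat; try apply Cmod_ge_0; [apply Hb|].
    eapply Rle_trans; [apply H; [assumption|apply INR_S_ge_1]|].
    apply Rmult_le_compat_l; [repeat apply Rmult_le_pos; assumption|].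
    now apply Rpower_quadratic.
Qed.

Lemma cpow_0_right s : 0 < Re s -> clim (sample (cpow s)) (RtoC 0).
Proof.
  intros Hs eps He.
  destruct (nat_above (exp (- ln eps / Re s))) as [N HN]. exists N. intros n Hn.
  replace (sample (cpow s) n - RtoC 0)%C with (sample (cpow s) n) by ring.
  unfold sample. rewrite Cmod_cpow. unfold Rpower.
  rewrite <- (exp_ln eps He). apply exp_increasing.
  assert (L : - ln eps / Re s < ln (INR (S n))).
  { rewrite <- (ln_exp (- ln eps / Re s)). apply ln_increasing; [apply exp_pos|].
    eapply Rlt_le_trans; [exact HN|]. apply le_INR. lia. }
  apply (Rmult_lt_compat_r (Re s)) in L; [|assumption].
  replace (- ln eps / Re s * Re s) with (- ln eps) in L by (field; lra). lra.
Qed.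

(** The value at s of the regularized series does not depend on the depth K of
    the regularization, and a fixed depth serves a whole neighbourhood of s. *)
Lemma periodic_series_continuation q a : (0 < q)%nat -> mean_zero q a ->
  exists F, holo F /\
    forall s, 0 < Re s -> clim (csum (fun k => (a k * sample (cpow s) k)%C)) (F s).
Proof.
  intros Hq Ha.
  set (F := fun s => proj1_sig (constructive_indefinite_description _ (regular_value q a s Hq Ha))).
  assert (HF : forall s K, deep s K -> clim (regular q a K (sample (cpow s))) (F s)).
  { intros s. exact (proj2_sig (constructive_indefinite_description _ (regular_value q a s Hq Ha))). }
  exists F. split.
  (* A depth for s - 1 serves every point of the unit disc around s. *)
  - intros s. destruct (deep_exists (s - RtoC 1)%C) as [K HK].
    assert (near : forall h, Cmod h <= 1 -> deep (s + h) K).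
    { intros h Hh. pose proof (re_le_Cmod h) as R1. pose proof (Rle_abs (- Re h)) as R2.
      rewrite Rabs_Ropp in R2. unfold deep, decay, Re in *. simpl in *. lra. }
    assert (HKs : deep s K).
    { replace s with (s + RtoC 0)%C by ring. apply near. rewrite Cmod_0. lra. }
    destruct (fdiffs_lpow_bound K s) as [M1 [HM1 H1]].
    destruct (regular_conv q a K (lpow s) M1 _ Hq Ha HM1 HKs H1) as [l Hl].
    destruct (regular_rpow_bound q a K s Hq Ha HKs) as [M [HM Hb]].
    exists (- l)%C. intros eps He. exists (Rmin 1 (eps / (M + 1))). split.
    { apply Rmin_pos; [lra|apply Rdiv_lt_0_compat; lra]. }
    intros w Hw. set (h := (w - s)%C) in *.
    pose proof (Rlt_le_trans _ _ _ Hw (Rmin_l _ _)) as W1.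
    pose proof (Rlt_le_trans _ _ _ Hw (Rmin_r _ _)) as W2.
    assert (Ew : w = (s + h)%C) by (unfold h; ring).
    assert (Hlim : clim (regular q a K (sample (rpow s h))) (F w - F s - - l * h)%C).
    { assert (Hw' : clim (regular q a K (sample (cpow (s + h)))) (F w)).
      { rewrite Ew. apply HF, near. lra. }
      pose proof (clim_plus _ _ _ _ (clim_plus _ _ _ _ Hw'
        (clim_scal (RtoC (-1)) _ _ (HF s K HKs))) (clim_scal h _ _ Hl)) as P.
      replace (F w - F s - - l * h)%C with (F w + RtoC (-1) * F s + h * l)%C by ring.
      eapply clim_ext; [|exact P]. intros n. cbv beta.
      rewrite <- !regular_lin. apply regular_ext. intros k. unfold sample, rpow. ring. }
    assert (Hle : Cmod (F w - F s - - l * h) <= M * (Cmod h * Cmod h)).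
    { apply (clim_Cmod_le _ _ _ Hlim). apply Hb. lra. }
    eapply Rle_trans; [exact Hle|]. rewrite <- Rmult_assoc.
    apply Rmult_le_compat_r; [apply Cmod_ge_0|].
    apply (Rmult_lt_compat_l (M + 1)) in W2; [|lra].
    replace ((M + 1) * (eps / (M + 1))) with eps in W2 by (field; lra).
    pose proof (Cmod_ge_0 h). lra.
  - intros s Hs. destruct (deep_exists s) as [K HK].
    (* Where the series itself has terms tending to 0, the regularization can be
       undone step by step. *)
    assert (D0 : forall J, clim (deltas J (sample (cpow s))) (RtoC 0)).
    { induction J as [|J IH]; [now apply cpow_0_right|]. now apply clim_delta. }
    assert (HJ : forall J, clim (regular q a J (sample (cpow s))) (F s) ->
       clim (regular q a 0 (sample (cpow s))) (F s)).
    { induction J as [|J IH]; [auto|]. intros H. apply IH.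
      now apply (regular_clim_step q a J (sample (cpow s)) (F s) Hq Ha (D0 J)). }
    eapply clim_ext; [|exact (HJ K (HF s K HK))].
    intros n. unfold regular, boundary. simpl. ring.
Qed.

Lemma is_L_function_of_clim {q : nat} (chi : DirichletCharacter q) F : holo F ->
  (forall s, 1 < Re s -> clim (csum (fun k => (chi (Z.of_nat (S k)) * sample (cpow s) k)%C)) (F s)) ->
  is_L_function chi F.
Proof.
  intros HF Hs. apply entire_holo in HF. split; [|split].
  - intros s H. apply is_series_clim. apply (Hs s H).
  - exists O, F. split; [assumption|]. intros s _. simpl. field.
  - auto.
Qed.

(** By the identity theorem the chosen continuation agrees with the explicit one. *)
Lemma L_half {q : nat} (chi : DirichletCharacter q) : (0 < q)%nat -> ~ principal chi ->
  csum (fun k => chi (Z.of_nat (S k))) q = RtoC 0 ->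
  clim (csum (fun k => (chi (Z.of_nat (S k)) * RtoC (/ sqrt (INR (S k))))%C))
    (L chi (RtoC (1 / 2))).
Proof.
  intros Hq Hnp Hz. set (a := fun k => chi (Z.of_nat (S k))).
  assert (Ha : mean_zero q a).
  { split; [|exact Hz]. intros k. unfold a.
    rewrite <- (chi_periodic q chi (Z.of_nat (S k))). f_equal. lia. }
  destruct (periodic_series_continuation q a Hq Ha) as [F [HF Hs]].
  assert (E : L chi (RtoC (1 / 2)) = F (RtoC (1 / 2))).
  { unfold L. destruct (excluded_middle_informative _) as [h|h].
    - destruct (constructive_indefinite_description _ h) as [G [HG1 [HG2 HG3]]]. simpl.
      specialize (HG3 Hnp). apply entire_holo in HG3.
      assert (H : (G (RtoC (1 / 2)) - F (RtoC (1 / 2)) = RtoC 0)%C).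
      { apply (holo_zero_half_plane (fun z => (G z - F z)%C) (holo_minus _ _ HG3 HF)).
        intros z Hz'. specialize (HG1 z Hz'). apply is_series_clim in HG1.
        rewrite (clim_unique _ (G z) (F z) HG1); [ring|]. apply (Hs z). lra. }
      replace (G (RtoC (1 / 2))) with (G (RtoC (1 / 2)) - F (RtoC (1 / 2)) + F (RtoC (1 / 2)))%C by ring.
      rewrite H. ring.
    - exfalso. apply h. exists F. apply is_L_function_of_clim; [assumption|].
      intros s Hs1. apply Hs. lra. }
  rewrite E.
  pose proof (Hs (RtoC (1 / 2))) as H. simpl in H. specialize (H ltac:(lra)).
  eapply clim_ext; [|exact H]. intros n. apply csum_ext. intros k _. f_equal.
  unfold sample. rewrite cpow_eq. simpl Re. simpl Im.
  pose proof (INR_S_ge_1 k) as Hk. set (x := INR (S k)) in *.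
  replace (- 0 * ln x) with 0 by ring. rewrite cos_0, sin_0.
  assert (Es : exp (- (1 / 2) * ln x) = / sqrt x).
  { rewrite <- Rpower_sqrt, <- Rpower_Ropp by lra. unfold Rpower. f_equal. field. }
  rewrite Es. apply injective_projections; simpl; ring.
Qed.

(** * Primitive roots *)

Module PrimitiveRoot.
From mathcomp Require Import ssreflect ssrfun ssrbool eqtype ssrnat seq div fintype prime ssralg poly zmodp cyclic finfield.
Import GRing.Theory.

Lemma modn_mod (m d : nat) : (0 < d)%N -> (m %% d)%N = Nat.modulo m d.
Proof.
move=> d0; apply: (Nat.mod_unique m d (m %/ d)%N); first by apply/ltP; rewrite ltn_mod.
by rewrite {1}(divn_eq m d) mulnC.
Qed.

Lemma dvdn_Zdivide (d n : nat) : (d %| n)%N -> Z.divide (Z.of_nat d) (Z.of_nat n).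
Proof. by case/dvdnP => k ->; exists (Z.of_nat k); rewrite -multE Nat2Z.inj_mul. Qed.

Lemma prime_mathcomp (q : nat) : Znumtheory.prime (Z.of_nat q) -> prime.prime q.
Proof.
move=> pq; have q1 : Z.lt 1 (Z.of_nat q) by case: pq.
apply/primeP; split; first by apply/ltP; lia.
move=> d /dvdn_Zdivide /(prime_divisors _ pq) [|[|[|]]] H.
- lia.
- by apply/orP; left; apply/eqP; lia.
- by apply/orP; right; apply/eqP; lia.
- lia.
Qed.

Local Open Scope ring_scope.

(** All q - 1 nonzero elements are roots of unity of order dividing q - 1. *)
Lemma primitive_root_Fp (q : nat) : prime.prime q ->
  exists2 z : 'F_q, q.-1.-primitive_root z &
    forall x : 'F_q, x != 0 -> exists2 k, (k < q.-1)%N & x = z ^+ k.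
Proof.
move=> pq; have q1 := prime_gt1 pq.
have card : #|'F_q| = q by exact: card_Fp.
pose rs := enum [pred x : 'F_q | x != 0].
have unity (x : 'F_q) : x != 0 -> x ^+ q.-1 = 1.
  move=> nx; apply: (mulIf nx); rewrite mul1r -exprSr prednK ?prime_gt0 //.
  by rewrite -[X in x ^+ X]card expf_card.
have /hasP [z _ zP] : has q.-1.-primitive_root rs.
  apply: has_prim_root.
  - by rewrite -subn1 subn_gt0.
  - apply/allP => x; rewrite mem_enum inE => nx.
    by apply/unity_rootP; exact: unity.
  - exact: enum_uniq.
  - rewrite -cardE -[X in (X.-1 <= _)%N]card.
    have -> : #|[pred x : 'F_q | x != 0]| = #|'F_q|.-1 by rewrite -(cardC1 (0 : 'F_q)).
    by [].
exists z => // x nx.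
have [k kq] := prim_rootP zP (unity x nx).
by exists (val k) => //; exact: ltn_ord.
Qed.

(** The function g is [k -> z^k mod q] for a primitive root z, read in the natural
    numbers. *)
Lemma primitive_root (q : nat) : Znumtheory.prime (Z.of_nat q) ->
  exists g : nat -> nat,
    (forall k, lt 0 (g k) /\ lt (g k) q) /\
    (forall n, Nat.modulo n q <> O ->
       exists k, lt k (Nat.sub q 1) /\ g k = Nat.modulo n q) /\
    (forall k l, g k = g l <-> Nat.modulo k (Nat.sub q 1) = Nat.modulo l (Nat.sub q 1)) /\
    (forall k l, g (Nat.add k l) = Nat.modulo (Nat.mul (g k) (g l)) q).
Proof.
move=> /prime_mathcomp pq; have q0 := prime_gt0 pq.
have q1 : (0 < q.-1)%N by rewrite -subn1 subn_gt0 prime_gt1.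
have eq1 : Nat.sub q 1 = q.-1 by lia.
have [z zP zG] := primitive_root_Fp q pq.
have vq (x : 'F_q) : (x < q)%N by rewrite -[X in (_ < X)%N](Fp_cast pq) ltn_ord.
have z0 k : z ^+ k != 0.
  apply: expf_neq0; apply/eqP => z0; have := prim_expr_order zP.
  by rewrite z0 expr0n (gtn_eqF q1) => /eqP; rewrite eq_sym oner_eq0.
exists (fun k => val (z ^+ k)); split; last split; last split.
- move=> k; split; last by apply/ltP; exact: vq.
  apply/ltP; rewrite lt0n; apply: contra (z0 k) => /eqP H.
  by apply/eqP/val_inj; rewrite H.
- move=> n; rewrite -modn_mod // => Hn.
  have Hz : (n%:R : 'F_q) != 0.
    by apply/eqP => H; apply: Hn; rewrite -(val_Fp_nat pq) H.
  have [k kq E] := zG _ Hz.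
  exists k; split; first by rewrite eq1; apply/ltP.
  by rewrite -E; exact: (val_Fp_nat pq n).
- move=> k l; rewrite eq1 -!modn_mod //; split => H.
  + by apply/eqP; rewrite -(eq_prim_root_expr zP); apply/eqP/val_inj.
  + by congr val; apply/eqP; rewrite (eq_prim_root_expr zP); apply/eqP.
- move=> k l; rewrite -modn_mod //= exprD.
  by rewrite -(val_Fp_nat pq) natrM !natr_Zp.
Qed.

End PrimitiveRoot.

(** * Finite sums over lists *)

Definition lsum {A : Type} (f : A -> C) (l : list A) : C :=
  fold_right (fun a s => (f a + s)%C) (RtoC 0) l.

Definition rsum {A : Type} (f : A -> R) (l : list A) : R :=
  fold_right (fun a s => f a + s) 0 l.

Lemma lsum_ext {A} (f g : A -> C) l : (forall a, In a l -> f a = g a) -> lsum f l = lsum g l.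
Proof.
  induction l as [|a l IH]; intros H; [reflexivity|]. simpl. rewrite H by (left; reflexivity).
  rewrite IH; [reflexivity|]. intros b Hb. apply H. now right.
Qed.

Lemma rsum_ext {A} (f g : A -> R) l : (forall a, In a l -> f a = g a) -> rsum f l = rsum g l.
Proof.
  induction l as [|a l IH]; intros H; [reflexivity|]. simpl. rewrite H by (left; reflexivity).
  rewrite IH; [reflexivity|]. intros b Hb. apply H. now right.
Qed.

Lemma lsum_plus {A} (f g : A -> C) l :
  lsum (fun a => (f a + g a)%C) l = (lsum f l + lsum g l)%C.
Proof. induction l as [|a l IH]; simpl; [ring|rewrite IH; ring]. Qed.

Lemma lsum_scal {A} (c : C) (f : A -> C) l : lsum (fun a => (c * f a)%C) l = (c * lsum f l)%C.
Proof. induction l as [|a l IH]; simpl; [ring|rewrite IH; ring]. Qed.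

Lemma lsum_scal_r {A} (c : C) (f : A -> C) l : lsum (fun a => (f a * c)%C) l = (lsum f l * c)%C.
Proof. induction l as [|a l IH]; simpl; [ring|rewrite IH; ring]. Qed.

Lemma lsum_0 {A} (l : list A) : lsum (fun _ => RtoC 0) l = RtoC 0.
Proof. induction l as [|a l IH]; simpl; [reflexivity|rewrite IH; ring]. Qed.

Lemma lsum_swap {A B} (f : A -> B -> C) la lb :
  lsum (fun a => lsum (fun b => f a b) lb) la = lsum (fun b => lsum (fun a => f a b) la) lb.
Proof.
  induction la as [|a la IH]; simpl.
  - now rewrite lsum_0.
  - rewrite IH. symmetry. apply lsum_plus.
Qed.

Lemma lsum_RtoC {A} (f : A -> R) l : lsum (fun a => RtoC (f a)) l = RtoC (rsum f l).
Proof.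
  induction l as [|a l IH]; simpl; [reflexivity|]. rewrite IH. now rewrite RtoC_plus.
Qed.

Lemma lsum_conj {A} (f : A -> C) l : Cconj (lsum f l) = lsum (fun a => Cconj (f a)) l.
Proof.
  induction l as [|a l IH]; simpl.
  - apply injective_projections; simpl; ring.
  - rewrite <- IH. apply injective_projections; simpl; ring.
Qed.

Lemma lsum_Cmod {A} (f : A -> C) l : Cmod (lsum f l) <= rsum (fun a => Cmod (f a)) l.
Proof.
  induction l as [|a l IH]; simpl; [rewrite Cmod_0; lra|].
  eapply Rle_trans; [apply Cmod_triangle|]. lra.
Qed.

Lemma lsum_map {A B} (h : A -> B) (f : B -> C) l : lsum f (map h l) = lsum (fun a => f (h a)) l.
Proof. induction l as [|a l IH]; simpl; [reflexivity|now rewrite IH]. Qed.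

Lemma lsum_perm {A} (f : A -> C) l l' : Permutation l l' -> lsum f l = lsum f l'.
Proof.
  induction 1; simpl; [reflexivity|now rewrite IHPermutation|ring|congruence].
Qed.

Lemma lsum_app {A} (f : A -> C) l l' : lsum f (l ++ l') = (lsum f l + lsum f l')%C.
Proof. induction l as [|a l IH]; simpl; [ring|rewrite IH; ring]. Qed.

Lemma csum_lsum f n : csum f n = lsum f (seq 0 n).
Proof.
  induction n as [|n IH]; [reflexivity|]. rewrite seq_S, lsum_app, <- IH. simpl. ring.
Qed.

Lemma rsum_le {A} (f g : A -> R) l : (forall a, In a l -> f a <= g a) -> rsum f l <= rsum g l.
Proof.
  induction l as [|a l IH]; intros H; simpl; [lra|].
  apply Rplus_le_compat; [apply H; now left|apply IH; intros b Hb; apply H; now right].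
Qed.

Lemma rsum_nonneg {A} (f : A -> R) l : (forall a, In a l -> 0 <= f a) -> 0 <= rsum f l.
Proof.
  induction l as [|a l IH]; intros H; simpl; [lra|].
  apply Rplus_le_le_0_compat; [apply H; now left|apply IH; intros b Hb; apply H; now right].
Qed.

Lemma rsum_plus {A} (f g : A -> R) l : rsum (fun a => f a + g a) l = rsum f l + rsum g l.
Proof. induction l as [|a l IH]; simpl; [ring|rewrite IH; ring]. Qed.

Lemma rsum_scal {A} (c : R) (f : A -> R) l : rsum (fun a => c * f a) l = c * rsum f l.
Proof. induction l as [|a l IH]; simpl; [ring|rewrite IH; ring]. Qed.

Lemma rsum_member {A} (f : A -> R) l a : (forall b, In b l -> 0 <= f b) -> In a l ->
  f a <= rsum f l.
Proof.
  induction l as [|b l IH]; intros H Ha; [destruct Ha|]. simpl.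
  assert (0 <= rsum f l) by (apply rsum_nonneg; intros c Hc; apply H; now right).
  assert (0 <= f b) by (apply H; now left).
  destruct Ha as [->|Ha]; [lra|].
  assert (f a <= rsum f l) by (apply IH; [intros c Hc; apply H; now right|assumption]). lra.
Qed.

(** * Dirichlet characters modulo a prime *)

(** The complex number [exp (2 pi i k / n)]. *)
Definition root (n k : nat) : C :=
  (cos (2 * PI * (INR k / INR n)), sin (2 * PI * (INR k / INR n))).

Lemma root_add n k l : (0 < n)%nat -> root n (k + l) = (root n k * root n l)%C.
Proof.
  intros Hn. apply lt_0_INR in Hn. unfold root. rewrite plus_INR.
  replace (2 * PI * ((INR k + INR l) / INR n))
    with (2 * PI * (INR k / INR n) + 2 * PI * (INR l / INR n)) by (field; lra).
  rewrite cos_plus, sin_plus. apply injective_projections; simpl; ring.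
Qed.

Lemma root_mult n k : (0 < n)%nat -> root n (n * k) = RtoC 1.
Proof.
  intros Hn. apply lt_0_INR in Hn. unfold root. rewrite mult_INR.
  replace (2 * PI * (INR n * INR k / INR n)) with (0 + 2 * INR k * PI) by (field; lra).
  now rewrite cos_period, sin_period, cos_0, sin_0.
Qed.

Lemma root_mod n k : (0 < n)%nat -> root n (k mod n) = root n k.
Proof.
  intros Hn. rewrite (Nat.div_mod_eq k n) at 2.
  rewrite root_add, root_mult by assumption. ring.
Qed.

Lemma root_neq_1 n k : (0 < n)%nat -> (k mod n <> 0)%nat -> root n k <> RtoC 1.
Proof.
  intros Hn Hk E. rewrite <- root_mod in E by assumption.
  assert (Hlt : (k mod n < n)%nat) by (apply Nat.mod_upper_bound; lia).
  set (r := (k mod n)%nat) in *. apply lt_INR in Hlt.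
  assert (Hr : 0 < INR r) by (apply lt_0_INR; lia). apply lt_0_INR in Hn.
  apply (f_equal fst) in E. unfold root in E; simpl in E.
  replace (2 * PI * (INR r / INR n)) with (2 * (PI * (INR r / INR n))) in E by ring.
  rewrite cos_2a_sin in E.
  assert (Q : 0 < INR r / INR n < 1).
  { split; [now apply Rdiv_lt_0_compat|]. apply Rmult_lt_reg_r with (INR n); [assumption|].
    unfold Rdiv. rewrite Rmult_assoc, Rinv_l by lra. lra. }
  pose proof PI_RGT_0.
  assert (0 < sin (PI * (INR r / INR n))) by (apply sin_gt_0; nra).
  nra.
Qed.

Lemma root_conj n k l : (0 < n)%nat -> root n (k + l) = RtoC 1 -> Cconj (root n k) = root n l.
Proof.
  intros Hn E. rewrite root_add in E by assumption.
  assert (U : (Cconj (root n k) * root n k = RtoC 1)%C).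
  { unfold root. pose proof (sin2_cos2 (2 * PI * (INR k / INR n))) as S. unfold Rsqr in S.
    apply injective_projections; simpl; lra. }
  replace (Cconj (root n k)) with (Cconj (root n k) * RtoC 1)%C by ring.
  rewrite <- E, Cmult_assoc, U. ring.
Qed.

Lemma root_pow n k j : (0 < n)%nat -> root n (k * j) = Cpow (root n k) j.
Proof.
  intros Hn. induction j as [|j IH].
  - rewrite Nat.mul_0_r. simpl. rewrite <- (root_mult n 0 Hn). now rewrite Nat.mul_0_r.
  - rewrite Nat.mul_succ_r, root_add, IH by assumption. simpl. ring.
Qed.

Lemma root_sum n k : (0 < n)%nat ->
  lsum (fun j => root n (k * j)) (seq 0 n) =
  if Nat.eqb (k mod n) 0 then RtoC (INR n) else RtoC 0.
Proof.
  intros Hn. rewrite <- csum_lsum. destruct (Nat.eqb_spec (k mod n) 0) as [E|E].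
  - rewrite (csum_ext _ (fun _ => RtoC 1)).
    + rewrite csum_const. ring.
    + intros j _. rewrite root_pow, <- (root_mod n k), E by assumption.
      assert (R0 : root n 0 = RtoC 1)
        by (rewrite <- (root_mult n 0 Hn); now rewrite Nat.mul_0_r).
      rewrite R0. clear. induction j as [|j IH]; simpl; [reflexivity|rewrite IH; ring].
  - pose proof (root_neq_1 n k Hn E) as Hne.
    rewrite (csum_ext _ (fun j => Cpow (root n k) j)) by (intros j _; now apply root_pow).
    set (w := root n k) in *.
    assert (G : forall m, ((RtoC 1 - w) * csum (fun j => Cpow w j) m = RtoC 1 - Cpow w m)%C).
    { induction m as [|m IH]; simpl; [ring|]. rewrite Cmult_plus_distr_l, IH. ring. }
    specialize (G n). unfold w in G at 3. rewrite <- root_pow in G by assumption.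
    rewrite Nat.mul_comm, root_mult in G by assumption.
    assert (Hz : (RtoC 1 - w <> RtoC 0)%C).
    { intros Z. apply Hne. replace w with (RtoC 1 - (RtoC 1 - w))%C by ring. rewrite Z. ring. }
    replace (csum (fun j => Cpow w j) n) with (/ (RtoC 1 - w) * ((RtoC 1 - w) * csum (fun j => Cpow w j) n))%C.
    + rewrite G. ring.
    + rewrite Cmult_assoc, Cinv_l by assumption. ring.
Qed.

Lemma rel_prime_mod (q : nat) z : prime (Z.of_nat q) ->
  (rel_prime z (Z.of_nat q) <-> (z mod Z.of_nat q <> 0)%Z).
Proof.
  intros Hq. pose proof (prime_ge_2 _ Hq) as H2. split.
  - intros Hr E. apply Z.mod_divide in E; [|lia].
    assert (D : (Z.of_nat q | 1)%Z).
    { destruct Hr as [_ _ Hr]. apply Hr; [assumption|]. apply Z.divide_refl. }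
    apply Z.divide_1_r_nonneg in D; lia.
  - intros Hne. apply rel_prime_sym, prime_rel_prime; [assumption|].
    intros D. apply Hne. apply Z.mod_divide; [lia|assumption].
Qed.

(** With ind the discrete logarithm to the base of a primitive root, the characters
    are [z -> exp (2 pi i j ind(z) / (q - 1))] for [0 <= j < q - 1]; j = 0 is the
    principal one.  All sums over characters or over residues become geometric. *)
Lemma dirichlet_characters (q : nat) : prime (Z.of_nat q) ->
  exists X : nat -> DirichletCharacter q,
    (forall j, (0 < j < q - 1)%nat -> ~ principal (X j)) /\
    (forall x y, (x mod Z.of_nat q <> 0)%Z -> (y mod Z.of_nat q <> 0)%Z ->
      lsum (fun j => (X j x * Cconj (X j y))%C) (seq 0 (q - 1)) =
      if Z.eqb (x mod Z.of_nat q) (y mod Z.of_nat q) then RtoC (INR (q - 1)) else RtoC 0) /\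
    (forall j, (0 < j < q - 1)%nat ->
      lsum (fun a => X j (Z.of_nat a)) (seq 1 (q - 1)) = RtoC 0) /\
    (forall j z, Cmod (X j z) <= 1).
Proof.
  intros Hq. pose proof (prime_ge_2 _ Hq) as H2.
  destruct (PrimitiveRoot.primitive_root q Hq) as [g [G1 [G2 [G3 G4]]]].
  set (n := (q - 1)%nat) in *. assert (Hn : (0 < n)%nat) by (unfold n; lia).
  set (Q := Z.of_nat q) in *.
  assert (res : forall z, exists k, (z mod Q <> 0)%Z ->
     (k < n)%nat /\ Z.of_nat (g k) = (z mod Q)%Z).
  { intros z. destruct (Z.eq_dec (z mod Q) 0) as [E|E]; [exists O; congruence|].
    pose proof (Z.mod_pos_bound z Q ltac:(lia)) as Hb.
    destruct (G2 (Z.to_nat (z mod Q))) as [k [Hk Ek]].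
    - rewrite Nat.mod_small by lia. lia.
    - exists k. intros _. split; [exact Hk|]. rewrite Ek, Nat.mod_small by lia. lia. }
  set (ind := fun z => proj1_sig (constructive_indefinite_description _ (res z))).
  assert (Hind : forall z, (z mod Q <> 0)%Z -> (ind z < n)%nat /\ Z.of_nat (g (ind z)) = (z mod Q)%Z).
  { intros z. exact (proj2_sig (constructive_indefinite_description _ (res z))). }
  set (val := fun j z => if Z.eqb (z mod Q) 0 then RtoC 0 else root n (j * ind z)).
  assert (root_eq : forall j k l, g k = g l -> root n (j * k) = root n (j * l)).
  { intros j k l E. apply G3 in E. rewrite <- (root_mod n (j * k)), <- (root_mod n (j * l)) by assumption.
    rewrite (Nat.Div0.mul_mod j k), (Nat.Div0.mul_mod j l), E. reflexivity. }
  assert (root_nz : forall k, root n k <> RtoC 0).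
  { intros k E. pose proof (root_mult n k Hn) as M.
    replace (n * k)%nat with (k + (n * k - k))%nat in M by nia.
    rewrite root_add, E, Cmult_0_l in M by assumption.
    apply (f_equal fst) in M. simpl in M. lra. }
  assert (Hper : forall j z, val j (z + Q)%Z = val j z).
  { intros j z. unfold val. replace ((z + Q) mod Q)%Z with (z mod Q)%Z.
    - destruct (Z.eqb_spec (z mod Q) 0) as [E|E]; [reflexivity|].
      apply root_eq. apply Nat2Z.inj.
      assert (E' : ((z + Q) mod Q)%Z = (z mod Q)%Z).
      { rewrite <- (Z_mod_plus_full z 1 Q). f_equal. ring. }
      rewrite (proj2 (Hind z E)), <- E'. apply Hind. now rewrite E'.
    - rewrite <- (Z_mod_plus_full z 1 Q). f_equal. ring. }
  assert (Hmod : forall x y, (x * y mod Q <> 0)%Z <-> (x mod Q <> 0)%Z /\ (y mod Q <> 0)%Z).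
  { intros x y. rewrite !Z.mod_divide by lia. split.
    - intros H. split; intros D; apply H; [now apply Z.divide_mul_l|now apply Z.divide_mul_r].
    - intros [Hx Hy] D. apply prime_mult in D; [|assumption]. tauto. }
  assert (Hmul : forall j x y, val j (x * y)%Z = (val j x * val j y)%C).
  { intros j x y. unfold val.
    destruct (Z.eqb_spec (x mod Q) 0) as [E1|E1].
    - destruct (Z.eqb_spec (x * y mod Q) 0) as [E|E]; [ring|]. apply Hmod in E. tauto.
    - destruct (Z.eqb_spec (y mod Q) 0) as [E2|E2].
      + destruct (Z.eqb_spec (x * y mod Q) 0) as [E|E]; [ring|]. apply Hmod in E. tauto.
      + assert (E : (x * y mod Q <> 0)%Z) by now apply Hmod.
        destruct (Z.eqb_spec (x * y mod Q) 0) as [E'|_]; [tauto|].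
        rewrite <- root_add, <- Nat.mul_add_distr_l by assumption. apply root_eq.
        apply Nat2Z.inj. rewrite (proj2 (Hind _ E)), G4, Nat2Z.inj_mod, Nat2Z.inj_mul.
        rewrite (proj2 (Hind _ E1)), (proj2 (Hind _ E2)). apply Zmult_mod. }
  assert (Hsup : forall j z, val j z <> RtoC 0 <-> rel_prime z Q).
  { intros j z. unfold Q. rewrite rel_prime_mod by assumption. fold Q. unfold val.
    destruct (Z.eqb_spec (z mod Q) 0) as [E|E]; split; intros H; try tauto. apply root_nz. }
  exists (fun j => Build_DirichletCharacter q (val j) (Hper j) (Hmul j) (Hsup j)). simpl.
  assert (small : forall k, (Z.of_nat (g k) mod Q)%Z = Z.of_nat (g k)).
  { intros k. destruct (G1 k). apply Z.mod_small. unfold Q. lia. }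
  assert (gnz : forall k, (Z.of_nat (g k) mod Q <> 0)%Z).
  { intros k. rewrite small. destruct (G1 k). lia. }
  assert (valg : forall j k, val j (Z.of_nat (g k)) = root n (j * k)).
  { intros j k. unfold val. destruct (Z.eqb_spec (Z.of_nat (g k) mod Q) 0) as [E|E].
    - now apply gnz in E.
    - apply root_eq, Nat2Z.inj. rewrite (proj2 (Hind _ E)). apply small. }
  repeat split.
  - intros j Hj Hp. specialize (Hp (Z.of_nat (g 1%nat))). simpl in Hp. rewrite valg in Hp.
    apply (root_neq_1 n (j * 1) Hn).
    + rewrite Nat.mul_1_r, Nat.mod_small by lia. lia.
    + apply Hp. apply rel_prime_mod; [assumption|apply gnz].
  - intros x y Hx Hy. destruct (Hind x Hx) as [Lx Ex], (Hind y Hy) as [Ly Ey].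
    rewrite (lsum_ext _ (fun j => root n ((ind x + (n - ind y)) * j))).
    + rewrite root_sum by assumption.
      assert (E : ((ind x + (n - ind y)) mod n = 0)%nat <-> (x mod Q)%Z = (y mod Q)%Z).
      { rewrite <- Ex, <- Ey. split.
        - intros E. apply Nat.Div0.mod_divides in E. destruct E as [c Hc].
          assert (c = 1)%nat by nia. subst c. do 2 f_equal. lia.
        - intros E. apply Nat2Z.inj in E. apply G3 in E.
          rewrite !Nat.mod_small in E by assumption. rewrite E.
          replace (ind y + (n - ind y))%nat with n by lia. apply Nat.Div0.mod_same. }
      destruct (Nat.eqb_spec ((ind x + (n - ind y)) mod n) 0) as [N|N];
        destruct (Z.eqb_spec (x mod Q) (y mod Q)) as [M|M]; tauto.
    + intros j _. unfold val.
      destruct (Z.eqb_spec (x mod Q) 0); [tauto|]. destruct (Z.eqb_spec (y mod Q) 0); [tauto|].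
      rewrite (root_conj n (j * ind y) (j * (n - ind y)) Hn).
      * rewrite <- root_add by assumption. f_equal. ring.
      * replace (j * ind y + j * (n - ind y))%nat with (n * j)%nat by nia.
        now apply root_mult.
  - intros j Hj.
    assert (P : Permutation (map g (seq 0 n)) (seq 1 n)).
    { apply NoDup_Permutation_bis.
      - apply NoDup_map_NoDup_ForallPairs; [|apply seq_NoDup].
        intros k l Hk Hl E. apply in_seq in Hk, Hl. apply G3 in E.
        rewrite !Nat.mod_small in E by lia. exact E.
      - rewrite length_map, !length_seq. lia.
      - intros a Ha. apply in_map_iff in Ha. destruct Ha as [k [<- _]].
        apply in_seq. destruct (G1 k). unfold n. lia. }
    rewrite <- (lsum_perm _ _ _ P), lsum_map.
    rewrite (lsum_ext _ (fun k => root n (j * k))) by (intros k _; apply valg).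
    rewrite root_sum by assumption. rewrite Nat.mod_small by lia.
    destruct (Nat.eqb_spec j 0); [lia|reflexivity].
  - intros j z. unfold val. destruct (Z.eqb (z mod Q) 0); [rewrite Cmod_0; lra|].
    unfold root, Cmod; simpl.
    pose proof (sin2_cos2 (2 * PI * (INR (j * ind z) / INR n))) as S. unfold Rsqr in S.
    rewrite !Rmult_1_r, Rplus_comm, S, sqrt_1. lra.
Qed.

(** * A finite formula for the central value *)

Definition inv_sqrt (x : R) : R := / sqrt x.

Lemma inv_sqrt_pos x : 0 < x -> 0 < inv_sqrt x.
Proof. intros H. apply Rinv_0_lt_compat. now apply sqrt_lt_R0. Qed.

Lemma inv_sqrt_le x y : 0 < x -> x <= y -> inv_sqrt y <= inv_sqrt x.
Proof.
  intros Hx Hy. apply Rinv_le_contravar; [now apply sqrt_lt_R0|]. now apply sqrt_le_1_alt.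
Qed.

(** The first M terms of the series for [a^(-1/2) - w(a)]. *)
Definition tail_part (q a M : nat) : R :=
  rsum (fun j => inv_sqrt (INR ((j + 1) * q)) - inv_sqrt (INR (a + (j + 1) * q))) (seq 0 M).

Lemma rsum_app {A} (f : A -> R) l l' : rsum f (l ++ l') = rsum f l + rsum f l'.
Proof. induction l as [|a l IH]; simpl; [ring|rewrite IH; ring]. Qed.

Lemma tail_part_S q a M : tail_part q a (S M)
  = tail_part q a M + (inv_sqrt (INR ((M + 1) * q)) - inv_sqrt (INR (a + (M + 1) * q))).
Proof. unfold tail_part. rewrite seq_S, rsum_app. simpl. ring. Qed.

(** For [a <= q] each term is at most the difference of two consecutive values of
    [(j q)^(-1/2)]. *)
Lemma tail_part_bounds q a M : (0 < q)%nat -> (a <= q)%nat ->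
  tail_part q a M <= tail_part q a (S M) /\
  0 <= tail_part q a M <= inv_sqrt (INR q) - inv_sqrt (INR ((M + 1) * q)).
Proof.
  intros Hq Ha.
  assert (P : forall j, 0 < INR ((j + 1) * q)) by (intros j; apply lt_0_INR; nia).
  assert (T : forall j, 0 <= inv_sqrt (INR ((j + 1) * q)) - inv_sqrt (INR (a + (j + 1) * q))
      <= inv_sqrt (INR ((j + 1) * q)) - inv_sqrt (INR ((j + 1 + 1) * q))).
  { intros j.
    assert (inv_sqrt (INR (a + (j + 1) * q)) <= inv_sqrt (INR ((j + 1) * q)))
      by (apply inv_sqrt_le; [apply P|apply le_INR; lia]).
    assert (inv_sqrt (INR ((j + 1 + 1) * q)) <= inv_sqrt (INR (a + (j + 1) * q))).
    { apply inv_sqrt_le; [apply lt_0_INR; nia|apply le_INR; nia]. }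
    lra. }
  split; [rewrite tail_part_S; specialize (T M); lra|].
  induction M as [|M IH].
  - unfold tail_part. simpl. rewrite Nat.add_0_r. lra.
  - rewrite tail_part_S. specialize (T M). replace (S M + 1)%nat with (M + 1 + 1)%nat by lia. lra.
Qed.

Lemma tail_part_cv q a : (0 < q)%nat -> (a <= q)%nat ->
  exists e, 0 <= e <= inv_sqrt (INR q) /\ Un_cv (tail_part q a) e.
Proof.
  intros Hq Ha.
  assert (U : forall M, tail_part q a M <= inv_sqrt (INR q)).
  { intros M. pose proof (proj2 (tail_part_bounds q a M Hq Ha)).
    assert (0 < inv_sqrt (INR ((M + 1) * q))) by (apply inv_sqrt_pos, lt_0_INR; nia). lra. }
  destruct (growing_cv (tail_part q a)) as [e He].
  - intros M. apply tail_part_bounds; assumption.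
  - exists (inv_sqrt (INR q)). intros x [M ->]. apply U.
  - exists e. split; [|assumption]. split.
    + apply (growing_ineq _ _) with (n := O) in He; [exact He|].
      intros M. apply tail_part_bounds; assumption.
    + apply Rnot_lt_le. intros Hlt. destruct (He (e - inv_sqrt (INR q))) as [N HN]; [lra|].
      specialize (HN N (le_n _)). unfold Rdist in HN. apply Rabs_def2 in HN.
      specialize (U N). lra.
Qed.

Lemma clim_csum (f : nat -> nat -> C) (l : nat -> C) n :
  (forall i, (i < n)%nat -> clim (fun M => f M i) (l i)) -> clim (fun M => csum (f M) n) (csum l n).
Proof.
  induction n as [|n IH]; intros H; [exact (clim_const (RtoC 0))|].
  simpl. apply clim_plus; [apply IH; auto|apply H; lia].
Qed.

Lemma clim_RtoC u l : Un_cv u l -> clim (fun n => RtoC (u n)) (RtoC l).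
Proof.
  intros H eps He. destruct (H eps He) as [N HN]. exists N. intros n Hn.
  rewrite <- RtoC_minus, Cmod_R. now apply HN.
Qed.

Lemma chi_0 {q : nat} (chi : DirichletCharacter q) : (1 < q)%nat -> chi (Z.of_nat q) = RtoC 0.
Proof.
  intros Hq. apply NNPP. intros H. apply chi_support in H.
  destruct H as [_ _ H]. specialize (H (Z.of_nat q) (Z.divide_refl _) (Z.divide_refl _)).
  apply Z.divide_1_r_nonneg in H; lia.
Qed.

(** Grouping the series for L(chi, 1/2) into blocks of length q, the mean zero of
    chi allows to subtract (j q)^(-1/2) from the terms of the j-th block. *)
Lemma central_value_formula (q : nat) : (1 < q)%nat -> exists w : nat -> R,
  (forall a, (1 <= a <= q)%nat ->
     0 <= w a <= inv_sqrt (INR a) /\ inv_sqrt (INR a) - inv_sqrt (INR q) <= w a) /\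
  forall chi : DirichletCharacter q, ~ principal chi ->
    lsum (fun a => chi (Z.of_nat a)) (seq 1 (q - 1)) = RtoC 0 ->
    L chi (RtoC (1 / 2)) = lsum (fun a => (chi (Z.of_nat a) * RtoC (w a))%C) (seq 1 (q - 1)).
Proof.
  intros Hq.
  assert (ex : forall a, exists e, (a <= q)%nat -> 0 <= e <= inv_sqrt (INR q) /\ Un_cv (tail_part q a) e).
  { intros a. destruct (Nat.le_gt_cases a q) as [H|H].
    - destruct (tail_part_cv q a ltac:(lia) H) as [e He]. now exists e.
    - exists 0. lia. }
  set (e := fun a => proj1_sig (constructive_indefinite_description _ (ex a))).
  assert (He : forall a, (a <= q)%nat -> 0 <= e a <= inv_sqrt (INR q) /\ Un_cv (tail_part q a) (e a)).
  { intros a. exact (proj2_sig (constructive_indefinite_description _ (ex a))). }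
  exists (fun a => inv_sqrt (INR a) - e a). split.
  - intros a Ha. destruct (He a ltac:(lia)) as [E _].
    assert (inv_sqrt (INR q) <= inv_sqrt (INR a)).
    { apply inv_sqrt_le; [apply lt_0_INR; lia|apply le_INR; lia]. }
    lra.
  - intros chi Hnp Hz.
    assert (Eq : forall f : nat -> C, csum (fun k => (chi (Z.of_nat (S k)) * f (S k))%C) q
        = lsum (fun a => (chi (Z.of_nat a) * f a)%C) (seq 1 (q - 1))).
    { intros f. rewrite csum_lsum, <- (lsum_map S (fun a => (chi (Z.of_nat a) * f a)%C)), seq_shift.
      replace q with (S (q - 1)) at 1 by lia. rewrite seq_S, lsum_app.
      replace (1 + (q - 1))%nat with q by lia. simpl. rewrite chi_0 by assumption. ring. }
    assert (Hz' : csum (fun k => chi (Z.of_nat (S k))) q = RtoC 0).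
    { rewrite <- Hz. rewrite (csum_ext _ (fun k => (chi (Z.of_nat (S k)) * RtoC 1)%C))
        by (intros; ring).
      rewrite (Eq (fun _ => RtoC 1)). apply lsum_ext. intros; ring. }
    rewrite <- Eq.
    pose proof (L_half chi ltac:(lia) Hnp Hz') as HL.
    assert (per : forall k i, chi (Z.of_nat (S (k * q + i))) = chi (Z.of_nat (S i))).
    { intros k i. induction k as [|k IH]; [reflexivity|].
      rewrite <- IH, <- (chi_periodic q chi (Z.of_nat (S (k * q + i)))). f_equal. lia. }
    assert (B : forall M, csum (fun k => (chi (Z.of_nat (S k)) * RtoC (/ sqrt (INR (S k))))%C) ((M + 1) * q)
      = csum (fun k => (chi (Z.of_nat (S k)) * RtoC (inv_sqrt (INR (S k)) - tail_part q (S k) M))%C) q).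
    { induction M as [|M IH].
      - simpl. rewrite Nat.add_0_r. apply csum_ext. intros k _. f_equal. f_equal.
        unfold tail_part, inv_sqrt; simpl. ring.
      - replace ((S M + 1) * q)%nat with ((M + 1) * q + q)%nat by lia.
        rewrite csum_add, IH.
        rewrite (csum_ext (fun k => (chi (Z.of_nat (S k)) * RtoC (inv_sqrt (INR (S k)) - tail_part q (S k) (S M)))%C)
          (fun k => ((chi (Z.of_nat (S k)) * RtoC (inv_sqrt (INR (S k)) - tail_part q (S k) M)
             + chi (Z.of_nat (S ((M + 1) * q + k))) * RtoC (/ sqrt (INR (S ((M + 1) * q + k)))))
             + RtoC (- inv_sqrt (INR ((M + 1) * q))) * chi (Z.of_nat (S k)))%C)).
        + rewrite !csum_plus, csum_scal, Hz'. ring.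
        + intros k _. rewrite per, tail_part_S.
          replace (S ((M + 1) * q + k))%nat with (S k + (M + 1) * q)%nat by lia.
          fold (inv_sqrt (INR (S k + (M + 1) * q))).
          rewrite !RtoC_minus, !RtoC_plus, !RtoC_minus, RtoC_opp. ring. }
    apply (clim_unique (fun M => csum (fun k => (chi (Z.of_nat (S k)) * RtoC (/ sqrt (INR (S k))))%C) ((M + 1) * q))).
    + intros eps Heps. destruct (HL eps Heps) as [N HN]. exists N. intros M HM. apply HN. nia.
    + eapply clim_ext; [intros M; symmetry; apply B|].
      apply clim_csum. intros i Hi. apply clim_scal.
      apply clim_RtoC. intros eps Heps. destruct (proj2 (He (S i) ltac:(lia)) eps Heps) as [N HN].
      exists N. intros M HM. specialize (HN M HM). unfold Rdist in *.
      replace (inv_sqrt (INR (S i)) - tail_part q (S i) M - (inv_sqrt (INR (S i)) - e (S i)))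
        with (- (tail_part q (S i) M - e (S i))) by ring. now rewrite Rabs_Ropp.
Qed.

(** * The resonance inequality *)

Definition den (I : list (nat * R)) : R := rsum (fun p => snd p * snd p) I.

(** The part of the twisted moment that comes from the exact equations [a m = n]. *)
Definition num (I : list (nat * R)) : R :=
  rsum (fun p => rsum (fun p' => if Nat.eqb (fst p' mod fst p) 0
     then snd p * snd p' * (sqrt (INR (fst p)) * inv_sqrt (INR (fst p'))) else 0) I) I.

Lemma rsum_0 {A} (f : A -> R) l : (forall a, In a l -> f a = 0) -> rsum f l = 0.
Proof.
  induction l as [|a l IH]; intros H; simpl; [reflexivity|].
  rewrite H by now left. rewrite IH; [ring|]. intros b Hb. apply H. now right.
Qed.

Lemma rsum_at_most_one {A} (f : A -> R) l b : NoDup l -> 0 <= b ->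
  (forall x, In x l -> f x <= b) ->
  (forall x y, In x l -> In y l -> f x <> 0 -> f y <> 0 -> x = y) -> rsum f l <= b.
Proof.
  intros Hn Hb. induction l as [|a l IH]; intros H1 H2; simpl; [lra|].
  inversion Hn; subst.
  destruct (Req_dec (f a) 0) as [E|E].
  - rewrite E, Rplus_0_l. apply IH; auto; intros.
    + apply H1. now right.
    + apply H2; auto; now right.
  - rewrite (rsum_0 f l), Rplus_0_r; [apply H1; now left|].
    intros x Hx. apply NNPP. intros Hf.
    assert (a = x) by (apply H2; auto; [now left|now right]). congruence.
Qed.

Lemma rsum_diagonal (I : list (nat * R)) p : NoDup (map fst I) -> In p I ->
  rsum (fun p' => if Nat.eqb (fst p) (fst p') then snd p * snd p' else 0) I = snd p * snd p.
Proof.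
  induction I as [|a I IH]; intros Hn Hp; [destruct Hp|].
  simpl in Hn. inversion Hn as [|x l Hnot Hn']; subst. simpl. destruct Hp as [->|Hp].
  - rewrite Nat.eqb_refl, rsum_0; [ring|]. intros p' Hp'.
    destruct (Nat.eqb_spec (fst p) (fst p')) as [E|E]; [|reflexivity].
    exfalso. apply Hnot. rewrite E. now apply in_map.
  - rewrite IH by assumption.
    destruct (Nat.eqb_spec (fst p) (fst a)) as [E|E]; [|ring].
    exfalso. apply Hnot. rewrite <- E. now apply in_map.
Qed.

Lemma rsum_cauchy {A} (f : A -> R) l :
  rsum f l * rsum f l <= INR (length l) * rsum (fun a => f a * f a) l.
Proof.
  induction l as [|a l IH]; [simpl; lra|].
  change (length (a :: l)) with (S (length l)). rewrite S_INR. simpl rsum.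
  set (r := f a). set (s := rsum f l) in *. set (t := rsum (fun a => f a * f a) l) in *.
  assert (Ht : 0 <= t) by (apply rsum_nonneg; intros; apply Rle_0_sqr).
  pose proof (pos_INR (length l)) as Hk. set (k := INR (length l)) in *.
  assert (2 * (r * s) <= k * (r * r) + t).
  { destruct (Rle_lt_or_eq_dec 0 k Hk) as [K|K].
    - apply Rmult_le_reg_l with k; [assumption|].
      pose proof (Rle_0_sqr (k * r - s)) as Q. unfold Rsqr in Q. nra.
    - rewrite <- K in *. assert (s = 0) by nra. rewrite H. lra. }
  nra.
Qed.

Lemma sum_inv_sqrt_le m : rsum (fun a => inv_sqrt (INR a)) (seq 1 m) <= 2 * sqrt (INR m).
Proof.
  induction m as [|m IH]; [simpl; rewrite sqrt_0; lra|].
  rewrite seq_S, rsum_app. change (1 + m)%nat with (S m).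
  replace (rsum (fun a => inv_sqrt (INR a)) [S m]) with (inv_sqrt (INR (S m)))
    by (unfold rsum, fold_right; ring).
  pose proof (pos_INR m) as Hm. pose proof (sqrt_pos (INR m)) as P0.
  assert (P1 : 0 < sqrt (INR (S m))) by (apply sqrt_lt_R0, lt_0_INR; lia).
  assert (E1 : sqrt (INR (S m)) * sqrt (INR (S m)) = INR m + 1)
    by (rewrite sqrt_sqrt; [apply S_INR|apply pos_INR]).
  assert (E0 : sqrt (INR m) * sqrt (INR m) = INR m) by now apply sqrt_sqrt.
  set (x := sqrt (INR (S m))) in *. set (y := sqrt (INR m)) in *.
  assert (inv_sqrt (INR (S m)) <= 2 * (x - y)).
  { unfold inv_sqrt. fold x. apply Rmult_le_reg_r with x; [assumption|].
    rewrite Rinv_l by lra. pose proof (Rle_0_sqr (x - y)) as Q. unfold Rsqr in Q. nra. }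
  lra.
Qed.

Lemma chi_1 {q : nat} (chi : DirichletCharacter q) : chi 1%Z = RtoC 1.
Proof.
  assert (N : chi 1%Z <> RtoC 0) by (apply chi_support, rel_prime_1).
  pose proof (chi_mult q chi 1 1) as E. simpl in E.
  replace (chi 1%Z) with (/ chi 1%Z * (chi 1%Z * chi 1%Z))%C by (field; assumption).
  rewrite <- E. now apply Cinv_l.
Qed.

Lemma chi_m1 {q : nat} (chi : DirichletCharacter q) :
  exists eta, (eta = 1 \/ eta = -1) /\ chi (-1)%Z = RtoC eta.
Proof.
  pose proof (chi_mult q chi (-1) (-1)) as E. simpl in E. rewrite chi_1 in E.
  set (u := chi (-1)%Z) in *.
  assert (E2 : ((u - RtoC 1) * (u + RtoC 1) = RtoC 0)%C).
  { replace ((u - RtoC 1) * (u + RtoC 1))%C with (u * u - RtoC 1)%C by ring. rewrite <- E. ring. }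
  apply (f_equal Cmod) in E2. rewrite Cmod_mult, Cmod_0 in E2.
  apply Rmult_integral in E2. destruct E2 as [E2|E2]; apply Cmod_eq_0 in E2.
  - exists 1. split; [now left|]. replace u with (u - RtoC 1 + RtoC 1)%C by ring. rewrite E2. ring.
  - exists (-1). split; [now right|]. replace u with (u + RtoC 1 + RtoC (-1))%C by ring.
    rewrite E2. ring.
Qed.

Definition cong_ind (q : nat) (x y : Z) : R :=
  if Z.eqb (x mod Z.of_nat q) (y mod Z.of_nat q) then 1 else 0.

Definition resonator {q : nat} (chi : DirichletCharacter q) (I : list (nat * R)) : C :=
  lsum (fun p => (RtoC (snd p) * chi (Z.of_nat (fst p)))%C) I.

Definition sq_resonator {q : nat} (chi : DirichletCharacter q) (I : list (nat * R)) : R :=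
  Cmod (resonator chi I) * Cmod (resonator chi I).

Lemma sq_resonator_C {q : nat} (chi : DirichletCharacter q) I :
  RtoC (sq_resonator chi I) = (resonator chi I * Cconj (resonator chi I))%C.
Proof.
  unfold sq_resonator. rewrite <- Cmod2_conj. simpl. f_equal. ring.
Qed.

Lemma resonator_expand {q : nat} (chi : DirichletCharacter q) I :
  RtoC (sq_resonator chi I) = lsum (fun p => lsum (fun p' =>
    (RtoC (snd p * snd p') * (chi (Z.of_nat (fst p)) * Cconj (chi (Z.of_nat (fst p')))))%C) I) I.
Proof.
  rewrite sq_resonator_C. unfold resonator at 1. rewrite <- lsum_scal_r.
  apply lsum_ext. intros p _. unfold resonator. rewrite lsum_conj, <- lsum_scal.
  apply lsum_ext. intros p' _. rewrite RtoC_mult.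
  replace (Cconj (RtoC (snd p') * chi (Z.of_nat (fst p'))))%C
    with (RtoC (snd p') * Cconj (chi (Z.of_nat (fst p'))))%C
    by (apply injective_projections; simpl; ring). ring.
Qed.

Lemma rsum_double_scal {A} (c : R) (f : A -> A -> R) l :
  rsum (fun p => rsum (fun p' => c * f p p') l) l = c * rsum (fun p => rsum (f p) l) l.
Proof.
  rewrite <- rsum_scal. apply rsum_ext. intros p _. now rewrite <- rsum_scal.
Qed.

Lemma rsum_swap {A B} (f : A -> B -> R) la lb :
  rsum (fun a => rsum (fun b => f a b) lb) la = rsum (fun b => rsum (fun a => f a b) la) lb.
Proof.
  apply RtoC_inj. rewrite <- !lsum_RtoC.
  transitivity (lsum (fun a => lsum (fun b => RtoC (f a b)) lb) la).
  - apply lsum_ext. intros a _. now rewrite lsum_RtoC.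
  - rewrite lsum_swap. apply lsum_ext. intros b _. now rewrite lsum_RtoC.
Qed.

Definition good_resonator (q N : nat) (I : list (nat * R)) : Prop :=
  NoDup (map fst I) /\ (N * N * N <= q)%nat /\
  forall p, In p I -> (1 <= fst p <= N)%nat /\ 0 <= snd p.

Lemma resonator_sum_sq q N I : good_resonator q N I ->
  rsum snd I * rsum snd I <= INR N * den I.
Proof.
  intros [Hnd [_ HI]]. eapply Rle_trans; [apply rsum_cauchy|].
  apply Rmult_le_compat_r; [apply rsum_nonneg; intros; apply Rle_0_sqr|].
  apply le_INR. rewrite <- (length_map fst), <- (length_seq N 1).
  apply NoDup_incl_length; [assumption|]. intros n Hn. apply in_map_iff in Hn.
  destruct Hn as [p [<- Hp]]. apply in_seq. destruct (HI p Hp). lia.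
Qed.

Lemma sum_products (I : list (nat * R)) :
  rsum (fun p => rsum (fun p' => snd p * snd p') I) I = rsum snd I * rsum snd I.
Proof.
  transitivity (rsum (fun p => rsum snd I * snd p) I).
  - apply rsum_ext. intros p _. rewrite rsum_scal. ring.
  - apply rsum_scal.
Qed.

Section Resonance.

Variables (q : nat) (X : nat -> DirichletCharacter q) (w : nat -> R).
Hypothesis Hq : prime (Z.of_nat q).
Hypothesis Hq16 : (16 <= q)%nat.
Hypothesis Horth : forall x y, (x mod Z.of_nat q <> 0)%Z -> (y mod Z.of_nat q <> 0)%Z ->
  lsum (fun j => (X j x * Cconj (X j y))%C) (seq 0 (q - 1)) =
  if Z.eqb (x mod Z.of_nat q) (y mod Z.of_nat q) then RtoC (INR (q - 1)) else RtoC 0.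
Hypothesis Hbound : forall j z, Cmod (X j z) <= 1.
Hypothesis Hw : forall a, (1 <= a <= q)%nat ->
  0 <= w a <= inv_sqrt (INR a) /\ inv_sqrt (INR a) - inv_sqrt (INR q) <= w a.

Variables (N : nat) (I : list (nat * R)) (eps : R).
Hypothesis HI : good_resonator q N I.
Hypothesis Heps : eps = 1 \/ eps = -1.

Let units := seq 1 (q - 1).
Let idx := seq 0 (q - 1).
Let V (j : nat) : C := lsum (fun a => (X j (Z.of_nat a) * RtoC (w a))%C) units.
(* This is 2 or 0 according as the j-th character has parity eps or not. *)
Let parity (j : nat) : C := (RtoC 1 + RtoC eps * X j (-1)%Z)%C.

Local Notation same a p p' := (cong_ind q (Z.of_nat a * Z.of_nat (fst p)) (Z.of_nat (fst p'))).
Local Notation opposite a p p' :=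
  (cong_ind q (- (Z.of_nat a * Z.of_nat (fst p))) (Z.of_nat (fst p'))).
Local Notation twist j a p p' :=
  (X j (Z.of_nat a) * (X j (Z.of_nat (fst p)) * Cconj (X j (Z.of_nat (fst p')))))%C.

Let nonzero_mod a : (1 <= a < q)%nat -> (Z.of_nat a mod Z.of_nat q <> 0)%Z.
Proof. intros H. rewrite Z.mod_small; lia. Qed.

Let member_bound p : In p I -> (1 <= fst p < q)%nat.
Proof. intros H. destruct HI as [_ [HN Hp]]. destruct (Hp p H) as [H1 _]. nia. Qed.

Lemma orthogonality_parity a p p' : In a units -> In p I -> In p' I ->
  lsum (fun j => (parity j * twist j a p p')%C) idx
  = RtoC (INR (q - 1) * (same a p p'
       + eps * opposite a p p')).
Proof.
  intros Ha Hp Hp'. apply in_seq in Ha.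
  set (x := (Z.of_nat a * Z.of_nat (fst p))%Z). set (y := Z.of_nat (fst p')).
  assert (Hx : (x mod Z.of_nat q <> 0)%Z).
  { intros E. apply Z.mod_divide in E; [|lia]. apply prime_mult in E; [|assumption].
    destruct E as [E|E]; apply Z.mod_divide in E; try lia; revert E; apply nonzero_mod.
    - lia.
    - now apply member_bound. }
  assert (Hx' : (- x mod Z.of_nat q <> 0)%Z).
  { intros E. apply Hx. apply Z.mod_divide in E; [|lia]. apply Z.mod_divide; [lia|].
    now apply Z.divide_opp_r. }
  assert (Hy : (y mod Z.of_nat q <> 0)%Z) by now apply nonzero_mod, member_bound.
  rewrite (lsum_ext _ (fun j => (X j x * Cconj (X j y) + RtoC eps * (X j (- x)%Z * Cconj (X j y)))%C)).
  - rewrite lsum_plus, lsum_scal. unfold idx. rewrite !Horth by assumption. unfold cong_ind.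
    destruct (Z.eqb (x mod _) _), (Z.eqb (- x mod _) _); rewrite <- ?RtoC_mult, <- ?RtoC_plus;
      f_equal; ring.
  - intros j _. unfold x at 1. replace (- x)%Z with (-1 * x)%Z by ring.
    rewrite !chi_mult. unfold x. rewrite chi_mult. unfold parity, y. ring.
Qed.

Let twisted_moment : R := rsum (fun p => rsum (fun p' => rsum (fun a =>
   snd p * snd p' * (w a * (same a p p'
       + eps * opposite a p p'))) units) I) I.

Lemma twisted_moment_eq :
  lsum (fun j => (parity j * (V j * RtoC (sq_resonator (X j) I)))%C) idx
  = RtoC (INR (q - 1) * twisted_moment).
Proof.
  transitivity (lsum (fun p => lsum (fun p' => lsum (fun a => lsum (fun j =>
    (RtoC (snd p * snd p' * w a) * (parity j * twist j a p p'))%C)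
    idx) units) I) I).
  - transitivity (lsum (fun j => lsum (fun p => lsum (fun p' => lsum (fun a =>
      (RtoC (snd p * snd p' * w a) * (parity j * twist j a p p'))%C)
      units) I) I) idx).
    + apply lsum_ext. intros j _. rewrite resonator_expand, <- !lsum_scal.
      apply lsum_ext. intros p _. rewrite <- !lsum_scal.
      apply lsum_ext. intros p' _.
      unfold V. rewrite <- lsum_scal_r, <- lsum_scal. apply lsum_ext. intros a _.
      rewrite !RtoC_mult. ring.
    + rewrite lsum_swap. apply lsum_ext. intros p _.
      rewrite lsum_swap. apply lsum_ext. intros p' _. apply lsum_swap.
  - unfold twisted_moment. rewrite <- rsum_scal, <- lsum_RtoC. apply lsum_ext. intros p Hp.
    rewrite <- rsum_scal, <- lsum_RtoC. apply lsum_ext. intros p' Hp'.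
    rewrite <- rsum_scal, <- lsum_RtoC. apply lsum_ext. intros a Ha.
    rewrite lsum_scal, orthogonality_parity by assumption.
    rewrite <- RtoC_mult. f_equal. ring.
Qed.

(* An upper bound for the weight of a residue a with [a >= q / (2 N)]. *)
Let beta := sqrt 2 * sqrt (INR N) * inv_sqrt (INR q).

(** A solution of [a m = -n] modulo q has [a m + n >= q], so a is at least
    q / (2 N), and there is at most one such a. *)
Lemma opposite_congruence_bound p p' : In p I -> In p' I ->
  rsum (fun a => w a * opposite a p p') units <= beta.
Proof.
  intros Hp Hp'.
  assert (Hq0 : 0 < INR q) by (apply lt_0_INR; lia).
  assert (Hb0 : 0 <= beta).
  { unfold beta. repeat apply Rmult_le_pos; try apply sqrt_pos. left; now apply inv_sqrt_pos. }
  assert (Hc : forall a, opposite a p p' <> 0 ->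
     (Z.of_nat q | Z.of_nat a * Z.of_nat (fst p) + Z.of_nat (fst p'))%Z).
  { intros a Ha. unfold cong_ind in Ha. destruct (Z.eqb_spec (- (Z.of_nat a * Z.of_nat (fst p)) mod Z.of_nat q)
      (Z.of_nat (fst p') mod Z.of_nat q)) as [E|E]; [|lra].
    symmetry in E. apply Z.mod_divide; [lia|].
    replace (Z.of_nat a * Z.of_nat (fst p) + Z.of_nat (fst p'))%Z
      with (Z.of_nat (fst p') - - (Z.of_nat a * Z.of_nat (fst p)))%Z by ring.
    rewrite Zminus_mod, E, Z.sub_diag. reflexivity. }
  destruct HI as [_ [HN HIp]]. destruct (HIp p Hp) as [Bp _], (HIp p' Hp') as [Bp' _].
  apply rsum_at_most_one; [apply seq_NoDup|assumption| |].
  - intros a Ha. apply in_seq in Ha. destruct (Hw a ltac:(lia)) as [[W0 W1] _].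
    destruct (Req_dec (opposite a p p') 0) as [E|E].
    { rewrite E. lra. }
    pose proof (Hc a E) as D.
    assert (L : (q <= a * fst p + fst p')%nat).
    { apply Z.divide_pos_le in D; lia. }
    assert (E1 : opposite a p p' = 1).
    { unfold cong_ind in *. destruct (Z.eqb _ _); [reflexivity|lra]. }
    rewrite E1, Rmult_1_r. eapply Rle_trans; [exact W1|].
    assert (HaN : (q <= 2 * N * a)%nat) by nia.
    assert (Ha0 : 0 < INR a) by (apply lt_0_INR; lia).
    assert (HR : INR q <= 2 * INR N * INR a).
    { apply le_INR in HaN. rewrite !mult_INR in HaN. simpl in HaN. lra. }
    unfold beta, inv_sqrt.
    assert (Hs : sqrt (INR q) <= sqrt 2 * sqrt (INR N) * sqrt (INR a)).
    { rewrite <- !sqrt_mult_alt; try apply sqrt_le_1_alt; try lra.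
      pose proof (pos_INR N). lra. }
    pose proof (sqrt_lt_R0 _ Ha0). pose proof (sqrt_lt_R0 _ Hq0).
    apply Rmult_le_reg_r with (sqrt (INR a) * sqrt (INR q)).
    { now apply Rmult_lt_0_compat. }
    replace (/ sqrt (INR a) * (sqrt (INR a) * sqrt (INR q))) with (sqrt (INR q)) by (field; lra).
    replace (sqrt 2 * sqrt (INR N) * / sqrt (INR q) * (sqrt (INR a) * sqrt (INR q)))
      with (sqrt 2 * sqrt (INR N) * sqrt (INR a)) by (field; lra).
    exact Hs.
  - intros a b Ha Hb Ea Eb. apply in_seq in Ha, Hb.
    assert (Da := Hc a ltac:(intros E; apply Ea; rewrite E; ring)).
    assert (Db := Hc b ltac:(intros E; apply Eb; rewrite E; ring)).
    pose proof (Z.divide_sub_r _ _ _ Da Db) as D.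
    replace (Z.of_nat a * Z.of_nat (fst p) + Z.of_nat (fst p')
       - (Z.of_nat b * Z.of_nat (fst p) + Z.of_nat (fst p')))%Z
      with ((Z.of_nat a - Z.of_nat b) * Z.of_nat (fst p))%Z in D by ring.
    apply prime_mult in D; [|assumption]. destruct D as [D|D].
    + destruct (Z.eq_dec (Z.of_nat a - Z.of_nat b) 0) as [Z0|Z0]; [lia|].
      apply Z.divide_abs_r in D. apply Z.divide_pos_le in D; lia.
    + apply Z.divide_pos_le in D; [|lia]. pose proof (member_bound p Hp). lia.
Qed.

(** All weights are nonnegative.  The solutions of [a m = n] modulo q include
    [a = n / m] when m divides n, and the opposite congruence costs at most [beta]. *)
Lemma twisted_moment_lower :
  num I - (inv_sqrt (INR q) + beta) * (rsum snd I * rsum snd I) <= twisted_moment.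
Proof.
  rewrite <- sum_products.
  unfold Rminus. rewrite Ropp_mult_distr_l, <- rsum_double_scal. unfold num.
  rewrite <- rsum_plus. unfold twisted_moment. apply rsum_le. intros p Hp.
  rewrite <- rsum_plus. apply rsum_le. intros p' Hp'.
  rewrite rsum_scal.
  assert (Hr : 0 <= snd p * snd p').
  { destruct HI as [_ [_ H]]. apply Rmult_le_pos; now apply H. }
  pose proof (opposite_congruence_bound p p' Hp Hp') as Hopp.
  assert (Hq0 : 0 < inv_sqrt (INR q)) by (apply inv_sqrt_pos, lt_0_INR; lia).
  assert (Hw0 : forall a, In a units -> 0 <= w a).
  { intros a Ha. apply in_seq in Ha. apply Hw. lia. }
  assert (Hcg : forall x y, 0 <= cong_ind q x y) by (intros; unfold cong_ind; destruct (Z.eqb _ _); lra).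
  assert (Hopp0 : 0 <= rsum (fun a => w a * opposite a p p') units).
  { apply rsum_nonneg. intros a Ha. apply Rmult_le_pos; [now apply Hw0|apply Hcg]. }
  assert (Esplit : rsum (fun a => w a * (same a p p'
       + eps * opposite a p p')) units
     = rsum (fun a => w a * same a p p') units
       + eps * rsum (fun a => w a * opposite a p p') units).
  { rewrite <- rsum_scal, <- rsum_plus. apply rsum_ext. intros; ring. }
  rewrite Esplit.
  assert (Hmain : (if Nat.eqb (fst p' mod fst p) 0
      then sqrt (INR (fst p)) * inv_sqrt (INR (fst p')) else 0) - inv_sqrt (INR q)
      <= rsum (fun a => w a * same a p p') units).
  { assert (Hnn : forall a, In a units -> 0 <= w a * same a p p').
    { intros a Ha. apply Rmult_le_pos; [now apply Hw0|apply Hcg]. }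
    destruct (Nat.eqb_spec (fst p' mod fst p) 0) as [E|E].
    - pose proof (member_bound p Hp) as Bp. pose proof (member_bound p' Hp') as Bp'.
      apply Nat.Div0.mod_divides in E. destruct E as [a Ea].
      assert (Ha : In a units) by (apply in_seq; nia).
      eapply Rle_trans; [|apply (rsum_member _ _ a Hnn Ha)].
      assert (E1 : same a p p' = 1).
      { unfold cong_ind. rewrite Ea, Nat2Z.inj_mul, Z.mul_comm, Z.eqb_refl. reflexivity. }
      rewrite E1, Rmult_1_r. apply in_seq in Ha.
      assert (E2 : sqrt (INR (fst p)) * inv_sqrt (INR (fst p')) = inv_sqrt (INR a)).
      { unfold inv_sqrt. rewrite Ea, mult_INR, sqrt_mult_alt by apply pos_INR. field.
        split; apply Rgt_not_eq, sqrt_lt_R0, lt_0_INR; lia. }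
      rewrite E2. apply Hw. lia.
    - pose proof (rsum_nonneg _ _ Hnn). lra. }
  set (A := rsum (fun a => w a * same a p p') units) in *.
  set (B := rsum _ units) in *.
  assert (HeB : - beta <= eps * B) by (destruct Heps as [->| ->]; lra).
  replace (if Nat.eqb (fst p' mod fst p) 0
     then snd p * snd p' * (sqrt (INR (fst p)) * inv_sqrt (INR (fst p'))) else 0)
    with (snd p * snd p' * (if Nat.eqb (fst p' mod fst p) 0
      then sqrt (INR (fst p)) * inv_sqrt (INR (fst p')) else 0))
    by (destruct (Nat.eqb _ _); ring).
  set (D := if Nat.eqb (fst p' mod fst p) 0 then _ else _) in *.
  apply Rle_trans with (snd p * snd p' * (D - inv_sqrt (INR q) - beta)); [right; ring|].
  apply Rmult_le_compat_l; [assumption|lra].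
Qed.

(** Since [2 N < q], neither [m = n] with m <> n nor [m = -n] is possible modulo q. *)
Lemma parity_moment : lsum (fun j => (parity j * RtoC (sq_resonator (X j) I))%C) idx
  = RtoC (INR (q - 1) * den I).
Proof.
  assert (H1 : In 1%nat units) by (apply in_seq; lia).
  transitivity (lsum (fun p => lsum (fun p' => lsum (fun j =>
    (RtoC (snd p * snd p') * (parity j * twist j 1 p p'))%C)
    idx) I) I).
  - transitivity (lsum (fun j => lsum (fun p => lsum (fun p' =>
      (RtoC (snd p * snd p') * (parity j * twist j 1 p p'))%C)
      I) I) idx).
    + apply lsum_ext. intros j _. rewrite resonator_expand, <- !lsum_scal.
      apply lsum_ext. intros p _. rewrite <- !lsum_scal.
      apply lsum_ext. intros p' _. simpl Z.of_nat. rewrite chi_1. ring.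
    + rewrite lsum_swap. apply lsum_ext. intros p _. apply lsum_swap.
  - unfold den. rewrite <- rsum_scal, <- lsum_RtoC. apply lsum_ext. intros p Hp.
    destruct HI as [Hnd [HN HIp]].
    rewrite <- (rsum_diagonal I p Hnd Hp), <- rsum_scal, <- lsum_RtoC. apply lsum_ext. intros p' Hp'.
    rewrite lsum_scal, orthogonality_parity by assumption.
    rewrite <- RtoC_mult. f_equal.
    destruct (HIp p Hp) as [Bp _], (HIp p' Hp') as [Bp' _].
    pose proof (member_bound p Hp) as Mp. pose proof (member_bound p' Hp') as Mp'.
    assert (N2 : (2 * N < q)%nat) by nia.
    assert (E1 : same 1 p p'
       = if Nat.eqb (fst p) (fst p') then 1 else 0).
    { unfold cong_ind. rewrite !Z.mod_small by lia.
      destruct (Z.eqb_spec (Z.of_nat 1 * Z.of_nat (fst p)) (Z.of_nat (fst p'))),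
        (Nat.eqb_spec (fst p) (fst p')); try reflexivity; lia. }
    assert (E2 : opposite 1 p p' = 0).
    { unfold cong_ind. destruct (Z.eqb_spec (- (Z.of_nat 1 * Z.of_nat (fst p)) mod Z.of_nat q)
        (Z.of_nat (fst p') mod Z.of_nat q)) as [E|E]; [|reflexivity].
      exfalso. rewrite (Z.mod_small (Z.of_nat (fst p'))) in E by lia.
      rewrite <- (Z_mod_plus_full _ 1 (Z.of_nat q)), Z.mod_small in E by lia. lia. }
    rewrite E1, E2. destruct (Nat.eqb (fst p) (fst p')); ring.
Qed.

Lemma trivial_V_bound j : Cmod (V j) <= 2 * sqrt (INR q).
Proof.
  eapply Rle_trans; [apply lsum_Cmod|].
  apply Rle_trans with (rsum (fun a => inv_sqrt (INR a)) units).
  - apply rsum_le. intros a Ha. apply in_seq in Ha. destruct (Hw a ltac:(lia)) as [[W0 W1] _].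
    rewrite Cmod_mult, Cmod_R, Rabs_right by lra.
    apply Rle_trans with (1 * w a); [|lra]. apply Rmult_le_compat_r; [assumption|apply Hbound].
  - eapply Rle_trans; [apply sum_inv_sqrt_le|]. apply Rmult_le_compat_l; [lra|].
    apply sqrt_le_1_alt, le_INR. lia.
Qed.

Lemma trivial_resonator_bound j : sq_resonator (X j) I <= INR N * den I.
Proof.
  eapply Rle_trans; [|apply (resonator_sum_sq q N I HI)]. unfold sq_resonator.
  assert (H : Cmod (resonator (X j) I) <= rsum snd I).
  { eapply Rle_trans; [apply lsum_Cmod|]. apply rsum_le. intros p Hp.
    destruct HI as [_ [_ H]]. destruct (H p Hp) as [_ Hr].
    rewrite Cmod_mult, Cmod_R, Rabs_right by lra.
    apply Rle_trans with (snd p * 1); [|lra]. apply Rmult_le_compat_l; [assumption|apply Hbound]. }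
  apply Rmult_le_compat; try apply Cmod_ge_0; assumption.
Qed.

(** The second bound, for the opposite congruences, is the one that requires
    [N^3 <= q]. *)
Lemma N_bounds : INR N * inv_sqrt (INR q) <= 1 /\ INR N * beta <= 2 /\
  INR N * sqrt (INR q) <= 2 * INR (q - 1).
Proof.
  destruct HI as [_ [HN _]].
  assert (Hq0 : 0 < INR q) by (apply lt_0_INR; lia).
  pose proof (sqrt_lt_R0 _ Hq0) as Hs. pose proof (sqrt_sqrt (INR q) ltac:(lra)) as Es.
  pose proof (pos_INR N) as PN.
  assert (H3 : INR N * INR N * INR N <= INR q).
  { apply le_INR in HN. now rewrite !mult_INR in HN. }
  assert (H2 : INR N * INR N <= INR q).
  { assert (H : (N * N <= q)%nat) by nia. apply le_INR in H. now rewrite mult_INR in H. }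
  assert (H1 : INR N <= sqrt (INR q)).
  { apply Rsqr_incr_0_var; [|lra]. unfold Rsqr. lra. }
  repeat split.
  - unfold inv_sqrt. apply Rmult_le_reg_r with (sqrt (INR q)); [assumption|].
    rewrite Rmult_assoc, Rinv_l by lra. lra.
  - unfold beta, inv_sqrt. apply Rmult_le_reg_r with (sqrt (INR q)); [assumption|].
    replace (INR N * (sqrt 2 * sqrt (INR N) * / sqrt (INR q)) * sqrt (INR q))
      with (sqrt 2 * (INR N * sqrt (INR N))) by (field; lra).
    assert (A : INR N * sqrt (INR N) <= sqrt (INR q)).
    { apply Rsqr_incr_0_var; [|lra]. unfold Rsqr.
      replace (INR N * sqrt (INR N) * (INR N * sqrt (INR N)))
        with (INR N * INR N * (sqrt (INR N) * sqrt (INR N))) by ring.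
      rewrite !sqrt_sqrt by lra. lra. }
    assert (B : sqrt 2 <= 2).
    { rewrite <- (sqrt_square 2) at 2 by lra. apply sqrt_le_1_alt. lra. }
    apply Rmult_le_compat; try assumption; try apply sqrt_pos.
    apply Rmult_le_pos; [assumption|apply sqrt_pos].
  - apply Rle_trans with (INR q); [nra|]. rewrite minus_INR by lia. simpl.
    assert (16 <= INR q) by (replace 16 with (INR 16) by (simpl; ring); apply le_INR; lia). lra.
Qed.

(** The constant 11 is 3 + 8: at most 3 den is lost in [twisted_moment_lower], and the
    principal character, estimated trivially, contributes at most 8 (q - 1) den. *)
Lemma resonance_pigeonhole B : 0 <= B -> (B + 11) * den I < num I ->
  exists j, (0 < j < q - 1)%nat /\ X j (-1)%Z = RtoC eps /\ B <= Cmod (V j).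
Proof.
  intros HB Hlt. apply NNPP. intros Hno.
  assert (Hsmall : forall j, (0 < j < q - 1)%nat -> X j (-1)%Z = RtoC eps -> Cmod (V j) <= B).
  { intros j Hj E. apply Rnot_lt_le. intros H. apply Hno. exists j. repeat split; try lia; try assumption. lra. }
  assert (Hden : 0 <= den I) by (apply rsum_nonneg; intros; apply Rle_0_sqr).
  assert (par : forall j, exists t, parity j = RtoC t /\ 0 <= t <= 2 /\
     (t <> 0 -> X j (-1)%Z = RtoC eps)).
  { intros j. destruct (chi_m1 (X j)) as [eta [He E]]. exists (1 + eps * eta).
    unfold parity. rewrite E. rewrite <- RtoC_mult, <- RtoC_plus. split; [reflexivity|].
    destruct He as [->| ->], Heps as [->| ->]; split; try lra; intros H; try reflexivity; lra. }
  assert (Hsq : forall j, 0 <= sq_resonator (X j) I).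
  { intros j. apply Rmult_le_pos; apply Cmod_ge_0. }
  pose proof N_bounds as [NB1 [NB2 NB3]].
  assert (Hq1 : 0 < INR (q - 1)) by (apply lt_0_INR; lia).
  set (pr := fun j => Re (parity j)).
  assert (Hpr : forall j, parity j = RtoC (pr j)).
  { intros j. destruct (par j) as [t [E _]]. unfold pr. rewrite E. reflexivity. }
  assert (Hpr' : forall j, 0 <= pr j <= 2 /\ (pr j <> 0 -> X j (-1)%Z = RtoC eps)).
  { intros j. destruct (par j) as [t [E H]]. unfold pr. rewrite E. exact H. }
  assert (Eden : rsum (fun j => pr j * sq_resonator (X j) I) idx = INR (q - 1) * den I).
  { apply RtoC_inj. rewrite <- parity_moment, <- lsum_RtoC. apply lsum_ext.
    intros j _. rewrite Hpr, RtoC_mult. reflexivity. }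
  assert (Hterm : forall j, In j idx ->
     Cmod (parity j * (V j * RtoC (sq_resonator (X j) I)))
     <= B * (pr j * sq_resonator (X j) I)
        + (if Nat.eqb j 0 then 8 * INR (q - 1) * den I else 0)).
  { intros j Hj. apply in_seq in Hj. destruct (Hpr' j) as [[P0 P2] P1].
    rewrite !Cmod_mult, Hpr, !Cmod_R, (Rabs_right (pr j)), (Rabs_right (sq_resonator _ _))
      by (apply Rle_ge; auto).
    assert (M0 : 0 <= pr j * sq_resonator (X j) I) by (apply Rmult_le_pos; auto).
    assert (M1 : 0 <= B * (pr j * sq_resonator (X j) I)) by (apply Rmult_le_pos; auto).
    destruct (Nat.eqb_spec j 0) as [->|Hj0].
    - assert (pr 0%nat * (Cmod (V 0) * sq_resonator (X 0%nat) I)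
        <= 2 * (2 * sqrt (INR q) * (INR N * den I))).
      { apply Rmult_le_compat; try lra.
        - apply Rmult_le_pos; [apply Cmod_ge_0|apply Hsq].
        - apply Rmult_le_compat; [apply Cmod_ge_0|apply Hsq|apply trivial_V_bound|apply trivial_resonator_bound]. }
      assert (INR N * sqrt (INR q) * den I <= 2 * INR (q - 1) * den I)
        by now apply Rmult_le_compat_r.
      lra.
    - destruct (Req_dec (pr j) 0) as [E|E]; [rewrite E; lra|].
      replace (pr j * (Cmod (V j) * sq_resonator (X j) I))
        with (Cmod (V j) * (pr j * sq_resonator (X j) I)) by ring.
      rewrite Rplus_0_r. apply Rmult_le_compat_r; [assumption|]. apply Hsmall; [lia|auto]. }
  pose proof (lsum_Cmod (fun j => (parity j * (V j * RtoC (sq_resonator (X j) I)))%C) idx) as Htri.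
  pose proof (rsum_le _ _ _ Hterm) as Hle. rewrite rsum_plus, rsum_scal, Eden in Hle.
  assert (Efirst : rsum (fun j => if Nat.eqb j 0 then 8 * INR (q - 1) * den I else 0) idx
     = 8 * INR (q - 1) * den I).
  { unfold idx. replace (q - 1)%nat with (S (q - 2)) by lia.
    rewrite <- cons_seq. unfold rsum at 1. cbn [fold_right].
    change (8 * INR (S (q - 2)) * den I + rsum (fun j => if Nat.eqb j 0 then 8 * INR (S (q - 2)) * den I else 0)
      (seq 1 (q - 2)) = 8 * INR (S (q - 2)) * den I).
    rewrite rsum_0; [ring|]. intros j Hj. apply in_seq in Hj.
    destruct (Nat.eqb_spec j 0); [lia|reflexivity]. }
  rewrite Efirst in Hle. rewrite twisted_moment_eq, Cmod_R in Htri.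
  pose proof (Rle_abs (INR (q - 1) * twisted_moment)) as Habs.
  pose proof twisted_moment_lower as Hlow.
  pose proof (resonator_sum_sq q N I HI) as Hss.
  assert (Hb0 : 0 <= inv_sqrt (INR q) + beta).
  { assert (0 < inv_sqrt (INR q)) by (apply inv_sqrt_pos, lt_0_INR; lia).
    assert (0 <= beta); [|lra].
    unfold beta. repeat apply Rmult_le_pos; try apply sqrt_pos. lra. }
  assert (Hc : (inv_sqrt (INR q) + beta) * (rsum snd I * rsum snd I) <= 3 * den I).
  { apply Rle_trans with ((inv_sqrt (INR q) + beta) * (INR N * den I)).
    - now apply Rmult_le_compat_l.
    - replace ((inv_sqrt (INR q) + beta) * (INR N * den I))
        with ((INR N * inv_sqrt (INR q) + INR N * beta) * den I) by ring.
      apply Rmult_le_compat_r; [assumption|lra]. }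
  assert (Hfin : INR (q - 1) * (num I - 3 * den I) <= INR (q - 1) * ((B + 8) * den I)).
  { apply Rle_trans with (INR (q - 1) * twisted_moment).
    - apply Rmult_le_compat_l; lra.
    - lra. }
  apply Rmult_le_reg_l in Hfin; [lra|assumption].
Qed.

End Resonance.

Lemma resonance (q N : nat) (I : list (nat * R)) (eps B : R) :
  prime (Z.of_nat q) -> (16 <= q)%nat -> good_resonator q N I -> eps = 1 \/ eps = -1 ->
  0 <= B -> (B + 11) * den I < num I ->
  exists chi : DirichletCharacter q, chi (-1)%Z = RtoC eps /\ B <= Cmod (L chi (RtoC (1 / 2))).
Proof.
  intros Hq Hq16 HI Heps HB Hlt.
  destruct (dirichlet_characters q Hq) as [X [X1 [X2 [X3 X4]]]].
  destruct (central_value_formula q ltac:(lia)) as [w [Hw HL]].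
  destruct (resonance_pigeonhole q X w Hq Hq16 X2 X4 Hw N I eps HI Heps B HB Hlt)
    as [j [Hj [E HV]]].
  exists (X j). split; [exact E|]. rewrite HL; auto.
Qed.

(** * Primes: factorials and binomial coefficients *)

Module PrimeFacts.
From mathcomp Require Import ssreflect ssrfun ssrbool eqtype ssrnat seq div fintype bigop prime binomial.

Definition isprime (p : nat) : bool := prime.prime p.

Lemma dvdn_divide (d n : nat) : (d %| n)%N <-> Nat.divide d n.
Proof.
split; first by case/dvdnP => k ->; exists k.
by case=> k ->; apply: dvdn_mull.
Qed.

Lemma isprime_ge2 p : isprime p = true -> le 2 p.
Proof. by move=> /prime_gt1 /ltP. Qed.

Lemma isprime_euclid p a b : isprime p = true -> Nat.divide p (Nat.mul a b) ->
  Nat.divide p a \/ Nat.divide p b.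
Proof.
move=> pp /dvdn_divide; rewrite multE (Euclid_dvdM _ _ pp) => /orP [] /dvdn_divide; by [left|right].
Qed.

Lemma isprime_factor n : n <> 1%nat -> exists p, isprime p = true /\ Nat.divide p n.
Proof.
case: n => [|n] n1; first by exists 2%nat; split => //; exists 0%nat.
exists (pdiv n.+1); split; first by apply: pdiv_prime; case: n n1.
exact/dvdn_divide/pdiv_dvd.
Qed.

Lemma isprime_dvd_isprime p p' : isprime p = true -> isprime p' = true ->
  Nat.divide p p' -> p = p'.
Proof. by move=> pp pp' /dvdn_divide; rewrite (dvdn_prime2 pp pp') => /eqP. Qed.

Lemma iota_seq m n : iota m n = List.seq m n.
Proof. by elim: n m => //= n IH m; rewrite IH. Qed.

Lemma INR_gt0 n : (0 < n)%N -> Rlt 0 (INR n).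
Proof. by move=> /ltP; exact: lt_0_INR. Qed.

Lemma ln_prod (F : nat -> nat) (s : list nat) : (forall p, (0 < F p)%N) ->
  ln (INR (\prod_(p <- s) F p)%N) = rsum (fun p => ln (INR (F p))) s.
Proof.
move=> F0; elim: s => [|p s IH]; first by rewrite big_nil /= ln_1.
rewrite big_cons /= -multE mult_INR ln_mult ?IH //; first exact: INR_gt0.
by apply: INR_gt0; apply: prodn_gt0.
Qed.

Lemma ln_expn p k : (0 < p)%N -> ln (INR (p ^ k)%N) = Rmult (INR k) (ln (INR p)).
Proof.
move=> p0; elim: k => [|k IH]; first by rewrite expn0 /= ln_1 Rmult_0_l.
rewrite expnS -multE mult_INR ln_mult ?IH ?S_INR; [ring|exact: INR_gt0|].
by apply: INR_gt0; rewrite expn_gt0 p0.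
Qed.

Lemma ln_logn (n M : nat) : (0 < n)%N -> (n <= M)%N ->
  ln (INR n) = rsum (fun p => Rmult (INR (logn p n)) (ln (INR p))) (List.seq 0 (S M)).
Proof.
move=> n0 nM.
have E : n = (\prod_(p <- iota 0 M.+1) p ^ logn p n)%N.
  rewrite -{1}(partnT n0) (widen_partn _ nM) /index_iota subn0.
  by apply: eq_bigl.
have pos p : (0 < p ^ logn p n)%N by rewrite expn_gt0 lognE; case: p => //=.
rewrite {1}E (ln_prod _ _ pos) iota_seq; apply: rsum_ext => -[|p] _; last by rewrite ln_expn.
have -> : logn 0 n = 0%nat by rewrite lognE.
by rewrite expn0 /= ln_1 Rmult_0_l.
Qed.

Definition vfact (n p : nat) : nat := logn p n`!.

Lemma vfact_nonprime n p : isprime p = false -> vfact n p = 0%nat.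
Proof. by move=> pp; rewrite /vfact lognE; move: pp; rewrite /isprime => ->. Qed.

Lemma INR_vfact n p : INR (vfact n p) = rsum (fun m => INR (logn p m)) (List.seq 1 n).
Proof.
elim: n => [|n IH]; first by rewrite /vfact fact0 logn1.
rewrite /vfact factS (lognM _ (ltn0Sn n) (fact_gt0 n)) -plusE plus_INR.
rewrite -/(vfact n p) IH -[List.seq 1 n.+1]/(List.seq 1 (S n)) List.seq_S rsum_app /=.
ring.
Qed.

Lemma ln_fact n : rsum (fun m => ln (INR m)) (List.seq 1 n)
  = rsum (fun p => Rmult (INR (vfact n p)) (ln (INR p))) (List.seq 0 (S n)).
Proof.
transitivity (rsum (fun m => rsum (fun p => Rmult (INR (logn p m)) (ln (INR p))) (List.seq 0 (S n))) (List.seq 1 n)).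
  apply: rsum_ext => m /List.in_seq [/leP m1 m2]; apply: ln_logn => //.
  by apply/leP; lia.
rewrite rsum_swap; apply: rsum_ext => p _; rewrite INR_vfact.
by rewrite Rmult_comm -rsum_scal; apply: rsum_ext => m _; rewrite Rmult_comm.
Qed.

Lemma INR_divn_bounds n d : (0 < d)%N ->
  Rle (Rminus (Rdiv (INR n) (INR d)) 1) (INR (n %/ d)%N) /\
  Rle (INR (n %/ d)%N) (Rdiv (INR n) (INR d)).
Proof.
move=> d0; have D := INR_gt0 _ d0.
have E : INR n = Rplus (Rmult (INR (n %/ d)%N) (INR d)) (INR (n %% d)%N).
  by rewrite -mult_INR -plus_INR {1}(divn_eq n d) multE plusE.
have L : Rlt (INR (n %% d)%N) (INR d) by apply: lt_INR; apply/ltP; rewrite ltn_mod.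
have P := pos_INR (n %% d)%N.
have -> : Rdiv (INR n) (INR d) = Rplus (INR (n %/ d)%N) (Rdiv (INR (n %% d)%N) (INR d)).
  by rewrite E; field; lra.
have Q0 : Rle 0 (Rdiv (INR (n %% d)%N) (INR d)) by apply: Rdiv_le_0_compat.
have Q1 : Rlt (Rdiv (INR (n %% d)%N) (INR d)) 1.
  by apply: (Rmult_lt_reg_r (INR d)) => //; rewrite /Rdiv Rmult_assoc Rinv_l; lra.
lra.
Qed.

(** Legendre's formula: the lower bound keeps only the first term, the upper bound
    is the full geometric series. *)
Lemma vfact_bounds n p : isprime p = true ->
  Rle (Rminus (Rdiv (INR n) (INR p)) 1) (INR (vfact n p)) /\
  Rle (INR (vfact n p)) (Rdiv (INR n) (Rminus (INR p) 1)).
Proof.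
move=> pp; have p2 := isprime_ge2 _ pp; have p0 : (0 < p)%N by apply/ltP; lia.
have P2 : Rle 2 (INR p) by rewrite (_ : IZR 2 = INR 2) //; apply: le_INR.
have N0 := pos_INR n.
rewrite /vfact (logn_fact _ pp); split.
- apply: Rle_trans (proj1 (INR_divn_bounds n p p0)) _.
  apply: le_INR; apply/leP; case: n {N0} => [|n]; first by rewrite div0n.
  by rewrite big_ltn // expn1 leq_addr.
- have H K : Rle (INR (\sum_(1 <= k < K.+1) n %/ p ^ k)%N)
      (Rmult (Rdiv (INR n) (Rminus (INR p) 1)) (Rminus 1 (pow (/ INR p) K))).
    elim: K => [|K IH]; first by rewrite big_geq //= Rminus_diag Rmult_0_r; lra.
    have -> : INR (\sum_(1 <= k < K.+2) n %/ p ^ k)%N =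
        Rplus (INR (\sum_(1 <= k < K.+1) n %/ p ^ k)%N) (INR (n %/ p ^ K.+1)%N).
      by rewrite big_nat_recr //= -plusE plus_INR.
    have pK : (0 < p ^ K.+1)%N by rewrite expn_gt0 p0.
    have := proj2 (INR_divn_bounds n _ pK).
    have -> : INR (p ^ K.+1)%N = pow (INR p) K.+1.
      by elim: K.+1 => [|k IHk] //=; rewrite expnS -multE mult_INR IHk.
    have -> : Rdiv (INR n) (pow (INR p) K.+1) = Rmult (INR n) (pow (/ INR p) K.+1).
      by rewrite /Rdiv pow_inv.
    have T : Rmult (Rdiv (INR n) (Rminus (INR p) 1)) (Rminus 1 (pow (/ INR p) K.+1))
       = Rplus (Rmult (Rdiv (INR n) (Rminus (INR p) 1)) (Rminus 1 (pow (/ INR p) K)))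
               (Rmult (INR n) (pow (/ INR p) K.+1)).
      rewrite /=; field; lra.
    by move=> D; rewrite T; apply: Rplus_le_compat.
  apply: Rle_trans (H n) _.
  have X : Rle 0 (pow (/ INR p) n).
    by apply: pow_le; left; apply: Rinv_0_lt_compat; lra.
  have Y : Rle 0 (Rdiv (INR n) (Rminus (INR p) 1)) by apply: Rdiv_le_0_compat; lra.
  nra.
Qed.

(** Every prime in (n, 2 n] divides the central binomial coefficient, which is at
    most [2^(2 n)]. *)
Lemma chebyshev_step n :
  Rle (rsum (fun p => if isprime p then ln (INR p) else R0) (List.seq (S n) n))
      (Rmult (Rmult 2 (INR n)) (ln 2)).
Proof.
set b := 'C(n.*2, n).
have b0 : (0 < b)%N by rewrite bin_gt0 -addnn leq_addr.
have bE : (b * (n`! * n`!) = (n.*2)`!)%N.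
  have H : (n <= n.*2)%N by rewrite -addnn leq_addr.
  have E : (n.*2 - n = n)%N by rewrite -addnn addnK.
  by rewrite -(bin_fact H) E.
have b4 : (b <= 2 ^ n.*2)%N.
  rewrite -[2%N]/(1 + 1)%N Pascal.
  have nn : (n < n.*2.+1)%N by rewrite ltnS -addnn leq_addr.
  rewrite (bigD1 (Ordinal nn)) //= !exp1n !muln1.
  exact: leq_addr.
have nb : (n.*2 <= maxn b n.*2)%N by exact: leq_maxr.
have L : Rle (ln (INR b)) (Rmult (Rmult 2 (INR n)) (ln 2)).
  apply: Rle_trans (_ : Rle _ (ln (INR (2 ^ n.*2)%N))) _.
    by apply: ln_le; [exact: INR_gt0|apply: le_INR; apply/leP].
  rewrite ln_expn // (_ : INR 2 = IZR 2) // -addnn -plusE plus_INR; lra.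
apply: Rle_trans L; rewrite (ln_logn b (maxn b n.*2) b0 (leq_maxl _ _)).
set M := maxn b n.*2.
have -> : S M = Nat.add (S n) (Nat.add n (M - n.*2)%N).
  by rewrite !plusE addSn addnA addnn subnKC.
rewrite !List.seq_app !rsum_app.
have nn (s : list nat) : Rle 0 (rsum (fun p => Rmult (INR (logn p b)) (ln (INR p))) s).
  apply: rsum_nonneg => -[|p] _; first by rewrite lognE /= Rmult_0_l; lra.
  apply: Rmult_le_pos; first exact: pos_INR.
  by rewrite -ln_1; apply: ln_le; [lra|rewrite (_ : IZR 1 = INR 1) //; apply: le_INR; lia].
have S1 := nn (List.seq 0 (S n)).
have S3 := nn (List.seq (Nat.add (Nat.add 0 (S n)) n) (M - n.*2)%N).
have S2 : Rle (rsum (fun p => if isprime p then ln (INR p) else R0) (List.seq (S n) n))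
  (rsum (fun p => Rmult (INR (logn p b)) (ln (INR p))) (List.seq (Nat.add 0 (S n)) n)).
  apply: rsum_le => p /List.in_seq [p1 p2].
  have lp : Rle 0 (ln (INR p)).
    by rewrite -ln_1; apply: ln_le; [lra|rewrite (_ : IZR 1 = INR 1) //; apply: le_INR; lia].
  case pp: (isprime p); last by apply: Rmult_le_pos => //; exact: pos_INR.
  have pb : (p %| b)%N.
    have : (p %| b * (n`! * n`!))%N.
      by rewrite bE; apply: dvdn_fact; apply/andP; split; apply/leP; rewrite -?addnn -?plusE; lia.
    have pn : (p %| n`!)%N = false.
      apply/negP => d; have : (0 < logn p n`!)%N.
        by rewrite logn_gt0 mem_primes; apply/and3P; split => //; exact: fact_gt0.
      rewrite (logn_fact n pp) big_nat big1 // => k /andP [k1 _].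
      apply: divn_small; apply: (@leq_trans p); first by apply/ltP; lia.
      by rewrite -{1}(expn1 p) leq_pexp2l //; apply/ltP; lia.
    by rewrite !(Euclid_dvdM _ _ pp) pn !orbF.
  have : (0 < logn p b)%N by rewrite logn_gt0 mem_primes; apply/and3P; split.
  move=> /ltP l0; have l1 := le_INR (S O) _ l0; rewrite (_ : INR (S O) = IZR 1) // in l1.
  by rewrite -{1}(Rmult_1_l (ln (INR p))); apply: Rmult_le_compat_r.
lra.
Qed.

End PrimeFacts.

(** * Mertens' first theorem *)

Notation isprime := PrimeFacts.isprime.

Definition prime_sum (f : nat -> R) (s : list nat) : R :=
  rsum (fun p => if isprime p then f p else 0) s.

Lemma ln_INR_nonneg n : (1 <= n)%nat -> 0 <= ln (INR n).
Proof.
  intros H. rewrite <- ln_1. apply ln_le; [lra|]. apply (le_INR 1). exact H.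
Qed.

Lemma prime_sum_nonneg f s : (forall p, In p s -> isprime p = true -> 0 <= f p) -> 0 <= prime_sum f s.
Proof.
  intros H. apply rsum_nonneg. intros p Hp. destruct (isprime p) eqn:E; [now apply H|lra].
Qed.

Lemma prime_sum_app f s t : prime_sum f (s ++ t) = prime_sum f s + prime_sum f t.
Proof. apply rsum_app. Qed.

Lemma not_prime_1 : isprime 1 = false.
Proof. reflexivity. Qed.

(** Strong induction, from m or m + 1 to n = 2 m or 2 m + 1; the constant 4, instead
    of the 2 that pure doubling would give, absorbs the rounding. *)
Lemma chebyshev_upper n : prime_sum (fun p => ln (INR p)) (seq 1 n) <= 4 * ln 2 * INR n.
Proof.
  assert (L2 : 0 < ln 2) by (rewrite <- ln_1; apply ln_increasing; lra).
  assert (step : forall m, prime_sum (fun p => ln (INR p)) (seq 1 (m + m))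
     <= prime_sum (fun p => ln (INR p)) (seq 1 m) + 2 * INR m * ln 2).
  { intros m. rewrite seq_app, prime_sum_app. apply Rplus_le_compat_l.
    exact (PrimeFacts.chebyshev_step m). }
  induction n as [n IH] using (well_founded_induction lt_wf).
  destruct (Nat.Even_or_Odd n) as [[m Hm]|[m Hm]].
  - destruct m as [|m]; [subst; simpl; lra|].
    specialize (IH (S m) ltac:(lia)). specialize (step (S m)).
    assert (0 <= ln 2 * INR (S m)) by (apply Rmult_le_pos; [lra|apply pos_INR]).
    replace n with (S m + S m)%nat by lia. rewrite plus_INR. lra.
  - destruct m as [|m].
    + subst n. change (2 * 0 + 1)%nat with 1%nat. unfold prime_sum, rsum; cbn [seq fold_right].
      rewrite not_prime_1. simpl. lra.
    + specialize (IH (S (S m)) ltac:(lia)). specialize (step (S (S m))).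
      replace (S (S m) + S (S m))%nat with (n + 1)%nat in step by lia.
      rewrite seq_app, prime_sum_app in step.
      assert (0 <= prime_sum (fun p => ln (INR p)) (seq (1 + n) 1)).
      { apply prime_sum_nonneg. intros p Hp _. apply in_seq in Hp. apply ln_INR_nonneg. lia. }
      replace (INR n) with (2 * INR (S (S m)) - 1).
      * assert (2 <= INR (S (S m))) by (rewrite !S_INR; pose proof (pos_INR m); lra).
        assert (ln 2 * 2 <= ln 2 * INR (S (S m))) by (apply Rmult_le_compat_l; lra). lra.
      * rewrite Hm, plus_INR, mult_INR, !S_INR. simpl. ring.
Qed.

Lemma ln_fact_prime_sum n : rsum (fun m => ln (INR m)) (seq 1 n)
  = prime_sum (fun p => INR (PrimeFacts.vfact n p) * ln (INR p)) (seq 1 n).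
Proof.
  rewrite PrimeFacts.ln_fact, <- cons_seq. unfold rsum at 1. cbn [fold_right].
  rewrite PrimeFacts.vfact_nonprime by reflexivity. rewrite Rmult_0_l, Rplus_0_l.
  apply rsum_ext. intros p _. destruct (isprime p) eqn:E; [reflexivity|].
  rewrite PrimeFacts.vfact_nonprime by assumption. simpl. ring.
Qed.

Lemma ln_fact_upper n : rsum (fun m => ln (INR m)) (seq 1 n) <= INR n * ln (INR n).
Proof.
  assert (H : forall k, (k <= n)%nat ->
    rsum (fun m => ln (INR m)) (seq 1 k) <= INR k * ln (INR n)).
  { induction k as [|k IH]; intros Hk; [simpl; lra|].
    rewrite seq_S, rsum_app, S_INR. specialize (IH ltac:(lia)).
    change (1 + k)%nat with (S k).
    replace (rsum (fun m => ln (INR m)) [S k]) with (ln (INR (S k)))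
      by (unfold rsum, fold_right; ring).
    assert (ln (INR (S k)) <= ln (INR n)) by (apply ln_le; [apply lt_0_INR; lia|now apply le_INR]).
    lra. }
  now apply H.
Qed.

Lemma ln_succ_diff n : (1 <= n)%nat -> INR n * (ln (INR (S n)) - ln (INR n)) <= 1.
Proof.
  intros Hn. assert (P : 0 < INR n) by (apply lt_0_INR; lia).
  rewrite S_INR, <- ln_div by lra.
  replace ((INR n + 1) / INR n) with (1 + / INR n) by (field; lra).
  assert (Q : 0 < / INR n) by now apply Rinv_0_lt_compat.
  pose proof (exp_ineq1 (/ INR n) ltac:(lra)) as E.
  assert (L : ln (1 + / INR n) <= / INR n).
  { rewrite <- (ln_exp (/ INR n)) at 2. apply ln_le; lra. }
  apply Rle_trans with (INR n * / INR n); [apply Rmult_le_compat_l; lra|].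
  rewrite Rinv_r; lra.
Qed.

Lemma ln_fact_lower n : (1 <= n)%nat ->
  INR n * ln (INR n) - INR n <= rsum (fun m => ln (INR m)) (seq 1 n).
Proof.
  intros Hn. induction n as [|n IH]; [lia|].
  destruct n as [|n]; [simpl; rewrite ln_1; lra|].
  specialize (IH ltac:(lia)). rewrite seq_S, rsum_app. change (1 + S n)%nat with (S (S n)).
  replace (rsum (fun m => ln (INR m)) [S (S n)]) with (ln (INR (S (S n))))
    by (unfold rsum, fold_right; ring).
  pose proof (ln_succ_diff (S n) ltac:(lia)) as D. rewrite (S_INR (S n)) at 1 3. lra.
Qed.

(** The telescoping majorant (ln m + 2) / m of the tail of ln m / (m (m - 1)). *)
Lemma ln_over_square_sum n : (1 <= n)%nat ->
  prime_sum (fun p => ln (INR p) / (INR p * (INR p - 1))) (seq 1 n)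
  <= 2 - (ln (INR n) + 2) / INR n.
Proof.
  intros Hn. induction n as [|n IH]; [lia|].
  destruct n as [|n].
  - unfold prime_sum, rsum; cbn [seq fold_right].
    rewrite not_prime_1. simpl. rewrite ln_1. lra.
  - specialize (IH ltac:(lia)). rewrite seq_S, prime_sum_app. change (1 + S n)%nat with (S (S n)).
    set (m := INR (S n)) in *. assert (Em : INR (S (S n)) = m + 1) by apply S_INR.
    assert (Hm : 1 <= m) by (unfold m; apply (le_INR 1); lia).
    assert (T : prime_sum (fun p => ln (INR p) / (INR p * (INR p - 1))) [S (S n)]
       <= ln (m + 1) / ((m + 1) * (m + 1 - 1))).
    { unfold prime_sum, rsum. cbn [fold_right]. rewrite Em.
      assert (0 <= ln (m + 1) / ((m + 1) * (m + 1 - 1))).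
      { apply Rdiv_le_0_compat; [|nra]. rewrite <- ln_1. apply ln_le; lra. }
      destruct (isprime (S (S n))); lra. }
    pose proof (ln_succ_diff (S n) ltac:(lia)) as D. fold m in D. rewrite Em in D |- *.
    assert (K : ln (m + 1) / ((m + 1) * (m + 1 - 1)) <= (ln m + 2) / m - (ln (m + 1) + 2) / (m + 1)).
    { apply Rmult_le_reg_r with (m * (m + 1)); [nra|].
      replace (ln (m + 1) / ((m + 1) * (m + 1 - 1)) * (m * (m + 1))) with (ln (m + 1)) by (field; lra).
      replace (((ln m + 2) / m - (ln (m + 1) + 2) / (m + 1)) * (m * (m + 1)))
        with ((ln m + 2) * (m + 1) - (ln (m + 1) + 2) * m) by (field; lra).
      assert (ln (m + 1) - ln m <= 1).
      { assert (0 <= ln (m + 1) - ln m) by (assert (ln m <= ln (m + 1)) by (apply ln_le; lra); lra).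
        nra. }
      lra. }
    lra.
Qed.

Lemma prime_sum_le f g s : (forall p, In p s -> isprime p = true -> f p <= g p) -> prime_sum f s <= prime_sum g s.
Proof.
  intros H. apply rsum_le. intros p Hp. destruct (isprime p) eqn:E; [now apply H|lra].
Qed.

Lemma prime_sum_plus f g s : prime_sum (fun p => f p + g p) s = prime_sum f s + prime_sum g s.
Proof.
  unfold prime_sum. rewrite <- rsum_plus. apply rsum_ext. intros p _. destruct (isprime p); ring.
Qed.

Lemma prime_sum_scal c f s : prime_sum (fun p => c * f p) s = c * prime_sum f s.
Proof.
  unfold prime_sum. rewrite <- rsum_scal. apply rsum_ext. intros p _. destruct (isprime p); ring.
Qed.

Lemma prime_INR_ge2 p : isprime p = true -> 2 <= INR p.
Proof.
  intros H. apply PrimeFacts.isprime_ge2, le_INR in H. simpl in H. lra.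
Qed.

(** In [ln n! = sum v_p ln p] the left side is at least [n ln n - n] and the exponents
    are at most [n / (p - 1)]. *)
Lemma mertens_lower n : (1 <= n)%nat ->
  ln (INR n) - 3 <= prime_sum (fun p => ln (INR p) / INR p) (seq 1 n).
Proof.
  intros Hn. assert (P : 0 < INR n) by (apply lt_0_INR; lia).
  pose proof (ln_fact_lower n Hn) as L. rewrite ln_fact_prime_sum in L.
  assert (U : prime_sum (fun p => INR (PrimeFacts.vfact n p) * ln (INR p)) (seq 1 n)
    <= INR n * (prime_sum (fun p => ln (INR p) / INR p) (seq 1 n)
        + prime_sum (fun p => ln (INR p) / (INR p * (INR p - 1))) (seq 1 n))).
  { rewrite <- prime_sum_plus, <- prime_sum_scal. apply prime_sum_le. intros p Hp Ep.
    apply in_seq in Hp. pose proof (prime_INR_ge2 p Ep) as P2.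
    destruct (PrimeFacts.vfact_bounds n p Ep) as [_ B].
    apply Rle_trans with (INR n / (INR p - 1) * ln (INR p)).
    - apply Rmult_le_compat_r; [apply ln_INR_nonneg; lia|assumption].
    - right. field. lra. }
  pose proof (ln_over_square_sum n Hn) as S.
  assert (0 <= (ln (INR n) + 2) / INR n).
  { apply Rdiv_le_0_compat; [|assumption]. pose proof (ln_INR_nonneg n Hn). lra. }
  apply Rmult_le_reg_l with (INR n); [assumption|].
  assert (INR n * prime_sum (fun p => ln (INR p) / (INR p * (INR p - 1))) (seq 1 n) <= INR n * 2)
    by (apply Rmult_le_compat_l; lra).
  lra.
Qed.

(** Here the exponents are at least [n / p - 1], and Chebyshev's bound controls the
    total error of the subtracted 1. *)
Lemma mertens_upper n : (1 <= n)%nat ->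
  prime_sum (fun p => ln (INR p) / INR p) (seq 1 n) <= ln (INR n) + 4.
Proof.
  intros Hn. assert (P : 0 < INR n) by (apply lt_0_INR; lia).
  pose proof (ln_fact_upper n) as L. rewrite ln_fact_prime_sum in L.
  assert (U : INR n * prime_sum (fun p => ln (INR p) / INR p) (seq 1 n)
      <= prime_sum (fun p => INR (PrimeFacts.vfact n p) * ln (INR p)) (seq 1 n)
         + prime_sum (fun p => ln (INR p)) (seq 1 n)).
  { rewrite <- prime_sum_plus, <- prime_sum_scal. apply prime_sum_le. intros p Hp Ep.
    apply in_seq in Hp. pose proof (prime_INR_ge2 p Ep) as P2.
    destruct (PrimeFacts.vfact_bounds n p Ep) as [B _].
    pose proof (ln_INR_nonneg p ltac:(lia)) as Lp.
    apply Rle_trans with ((INR n / INR p - 1) * ln (INR p) + ln (INR p)).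
    - right. field. lra.
    - apply Rplus_le_compat_r. now apply Rmult_le_compat_r. }
  pose proof (chebyshev_upper n) as C.
  assert (L2 : ln 2 <= 1).
  { rewrite <- (ln_exp 1). apply ln_le; [lra|]. pose proof (exp_ineq1 1 ltac:(lra)). lra. }
  apply Rmult_le_reg_l with (INR n); [assumption|].
  assert (4 * ln 2 * INR n <= 4 * 1 * INR n) by (apply Rmult_le_compat_r; lra).
  lra.
Qed.

Lemma mertens_interval u v : (1 <= u <= v)%nat ->
  ln (INR v) - ln (INR u) - 7 <= prime_sum (fun p => ln (INR p) / INR p) (seq (S u) (v - u)).
Proof.
  intros H. pose proof (mertens_lower v ltac:(lia)) as L. pose proof (mertens_upper u ltac:(lia)) as U.
  replace v with (u + (v - u))%nat in L at 2 by lia. rewrite seq_app, prime_sum_app in L.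
  change (1 + u)%nat with (S u) in L. lra.
Qed.

(** * Resonators *)

(** A subset is represented by its product and its cardinality, the only data on
    which the weights depend. *)
Fixpoint subsets (P : list nat) : list (nat * nat) :=
  match P with
  | [] => [(1%nat, 0%nat)]
  | p :: P' => subsets P' ++ map (fun t => ((p * fst t)%nat, S (snd t))) (subsets P')
  end.

Lemma rsum_map {A B} (h : A -> B) (f : B -> R) l : rsum f (map h l) = rsum (fun a => f (h a)) l.
Proof. induction l as [|a l IH]; simpl; [reflexivity|now rewrite IH]. Qed.

Lemma rsum_filter {A} (b : A -> bool) (f : A -> R) l :
  rsum f (filter b l) = rsum (fun a => if b a then f a else 0) l.
Proof.
  induction l as [|a l IH]; simpl; [reflexivity|]. destruct (b a); simpl; rewrite IH; ring.
Qed.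

Lemma rsum_subsets p P (f : nat * nat -> R) : rsum f (subsets (p :: P))
  = rsum f (subsets P) + rsum (fun t => f ((p * fst t)%nat, S (snd t))) (subsets P).
Proof. simpl. now rewrite rsum_app, rsum_map. Qed.

(** Elementary symmetric function of the inverses of the members of P. *)
Definition esym (P : list nat) (j : nat) : R :=
  rsum (fun t => if Nat.eqb (snd t) j then / INR (fst t) else 0) (subsets P).

Lemma esym_cons_0 p P : esym (p :: P) 0 = esym P 0.
Proof.
  unfold esym. rewrite rsum_subsets. rewrite (rsum_0 (fun t => if Nat.eqb (snd ((p * fst t)%nat, S (snd t))) 0 then _ else _)).
  - ring.
  - intros t _. reflexivity.
Qed.

Lemma esym_cons_S p P j : esym (p :: P) (S j) = esym P (S j) + / INR p * esym P j.
Proof.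
  unfold esym. rewrite rsum_subsets, <- rsum_scal. f_equal. apply rsum_ext. intros t _.
  cbn [fst snd Nat.eqb]. rewrite mult_INR, Rinv_mult. destruct (Nat.eqb (snd t) j); ring.
Qed.

Lemma subsets_ge1 P : (forall p, In p P -> (1 <= p)%nat) ->
  forall t, In t (subsets P) -> (1 <= fst t)%nat.
Proof.
  induction P as [|p P IH]; intros HP t Ht.
  - destruct Ht as [<-|[]]. simpl. lia.
  - assert (IH' := IH (fun p' Hp' => HP p' (or_intror Hp'))).
    simpl in Ht. apply in_app_iff in Ht. destruct Ht as [Ht|Ht]; [auto|].
    apply in_map_iff in Ht. destruct Ht as [t' [<- Ht']]. simpl.
    specialize (IH' t' Ht'). specialize (HP p (or_introl eq_refl)). nia.
Qed.

Lemma esym_nonneg P j : (forall p, In p P -> (1 <= p)%nat) -> 0 <= esym P j.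
Proof.
  intros HP. apply rsum_nonneg. intros t Ht. destruct (Nat.eqb (snd t) j); [|lra].
  left. apply Rinv_0_lt_compat, lt_0_INR. pose proof (subsets_ge1 P HP t Ht). lia.
Qed.

Definition inv_sum (P : list nat) : R := rsum (fun p => / INR p) P.

(** Adjoining one more element to a j-subset in all possible ways produces each
    (j+1)-subset j+1 times. *)
Lemma esym_ratio P mu : (forall p, In p P -> (1 <= p)%nat /\ / INR p <= mu) ->
  forall j, (inv_sum P - INR j * mu) * esym P j <= INR (S j) * esym P (S j).
Proof.
  induction P as [|p P IH]; intros HP j.
  - unfold esym, inv_sum, rsum; simpl. destruct j as [|j]; simpl; lra.
  - assert (HP' : forall p', In p' P -> (1 <= p')%nat /\ / INR p' <= mu)
      by (intros; apply HP; now right).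
    specialize (IH HP'). destruct (HP p (or_introl eq_refl)) as [Hp1 Hpm].
    assert (HN : forall i, 0 <= esym P i) by (intros i; apply esym_nonneg; intros; now apply HP').
    assert (Hx : 0 < / INR p) by (apply Rinv_0_lt_compat, lt_0_INR; lia).
    change (inv_sum (p :: P)) with (/ INR p + inv_sum P).
    set (x := / INR p) in *. set (s := inv_sum P) in *.
    destruct j as [|i].
    + rewrite esym_cons_0, esym_cons_S. fold x. specialize (IH O). simpl in *. lra.
    + rewrite !esym_cons_S. fold x.
      pose proof (IH (S i)) as I1. pose proof (IH i) as I0.
      rewrite (S_INR (S i)) in *. rewrite (S_INR i) in *.
      set (a := esym P i) in *. set (b := esym P (S i)) in *. set (c := esym P (S (S i))) in *.
      pose proof (HN i) as Ha. fold a in Ha.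
      assert (K : x * ((s - INR i * mu) * a) <= x * ((INR i + 1) * b)) by (apply Rmult_le_compat_l; lra).
      assert (K2 : 0 <= x * ((mu - x) * a)) by (apply Rmult_le_pos; [lra|apply Rmult_le_pos; lra]).
      lra.
Qed.

Lemma subsets_den (P : list nat) (k : nat) (f : nat -> R) :
  rsum (fun t => if Nat.leb (snd t) k then f (snd t) * / INR (fst t) else 0) (subsets P)
  = rsum (fun j => f j * esym P j) (seq 0 (S k)).
Proof.
  transitivity (rsum (fun j => rsum (fun t => if Nat.eqb (snd t) j then f j * / INR (fst t) else 0) (subsets P)) (seq 0 (S k))).
  - rewrite rsum_swap. apply rsum_ext. intros t _.
    assert (H : forall m, rsum (fun j => if Nat.eqb (snd t) j then f j * / INR (fst t) else 0) (seq 0 m)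
       = if Nat.ltb (snd t) m then f (snd t) * / INR (fst t) else 0).
    { induction m as [|m IH]; [reflexivity|].
      rewrite seq_S, rsum_app, IH. unfold rsum; cbn [fold_right Nat.add].
      destruct (Nat.eqb_spec (snd t) m), (Nat.ltb_spec (snd t) m), (Nat.ltb_spec (snd t) (S m));
        try lia; subst; ring. }
    rewrite H. destruct (Nat.ltb_spec (snd t) (S k)), (Nat.leb_spec (snd t) k); try lia; reflexivity.
  - apply rsum_ext. intros j _. unfold esym. rewrite <- rsum_scal. apply rsum_ext.
    intros t _. destruct (Nat.eqb (snd t) j); ring.
Qed.

(** The divisors of a product of i primes contribute the binomial expansion of
    [(1 + rho)^i]; a divisor avoids the first prime or is a multiple of it. *)
Lemma subset_divisor_sum rho P : 0 <= rho -> forall k t', In t' (subsets P) -> (snd t' <= k)%nat ->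
  (1 + rho) ^ snd t' <=
  rsum (fun t => if andb (Nat.leb (snd t) k) (Nat.eqb (fst t' mod fst t) 0)
                 then rho ^ snd t else 0) (subsets P).
Proof.
  intros Hr. assert (Hpow : forall i, 0 <= rho ^ i) by (intros; now apply pow_le).
  induction P as [|p P IH]; intros k t' Ht' Hk.
  - destruct Ht' as [<-|[]]. unfold rsum; simpl. lra.
  - rewrite rsum_subsets. simpl in Ht'. apply in_app_iff in Ht'. destruct Ht' as [Ht'|Ht'].
    + eapply Rle_trans; [apply (IH k t' Ht' Hk)|].
      assert (0 <= rsum (fun t => if andb (Nat.leb (snd ((p * fst t)%nat, S (snd t))) k)
          (Nat.eqb (fst t' mod fst ((p * fst t)%nat, S (snd t))) 0)
          then rho ^ snd ((p * fst t)%nat, S (snd t)) else 0) (subsets P)); [|lra].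
      apply rsum_nonneg. intros t _. destruct (andb _ _); [apply Hpow|lra].
    + apply in_map_iff in Ht'. destruct Ht' as [t0 [<- Ht0]]. cbn [fst snd] in *.
      destruct k as [|k]; [lia|].
      pose proof (IH (S k) t0 Ht0 ltac:(lia)) as I1. pose proof (IH k t0 Ht0 ltac:(lia)) as I2.
      simpl pow. rewrite Rmult_plus_distr_r, Rmult_1_l. apply Rplus_le_compat.
      * eapply Rle_trans; [exact I1|]. apply rsum_le. intros t _.
        destruct (Nat.leb (snd t) (S k)); [|simpl; lra]. cbn [andb].
        destruct (Nat.eqb_spec (fst t0 mod fst t) 0) as [E|E];
          destruct (Nat.eqb_spec ((p * fst t0) mod fst t) 0) as [E'|E']; try apply Hpow; try lra.
        exfalso. apply E'. apply Nat.Div0.mod_divides in E. destruct E as [c Hc].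
        apply Nat.Div0.mod_divides. exists (p * c)%nat. rewrite Hc. ring.
      * apply (Rmult_le_compat_l rho) in I2; [|assumption]. eapply Rle_trans; [exact I2|].
        rewrite <- rsum_scal. apply rsum_le. intros t _. cbn [fst snd Nat.leb].
        destruct (Nat.leb (snd t) k); [|simpl; lra]. cbn [andb].
        destruct (Nat.eqb_spec (fst t0 mod fst t) 0) as [E|E];
          destruct (Nat.eqb_spec ((p * fst t0) mod (p * fst t)) 0) as [E'|E'];
          rewrite ?Rmult_0_r; try (simpl; lra); try apply (Hpow (S (snd t))).
        exfalso. apply E'. apply Nat.Div0.mod_divides in E. destruct E as [c Hc].
        apply Nat.Div0.mod_divides. exists c. rewrite Hc. ring.
Qed.

Definition class_resonator (rho : R) (k : nat) (P : list nat) : list (nat * R) :=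
  map (fun t => (fst t, rho ^ snd t * inv_sqrt (INR (fst t))))
    (filter (fun t => Nat.leb (snd t) k) (subsets P)).

Lemma inv_sqrt_sq x : 0 < x -> inv_sqrt x * inv_sqrt x = / x.
Proof. intros H. unfold inv_sqrt. rewrite <- Rinv_mult, sqrt_sqrt; [reflexivity|lra]. Qed.

Lemma class_den rho k P : (forall p, In p P -> (1 <= p)%nat) ->
  den (class_resonator rho k P) = rsum (fun j => rho ^ j * rho ^ j * esym P j) (seq 0 (S k)).
Proof.
  intros HP. unfold den, class_resonator. rewrite rsum_map, rsum_filter.
  rewrite <- (subsets_den P k (fun j => rho ^ j * rho ^ j)). apply rsum_ext. intros t Ht.
  destruct (Nat.leb (snd t) k); [|reflexivity]. simpl.
  rewrite <- inv_sqrt_sq by (apply lt_0_INR; pose proof (subsets_ge1 P HP t Ht); lia). ring.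
Qed.

(** Only the pairs whose larger member is a product of exactly k primes are kept. *)
Lemma class_num rho k P : 0 <= rho -> (forall p, In p P -> (1 <= p)%nat) ->
  rho ^ k * (1 + rho) ^ k * esym P k <= num (class_resonator rho k P).
Proof.
  intros Hr HP. assert (Hpow : forall i, 0 <= rho ^ i) by (intros; now apply pow_le).
  unfold num, class_resonator. rewrite rsum_map, rsum_filter.
  transitivity (rsum (fun t => rsum (fun t' => if Nat.leb (snd t) k then
      if Nat.leb (snd t') k then if Nat.eqb (fst t' mod fst t) 0
      then rho ^ snd t * rho ^ snd t' * / INR (fst t') else 0 else 0 else 0) (subsets P)) (subsets P)).
  - rewrite rsum_swap. unfold esym. rewrite <- rsum_scal. apply rsum_le. intros t' Ht'.
    assert (Hi : 0 < / INR (fst t')).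
    { apply Rinv_0_lt_compat, lt_0_INR. pose proof (subsets_ge1 P HP t' Ht'). lia. }
    assert (Hnn : 0 <= rsum (fun t => if Nat.leb (snd t) k then
      if Nat.leb (snd t') k then if Nat.eqb (fst t' mod fst t) 0
      then rho ^ snd t * rho ^ snd t' * / INR (fst t') else 0 else 0 else 0) (subsets P)).
    { apply rsum_nonneg. intros t _. destruct (Nat.leb (snd t) k), (Nat.leb (snd t') k),
        (Nat.eqb (fst t' mod fst t) 0); try lra.
      apply Rmult_le_pos; [now apply Rmult_le_pos|lra]. }
    destruct (Nat.eqb_spec (snd t') k) as [E|E]; [|lra].
    pose proof (subset_divisor_sum rho P Hr k t' Ht' ltac:(lia)) as D. rewrite E in D.
    apply Rle_trans with (rho ^ k * / INR (fst t') * (1 + rho) ^ k); [right; ring|].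
    eapply Rle_trans; [apply Rmult_le_compat_l; [|exact D]|].
    { apply Rmult_le_pos; [apply Hpow|lra]. }
    rewrite <- rsum_scal. apply rsum_le. intros t _. rewrite E, Nat.leb_refl.
    destruct (Nat.leb (snd t) k), (Nat.eqb (fst t' mod fst t) 0); cbn [andb]; lra.
  - right. apply rsum_ext. intros t Ht. destruct (Nat.leb (snd t) k).
    + rewrite rsum_map, rsum_filter. apply rsum_ext. intros t' Ht'.
      destruct (Nat.leb (snd t') k); [|reflexivity]. cbn [fst snd].
      destruct (Nat.eqb (fst t' mod fst t) 0); [|reflexivity].
      assert (P1 : 0 < INR (fst t)) by (apply lt_0_INR; pose proof (subsets_ge1 P HP t Ht); lia).
      assert (P2 : 0 < INR (fst t')) by (apply lt_0_INR; pose proof (subsets_ge1 P HP t' Ht'); lia).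
      rewrite <- (inv_sqrt_sq (INR (fst t')) P2). unfold inv_sqrt. field.
      split; apply Rgt_not_eq, sqrt_lt_R0; assumption.
    + apply rsum_0. reflexivity.
Qed.

(** The choice [rho^2 = k / s0] makes the weights [rho^(2 j) e_j] nondecreasing
    for [j <= k], so that the last of them carries a proportion 1/(k+1). *)
Lemma class_gain P k s0 mu : (1 <= k)%nat -> 0 < s0 -> 0 <= mu ->
  (forall p, In p P -> (1 <= p)%nat /\ / INR p <= mu) -> s0 <= inv_sum P - INR k * mu ->
  (1 + sqrt (s0 / INR k)) ^ k / (INR k + 1) * den (class_resonator (sqrt (INR k / s0)) k P)
  <= num (class_resonator (sqrt (INR k / s0)) k P).
Proof.
  intros Hk Hs0 Hmu HP Hs.
  assert (HP1 : forall p, In p P -> (1 <= p)%nat) by (intros; now apply HP).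
  assert (K0 : 0 < INR k) by (apply lt_0_INR; lia).
  assert (Q : 0 < INR k / s0) by now apply Rdiv_lt_0_compat.
  set (rho := sqrt (INR k / s0)) in *.
  assert (Hr : 0 < rho) by now apply sqrt_lt_R0.
  assert (Hr2 : rho * rho = INR k / s0) by (apply sqrt_sqrt; lra).
  assert (Ei : sqrt (s0 / INR k) = / rho).
  { unfold rho. rewrite <- sqrt_inv. f_equal. field. lra. }
  rewrite Ei.
  assert (HN : forall i, 0 <= esym P i) by (intros i; now apply esym_nonneg).
  assert (mono : forall j, (j < k)%nat -> rho ^ j * rho ^ j * esym P j
      <= rho ^ S j * rho ^ S j * esym P (S j)).
  { intros j Hj. pose proof (esym_ratio P mu HP j) as E.
    assert (Hjk : INR (S j) <= INR k) by (apply le_INR; lia).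
    assert (Hjk' : INR j <= INR k) by (apply le_INR; lia).
    assert (A1 : s0 * esym P j <= INR k * esym P (S j)).
    { apply Rle_trans with ((inv_sum P - INR j * mu) * esym P j).
      - apply Rmult_le_compat_r; [apply HN|].
        assert (INR j * mu <= INR k * mu) by now apply Rmult_le_compat_r. lra.
      - eapply Rle_trans; [exact E|]. apply Rmult_le_compat_r; [apply HN|assumption]. }
    assert (A2 : esym P j <= rho * rho * esym P (S j)).
    { rewrite Hr2. apply Rmult_le_reg_l with s0; [assumption|].
      replace (s0 * (INR k / s0 * esym P (S j))) with (INR k * esym P (S j)) by (field; lra).
      assumption. }
    simpl. replace (rho * rho ^ j * (rho * rho ^ j) * esym P (S j))
      with (rho ^ j * rho ^ j * (rho * rho * esym P (S j))) by ring.
    apply Rmult_le_compat_l; [|assumption].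
    apply Rmult_le_pos; apply pow_le; lra. }
  assert (top : forall d, (d <= k)%nat -> rho ^ (k - d) * rho ^ (k - d) * esym P (k - d)
      <= rho ^ k * rho ^ k * esym P k).
  { induction d as [|d IH]; intros Hd; [rewrite Nat.sub_0_r; lra|].
    eapply Rle_trans; [apply mono; lia|]. replace (S (k - S d)) with (k - d)%nat by lia.
    apply IH. lia. }
  rewrite class_den by assumption.
  assert (D : rsum (fun j => rho ^ j * rho ^ j * esym P j) (seq 0 (S k))
     <= (INR k + 1) * (rho ^ k * rho ^ k * esym P k)).
  { rewrite <- S_INR. set (T := rho ^ k * rho ^ k * esym P k) in *.
    assert (H : forall m, (m <= S k)%nat ->
      rsum (fun j => rho ^ j * rho ^ j * esym P j) (seq 0 m) <= INR m * T).
    { induction m as [|m IH]; intros Hm; [simpl; lra|].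
      rewrite seq_S, rsum_app, S_INR. specialize (IH ltac:(lia)).
      unfold rsum at 2; cbn [fold_right Nat.add].
      specialize (top (k - m)%nat ltac:(lia)). replace (k - (k - m))%nat with m in top by lia. lra. }
    now apply H. }
  eapply Rle_trans; [|apply class_num; [lra|assumption]].
  assert (G : 0 < (1 + / rho) ^ k / (INR k + 1)).
  { apply Rdiv_lt_0_compat; [|lra]. apply pow_lt. pose proof (Rinv_0_lt_compat _ Hr). lra. }
  eapply Rle_trans; [apply Rmult_le_compat_l; [lra|exact D]|].
  assert (E : (1 + rho) ^ k = rho ^ k * (1 + / rho) ^ k).
  { rewrite <- Rpow_mult_distr. f_equal. field. lra. }
  rewrite E. right. field. lra.
Qed.

(** The ranges of primes are half open because blocks over adjacent ranges are
    multiplied: the sizes Y add up and the gains g multiply. *)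
Definition block (u v : nat) (Y g : R) (I : list (nat * R)) : Prop :=
  NoDup (map fst I) /\
  (forall p, In p I -> (1 <= fst p)%nat /\ 0 <= snd p /\ ln (INR (fst p)) <= Y /\
     forall l, isprime l = true -> Nat.divide l (fst p) -> (u < l <= v)%nat) /\
  0 < den I /\ g * den I <= num I.

Lemma subsets_prime_factor P : (forall p, In p P -> isprime p = true) ->
  forall t l, In t (subsets P) -> isprime l = true -> Nat.divide l (fst t) -> In l P.
Proof.
  induction P as [|p P IH]; intros HP t l Ht Hl D.
  - destruct Ht as [<-|[]]. simpl in D. apply Nat.divide_1_r in D. subst l.
    pose proof (PrimeFacts.isprime_ge2 _ Hl). lia.
  - assert (IH' := IH (fun p' Hp' => HP p' (or_intror Hp'))).
    simpl in Ht. apply in_app_iff in Ht. destruct Ht as [Ht|Ht].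
    + right. eapply IH'; eassumption.
    + apply in_map_iff in Ht. destruct Ht as [t' [<- Ht']]. simpl in D.
      apply (PrimeFacts.isprime_euclid l p (fst t') Hl) in D. destruct D as [D|D].
      * left. symmetry. apply PrimeFacts.isprime_dvd_isprime; [assumption|apply HP; now left|assumption].
      * right. eapply IH'; eassumption.
Qed.

Lemma subsets_NoDup P : NoDup P -> (forall p, In p P -> isprime p = true) ->
  NoDup (map fst (subsets P)).
Proof.
  induction P as [|p P IH]; intros Hn HP.
  - constructor; [intros []|constructor].
  - inversion Hn; subst. assert (HP' : forall p', In p' P -> isprime p' = true) by (intros; apply HP; now right).
    specialize (IH H2 HP'). simpl. rewrite map_app, map_map. simpl.
    pose proof (PrimeFacts.isprime_ge2 p (HP p (or_introl eq_refl))) as P2.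
    apply NoDup_app; [assumption| |].
    + rewrite <- (map_map fst (Nat.mul p)). apply FinFun.Injective_map_NoDup; [|assumption].
      intros a b E. apply Nat.mul_cancel_l in E; lia.
    + intros n H1' H2'. apply in_map_iff in H1', H2'.
      destruct H1' as [t [<- Ht]], H2' as [t' [E Ht']]. apply H1.
      apply (subsets_prime_factor P HP' t p Ht); [apply HP; now left|].
      exists (fst t'). rewrite <- E. ring.
Qed.

Lemma NoDup_map_filter {A B} (f : A -> B) (b : A -> bool) l :
  NoDup (map f l) -> NoDup (map f (filter b l)).
Proof.
  induction l as [|a l IH]; intros H; [constructor|]. simpl in H. inversion H; subst. simpl.
  destruct (b a); [|auto]. simpl. constructor; [|auto].
  intros Hin. apply H2. apply in_map_iff in Hin. destruct Hin as [x [E Hx]].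
  apply filter_In in Hx. rewrite <- E. apply in_map. tauto.
Qed.

Lemma subsets_ln P Lv : 0 <= Lv -> (forall p, In p P -> (1 <= p)%nat /\ ln (INR p) <= Lv) ->
  forall t, In t (subsets P) -> ln (INR (fst t)) <= INR (snd t) * Lv.
Proof.
  intros HL. induction P as [|p P IH]; intros HP t Ht.
  - destruct Ht as [<-|[]]. simpl. rewrite ln_1. lra.
  - assert (HP' : forall p', In p' P -> (1 <= p')%nat /\ ln (INR p') <= Lv) by (intros; apply HP; now right).
    simpl in Ht. apply in_app_iff in Ht. destruct Ht as [Ht|Ht]; [now apply IH|].
    apply in_map_iff in Ht. destruct Ht as [t' [<- Ht']]. cbn [fst snd].
    destruct (HP p (or_introl eq_refl)) as [P1 P2].
    pose proof (subsets_ge1 P (fun p' H => proj1 (HP' p' H)) t' Ht') as T1.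
    rewrite mult_INR, ln_mult by (apply lt_0_INR; lia). rewrite S_INR.
    specialize (IH HP' t' Ht'). lra.
Qed.

Lemma esym_0 P : (forall p, In p P -> (1 <= p)%nat) -> esym P 0 = 1.
Proof.
  induction P as [|p P IH]; intros HP.
  - unfold esym, rsum; simpl. field.
  - rewrite esym_cons_0. apply IH. intros; apply HP; now right.
Qed.

Lemma class_block u v k s0 mu : (1 <= k)%nat -> (1 <= v)%nat -> 0 < s0 -> 0 <= mu ->
  (forall p, (u < p)%nat -> / INR p <= mu) ->
  s0 <= inv_sum (filter isprime (seq (S u) (v - u))) - INR k * mu ->
  exists I, block u v (INR k * ln (INR v)) ((1 + sqrt (s0 / INR k)) ^ k / (INR k + 1)) I.
Proof.
  intros Hk Hv Hs0 Hmu Hinv Hs. set (P := filter isprime (seq (S u) (v - u))) in *.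
  assert (HP : forall p, In p P -> isprime p = true /\ (u < p <= v)%nat).
  { intros p Hp. apply filter_In in Hp. destruct Hp as [Hp E]. apply in_seq in Hp. split; [assumption|lia]. }
  assert (HP1 : forall p, In p P -> (1 <= p)%nat) by (intros p Hp; destruct (HP p Hp); lia).
  assert (HPp : forall p, In p P -> isprime p = true) by (intros p Hp; now apply HP).
  assert (Hr : 0 < sqrt (INR k / s0)).
  { apply sqrt_lt_R0, Rdiv_lt_0_compat; [apply lt_0_INR; lia|assumption]. }
  exists (class_resonator (sqrt (INR k / s0)) k P). split; [|split; [|split]].
  - unfold class_resonator. rewrite map_map. simpl.
    apply NoDup_map_filter, subsets_NoDup; [|assumption]. apply NoDup_filter, seq_NoDup.
  - intros p Hp. unfold class_resonator in Hp. apply in_map_iff in Hp.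
    destruct Hp as [t [<- Ht]]. apply filter_In in Ht. destruct Ht as [Ht Hle].
    apply Nat.leb_le in Hle. cbn [fst snd]. pose proof (subsets_ge1 P HP1 t Ht) as T1.
    split; [assumption|]. split; [|split].
    + apply Rmult_le_pos; [apply pow_le; lra|left; apply inv_sqrt_pos, lt_0_INR; lia].
    + pose proof (ln_INR_nonneg v Hv) as Lv.
      eapply Rle_trans; [apply (subsets_ln P (ln (INR v)) Lv); [|exact Ht]|].
      * intros p Hp. split; [now apply HP1|]. destruct (HP p Hp) as [_ [_ H]].
        apply ln_le; [apply lt_0_INR; specialize (HP1 p Hp); lia|now apply le_INR].
      * apply Rmult_le_compat_r; [assumption|now apply le_INR].
    + intros l Hl D. apply HP. eapply subsets_prime_factor; eassumption.
  - rewrite class_den by assumption.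
    apply Rlt_le_trans with (sqrt (INR k / s0) ^ 0 * sqrt (INR k / s0) ^ 0 * esym P 0).
    + rewrite esym_0 by assumption. simpl. lra.
    + apply (rsum_member (fun j => sqrt (INR k / s0) ^ j * sqrt (INR k / s0) ^ j * esym P j)).
      * intros j _. apply Rmult_le_pos; [apply Rmult_le_pos; apply pow_le; lra|now apply esym_nonneg].
      * apply in_seq. lia.
  - apply (class_gain P k s0 mu); try assumption. intros p Hp. split; [now apply HP1|].
    apply Hinv. destruct (HP p Hp). lia.
Qed.

Lemma trivial_block u : block u u 0 1 [(1%nat, 1)].
Proof.
  split; [|split; [|split]].
  - constructor; [intros []|constructor].
  - intros p [<-|[]]. simpl. rewrite ln_1. repeat split; try lra; try lia;
      apply Nat.divide_1_r in H0; subst l; pose proof (PrimeFacts.isprime_ge2 _ H); lia.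
  - unfold den, rsum; simpl. lra.
  - unfold den, num, rsum, inv_sqrt; simpl. rewrite sqrt_1. lra.
Qed.

Definition prod_resonator (I J : list (nat * R)) : list (nat * R) :=
  flat_map (fun a => map (fun b => ((fst a * fst b)%nat, snd a * snd b)) J) I.

Lemma rsum_prod I J (f : nat * R -> R) : rsum f (prod_resonator I J)
  = rsum (fun a => rsum (fun b => f ((fst a * fst b)%nat, snd a * snd b)) J) I.
Proof.
  induction I as [|a I IH]; [reflexivity|]. simpl. rewrite rsum_app, IH, rsum_map. reflexivity.
Qed.

Lemma coprime_of_support m n (S : nat -> Prop) :
  (forall l, isprime l = true -> Nat.divide l m -> S l) ->
  (forall l, isprime l = true -> Nat.divide l n -> ~ S l) -> Nat.gcd m n = 1%nat.
Proof.
  intros Hm Hn. apply NNPP. intros H.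
  destruct (PrimeFacts.isprime_factor _ H) as [p [Hp D]].
  apply (Hn p Hp).
  - eapply Nat.divide_trans; [exact D|apply Nat.gcd_divide_r].
  - apply Hm; [assumption|]. eapply Nat.divide_trans; [exact D|apply Nat.gcd_divide_l].
Qed.

(** Coprimality of the supports makes [(m, n) -> m n] injective, so den multiplies;
    divisibility in both factors implies divisibility of the products, so num is at
    least the product. *)
Lemma block_product u v w Y1 Y2 g1 g2 I J : (u <= v <= w)%nat -> 0 <= g1 -> 0 <= g2 ->
  block u v Y1 g1 I -> block v w Y2 g2 J -> block u w (Y1 + Y2) (g1 * g2) (prod_resonator I J).
Proof.
  intros Huv Hg1 Hg2 [N1 [M1 [D1 G1]]] [N2 [M2 [D2 G2]]].
  assert (cop : forall a b, In a I -> In b J -> Nat.gcd (fst a) (fst b) = 1%nat).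
  { intros a b Ha Hb. apply (coprime_of_support _ _ (fun l => (l <= v)%nat)).
    - intros l Hl D. destruct (M1 a Ha) as [_ [_ [_ H]]]. specialize (H l Hl D). lia.
    - intros l Hl D. destruct (M2 b Hb) as [_ [_ [_ H]]]. specialize (H l Hl D). lia. }
  assert (inj : forall a b a' b', In a I -> In b J -> In a' I -> In b' J ->
     (fst a * fst b = fst a' * fst b')%nat -> fst a = fst a').
  { intros a b a' b' Ha Hb Ha' Hb' E. apply Nat.divide_antisym.
    - apply (Nat.gauss (fst a) (fst b') (fst a')); [|now apply cop].
      exists (fst b). rewrite Nat.mul_comm, (Nat.mul_comm (fst b)). symmetry. rewrite E. reflexivity.
    - apply (Nat.gauss (fst a') (fst b) (fst a)); [|now apply cop].
      exists (fst b'). rewrite (Nat.mul_comm (fst b)), E. ring. }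
  assert (Hden : den (prod_resonator I J) = den I * den J).
  { unfold den. rewrite rsum_prod. cbn [snd]. rewrite Rmult_comm, <- rsum_scal. apply rsum_ext.
    intros a _. rewrite Rmult_comm, <- rsum_scal. apply rsum_ext. intros b _. ring. }
  split; [|split; [|split]].
  - clear D1 D2 G1 G2 Hden. induction I as [|a I IH]; [constructor|].
    simpl. rewrite map_app, map_map. simpl. simpl in N1. inversion N1; subst.
    apply NoDup_app.
    + rewrite <- (map_map fst (Nat.mul (fst a))). apply FinFun.Injective_map_NoDup; [|assumption].
      intros x y E. destruct (M1 a (or_introl eq_refl)) as [A1 _]. apply Nat.mul_cancel_l in E; lia.
    + apply IH; auto.
      * intros p Hp. apply M1. now right.
      * intros x y Hx Hy. apply cop; [now right|assumption].
      * intros x y x' y' Hx Hy Hx' Hy'. apply inj; auto; now right.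
    + intros n H1' H2'. apply in_map_iff in H1'. destruct H1' as [b [<- Hb]].
      apply in_map_iff in H2'. destruct H2' as [t [E Ht]]. apply in_flat_map in Ht.
      destruct Ht as [a' [Ha' Ht]]. apply in_map_iff in Ht. destruct Ht as [b' [<- Hb']]. simpl in E.
      apply H1. rewrite <- (inj a' b' a b); auto; [now apply in_map|now right|now left].
  - intros p Hp. unfold prod_resonator in Hp. apply in_flat_map in Hp.
    destruct Hp as [a [Ha Hp]]. apply in_map_iff in Hp. destruct Hp as [b [<- Hb]]. cbn [fst snd].
    destruct (M1 a Ha) as [A1 [A2 [A3 A4]]], (M2 b Hb) as [B1 [B2 [B3 B4]]].
    split; [nia|]. split; [now apply Rmult_le_pos|]. split.
    + rewrite mult_INR, ln_mult by (apply lt_0_INR; lia). lra.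
    + intros l Hl D. apply PrimeFacts.isprime_euclid in D; [|assumption].
      destruct D as [D|D]; [specialize (A4 l Hl D)|specialize (B4 l Hl D)]; lia.
  - rewrite Hden. now apply Rmult_lt_0_compat.
  - rewrite Hden.
    apply Rle_trans with (num I * num J).
    + replace (g1 * g2 * (den I * den J)) with ((g1 * den I) * (g2 * den J)) by ring.
      apply Rmult_le_compat; try assumption; apply Rmult_le_pos; lra.
    + unfold num. rewrite rsum_prod. cbn [fst snd].
      rewrite Rmult_comm, <- rsum_scal. apply rsum_le. intros a Ha.
      rewrite Rmult_comm, <- rsum_scal. apply rsum_le. intros b Hb. rewrite rsum_prod. cbn [fst snd].
      rewrite Rmult_comm, <- rsum_scal. apply rsum_le. intros a' Ha'.
      rewrite Rmult_comm, <- rsum_scal. apply rsum_le. intros b' Hb'.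
      destruct (M1 a Ha) as [A1 [A2 _]], (M2 b Hb) as [B1 [B2 _]].
      destruct (M1 a' Ha') as [A1' [A2' _]], (M2 b' Hb') as [B1' [B2' _]].
      assert (P1 : 0 < INR (fst a')) by (apply lt_0_INR; lia).
      assert (P2 : 0 < INR (fst b')) by (apply lt_0_INR; lia).
      assert (Es : sqrt (INR (fst a * fst b)) * inv_sqrt (INR (fst a' * fst b'))
        = (sqrt (INR (fst a)) * inv_sqrt (INR (fst a'))) * (sqrt (INR (fst b)) * inv_sqrt (INR (fst b')))).
      { unfold inv_sqrt. rewrite !mult_INR, !sqrt_mult_alt by apply pos_INR. rewrite Rinv_mult. ring. }
      assert (Hnn : 0 <= snd a * snd b * (snd a' * snd b')
         * (sqrt (INR (fst a * fst b)) * inv_sqrt (INR (fst a' * fst b')))).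
      { repeat apply Rmult_le_pos; try assumption; try apply sqrt_pos.
        left. apply inv_sqrt_pos, lt_0_INR. nia. }
      destruct (Nat.eqb_spec (fst a' mod fst a) 0) as [Ea|Ea];
        destruct (Nat.eqb_spec (fst b' mod fst b) 0) as [Eb|Eb];
        destruct (Nat.eqb_spec ((fst a' * fst b') mod (fst a * fst b)) 0) as [E|E]; try lra.
      * rewrite Es. right. ring.
      * exfalso. apply E. apply Nat.Div0.mod_divides in Ea, Eb. destruct Ea as [c Hc], Eb as [d Hd].
        apply Nat.Div0.mod_divides. exists (c * d)%nat. rewrite Hc, Hd. ring.
Qed.

(** * Optimization over classes of primes *)

Definition nfloor (x : R) : nat := Z.to_nat (Int_part x).

Lemma nfloor_bounds x : 0 <= x -> INR (nfloor x) <= x < INR (nfloor x) + 1.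
Proof.
  intros Hx. destruct (base_Int_part x) as [B1 B2]. unfold nfloor.
  assert (H : (0 <= Int_part x)%Z).
  { assert (IZR (-1) < IZR (Int_part x)) by (simpl; lra). apply lt_IZR in H. lia. }
  rewrite INR_IZR_INZ, Z2Nat.id by assumption. lra.
Qed.

Lemma block_weaken u v Y Y' g g' I : Y <= Y' -> g' <= g -> block u v Y g I -> block u v Y' g' I.
Proof.
  intros HY Hg [N [M [D G]]]. split; [assumption|]. split; [|split].
  - intros p Hp. destruct (M p Hp) as [A1 [A2 [A3 A4]]]. repeat split; try assumption; try lra;
      apply (A4 l H H0).
  - assumption.
  - apply Rle_trans with (g * den I); [|assumption]. apply Rmult_le_compat_r; lra.
Qed.

Lemma exp_le_pow x k : 0 <= x -> exp (INR k * (x - x * x)) <= (1 + x) ^ k.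
Proof.
  intros Hx.
  assert (H : exp (x - x * x) <= 1 + x).
  { apply Rle_trans with (exp (x / (1 + x))).
    - apply exp_le_mono. apply Rmult_le_reg_r with (1 + x); [lra|].
      unfold Rdiv. rewrite Rmult_assoc, Rinv_l by lra. nra.
    - pose proof (exp_ineq1_le (- (x / (1 + x)))) as E. rewrite exp_Ropp in E.
      pose proof (exp_pos (x / (1 + x))) as P.
      apply (Rmult_le_compat_r (exp (x / (1 + x)) * (1 + x))) in E; [|nra].
      replace (/ exp (x / (1 + x)) * (exp (x / (1 + x)) * (1 + x))) with (1 + x) in E by (field; lra).
      replace ((1 + - (x / (1 + x))) * (exp (x / (1 + x)) * (1 + x))) with (exp (x / (1 + x))) in E
        by (field; lra). exact E. }
  replace (INR k * (x - x * x)) with ((x - x * x) * INR k) by ring.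
  induction k as [|k IH]; [simpl; rewrite Rmult_0_r, exp_0; lra|].
  rewrite S_INR, Rmult_plus_distr_l, Rmult_1_r, exp_plus. simpl. rewrite Rmult_comm.
  apply Rmult_le_compat; try assumption; left; apply exp_pos.
Qed.

Lemma nfloor_ln E : 1 <= ln E -> (1 <= nfloor E)%nat /\ ln (INR (nfloor E)) <= ln E /\ ln E - 1 <= ln (INR (nfloor E)).
Proof.
  intros HE.
  assert (E0 : 0 < E).
  { apply Rnot_le_lt. intros H. unfold ln in HE. destruct (Rlt_dec 0 E); lra. }
  assert (E2 : 2 <= E).
  { rewrite <- (exp_ln E E0). pose proof (exp_ineq1_le (ln E)). lra. }
  destruct (nfloor_bounds E) as [B1 B2]; [lra|].
  assert (N1 : (1 <= nfloor E)%nat).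
  { apply INR_le. simpl. destruct (nfloor E) as [|m]; [simpl in B2; lra|].
    rewrite S_INR. pose proof (pos_INR m). lra. }
  assert (P : 1 <= INR (nfloor E)) by (apply (le_INR 1); assumption).
  split; [assumption|]. split; [apply ln_le; lra|].
  assert (ln E <= ln (INR (nfloor E) * exp 1)).
  { apply ln_le; [assumption|]. pose proof (exp_ineq1_le 1). nra. }
  rewrite ln_mult, ln_exp in H; [lra|lra|apply exp_pos].
Qed.

Lemma pow_pow_inv th de i : th * (1 + de) = 1 -> th ^ i * (1 + de) ^ i = 1.
Proof. intros H. rewrite <- Rpow_mult_distr, H. apply pow1. Qed.

Section Classes.

Variables (de th X : R) (J : nat).
Hypothesis Hde : 0 < de <= 1.
Hypothesis Hth : th * (1 + de) = 1.
Hypothesis HX : 0 < X.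
Let l := ln X.
Hypothesis Hl1 : 1 <= l.
Hypothesis Hl9 : 9 <= (de * th) * (de * th) * l.
Hypothesis HJ : forall i, (i < J)%nat -> 1 <= de * th * th * (th ^ i * th ^ i) * (X / l).

Let S0 := sqrt (X / l).
(* The i-th class consists of the primes from [X^((1+de)^i)] to [X^((1+de)^(i+1))]. *)
Let u (i : nat) : nat := nfloor (exp (l * (1 + de) ^ i)).

Let th_bounds : 0 < th < 1.
Proof. split; nra. Qed.

Let b_ge i : l <= l * (1 + de) ^ i.
Proof.
  assert (1 <= (1 + de) ^ i) by (apply pow_R1_Rle; lra). nra.
Qed.

Let u_ln i : (1 <= u i)%nat /\ ln (INR (u i)) <= l * (1 + de) ^ i /\ l * (1 + de) ^ i - 1 <= ln (INR (u i)).
Proof.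
  pose proof (nfloor_ln (exp (l * (1 + de) ^ i))) as H. rewrite ln_exp in H. apply H.
  pose proof (b_ge i). lra.
Qed.

Let u_mono j : (u j <= u (S j))%nat.
Proof.
  assert (Hm : exp (l * (1 + de) ^ j) <= exp (l * (1 + de) ^ S j)).
  { apply exp_le_mono. simpl. pose proof (b_ge j). nra. }
  destruct (nfloor_bounds (exp (l * (1 + de) ^ j)) ltac:(left; apply exp_pos)) as [C1 _].
  destruct (nfloor_bounds (exp (l * (1 + de) ^ S j)) ltac:(left; apply exp_pos)) as [_ C2].
  fold (u j) in C1. fold (u (S j)) in C2.
  assert (INR (u j) < INR (u (S j) + 1)) by (rewrite plus_INR; simpl; lra).
  apply INR_lt in H. lia.
Qed.

(** Mertens' theorem gives [(1 - th) b] for the sum of [ln p / p], where b is the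
    logarithm of the upper end, up to 7 and 1 more for the integer parts. *)
Lemma inv_sum_class i :
  (1 - th) - 8 / l <= inv_sum (filter isprime (seq (S (u i)) (u (S i) - u i))).
Proof.
  destruct (u_ln i) as [A1 [A2 A3]], (u_ln (S i)) as [B1 [B2 B3]].
  set (b := l * (1 + de) ^ S i) in *.
  assert (Eb : l * (1 + de) ^ i = th * b) 
    by (transitivity (l * (1 + de) ^ i * (th * (1 + de))); [rewrite Hth|unfold b; simpl]; ring).
  rewrite Eb in *. pose proof (b_ge (S i)) as Hb. fold b in Hb.
  pose proof (u_mono i) as Huv.
  pose proof (mertens_interval (u i) (u (S i)) ltac:(lia)) as M.
  set (P := filter isprime (seq (S (u i)) (u (S i) - u i))).
  assert (Hle : prime_sum (fun p => ln (INR p) / INR p) (seq (S (u i)) (u (S i) - u i)) <= b * inv_sum P).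
  { unfold inv_sum, P. rewrite rsum_filter, <- rsum_scal. apply rsum_le. intros p Hp.
    destruct (isprime p); [|lra]. apply in_seq in Hp.
    unfold Rdiv. apply Rmult_le_compat_r.
    - left. apply Rinv_0_lt_compat, lt_0_INR. lia.
    - eapply Rle_trans; [|exact B2]. apply ln_le; [apply lt_0_INR; lia|apply le_INR; lia]. }
  assert (Hb0 : 0 < b) by lra.
  assert (K : b * ((1 - th) - 8 / b) <= b * inv_sum P).
  { replace (b * (1 - th - 8 / b)) with (b - th * b - 8) by (field; lra). lra. }
  apply Rmult_le_reg_l in K; [|assumption].
  assert (8 / b <= 8 / l); [|lra].
  unfold Rdiv. apply Rmult_le_compat_l; [lra|]. apply Rinv_le_contravar; lra.
Qed.

(** Products of at most [k = de th^(2 i + 2) X / ln X] primes.  This choice makes both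
    the size and the gain exponent proportional to [th^i]. *)
Lemma one_class i : (i < J)%nat -> exists I,
  block (u i) (u (S i)) ((1 - th) * th ^ i * X)
    (exp (th * (1 - th) * th ^ i * S0 - (l + 3))) I.
Proof.
  intros Hi. pose proof th_bounds as Ht. specialize (HJ i Hi).
  set (ka := de * th * th * (th ^ i * th ^ i)) in *.
  set (k := nfloor (ka * (X / l))).
  destruct (nfloor_bounds (ka * (X / l)) ltac:(lra)) as [K1 K2]. fold k in K1, K2.
  assert (Hti : 0 < th ^ i <= 1).
  { split; [apply pow_lt; lra|]. rewrite <- (pow1 i). apply pow_incr. lra. }
  assert (Edt : de * th = 1 - th) by lra.
  assert (Hs0 : 0 < de * th * th <= 1) by (rewrite Edt; nra).
  assert (Hka : 0 < ka <= de * th * th).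
  { unfold ka. assert (0 < th ^ i * th ^ i <= 1) by nra. split; nra. }
  assert (Hk1 : (1 <= k)%nat).
  { destruct k as [|m]; [simpl in K2; lra|lia]. }
  assert (Hk1R : 1 <= INR k) by (apply (le_INR 1); assumption).
  assert (XlX : X / l <= X).
  { apply Rmult_le_reg_r with l; [lra|]. unfold Rdiv. rewrite Rmult_assoc, Rinv_l by lra. nra. }
  assert (Xl0 : 0 < X / l) by (apply Rdiv_lt_0_compat; lra).
  assert (HkX : INR k <= X / l) by nra.
  destruct (class_block (u i) (u (S i)) k (de * th * th) (/ X)) as [I HI].
  - assumption.
  - apply u_ln.
  - lra.
  - left; now apply Rinv_0_lt_compat.
  - intros p Hp. apply Rinv_le_contravar; [assumption|].
    destruct (nfloor_bounds (exp (l * (1 + de) ^ i)) ltac:(left; apply exp_pos)) as [_ C2].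
    fold (u i) in C2. apply le_INR in Hp. rewrite S_INR in Hp.
    assert (X <= exp (l * (1 + de) ^ i)).
    { rewrite <- (exp_ln X HX) at 1. apply exp_le_mono. apply b_ge. }
    lra.
  - pose proof (inv_sum_class i) as HS.
    assert (A : INR k * / X <= / l).
    { apply Rmult_le_reg_r with X; [assumption|]. rewrite Rmult_assoc, Rinv_l by lra.
      unfold Rdiv in HkX. lra. }
    assert (B : 9 / l <= (de * th) * (de * th)).
    { apply Rmult_le_reg_r with l; [lra|]. unfold Rdiv. rewrite Rmult_assoc, Rinv_l by lra. lra. }
    assert (C : de * th * th = (1 - th) - (de * th) * (de * th)) by (rewrite Edt; ring).
    unfold Rdiv in *. lra.
  - exists I. apply (block_weaken _ _ (INR k * ln (INR (u (S i))))
      _ ((1 + sqrt (de * th * th / INR k)) ^ k / (INR k + 1))); [| |exact HI].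
    + destruct (u_ln (S i)) as [B1 [B2 _]].
      pose proof (ln_INR_nonneg _ B1) as L0.
      apply Rle_trans with (ka * (X / l) * (l * (1 + de) ^ S i)).
      * apply Rmult_le_compat; try assumption. apply pos_INR.
      * right. pose proof (pow_pow_inv th de i Hth) as E. unfold ka. simpl.
        replace (de * th * th * (th ^ i * th ^ i) * (X / l) * (l * ((1 + de) * (1 + de) ^ i)))
          with ((de * th) * (th * (1 + de)) * (th ^ i * (1 + de) ^ i) * th ^ i * X) by (field; lra).
        rewrite Hth, E, Edt. ring.
    + set (x := sqrt (de * th * th / INR k)).
      assert (Q : 0 < de * th * th / INR k) by (apply Rdiv_lt_0_compat; lra).
      assert (Hx : 0 < x) by now apply sqrt_lt_R0.
      assert (Hx2 : x * x = de * th * th / INR k) by (apply sqrt_sqrt; lra).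
      set (T := th * (1 - th) * th ^ i * S0).
      assert (HS0 : 0 < S0) by now apply sqrt_lt_R0.
      assert (HS2 : S0 * S0 = X / l) by (apply sqrt_sqrt; lra).
      assert (HT0 : 0 < T) by (unfold T; repeat apply Rmult_lt_0_compat; lra).
      assert (HT2 : T * T = de * th * th * (ka * (X / l))).
      { unfold T, ka. rewrite <- HS2, <- Edt. ring. }
      assert (Hkx : T - 1 <= INR k * x).
      { destruct (Rle_dec T 1) as [L|L]; [assert (0 <= INR k * x) by (apply Rmult_le_pos; lra); lra|].
        apply Rsqr_incr_0_var; [|apply Rmult_le_pos; lra]. unfold Rsqr.
        replace (INR k * x * (INR k * x)) with (INR k * (INR k * (x * x))) by ring.
        rewrite Hx2. replace (INR k * (INR k * (de * th * th / INR k))) with (de * th * th * INR k)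
          by (field; lra).
        assert (de * th * th * (ka * (X / l)) <= de * th * th * (INR k + 1))
          by (apply Rmult_le_compat_l; lra). lra. }
      pose proof (exp_le_pow x k ltac:(lra)) as Hpow. fold x.
      assert (Hk2 : INR k + 1 <= exp (l + 1)).
      { rewrite exp_plus. unfold l. rewrite exp_ln by assumption.
        pose proof (exp_ineq1_le 1). assert (1 <= X) by lra. nra. }
      apply Rmult_le_reg_r with (INR k + 1); [lra|].
      unfold Rdiv. rewrite Rmult_assoc, Rinv_l, Rmult_1_r by lra.
      eapply Rle_trans; [|exact Hpow].
      apply Rle_trans with (exp (T - (l + 3)) * exp (l + 1)).
      { apply Rmult_le_compat_l; [left; apply exp_pos|assumption]. }
      rewrite <- exp_plus. apply exp_le_mono. rewrite Rmult_minus_distr_l, Hx2.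
      replace (INR k * (de * th * th / INR k)) with (de * th * th) by (field; lra). lra.
Qed.

(** Geometric sums of the sizes and of the gain exponents of the classes. *)
Lemma all_classes i : (i <= J)%nat -> exists I,
  block (u 0) (u i) ((1 - th ^ i) * X) (exp (th * (1 - th ^ i) * S0 - INR i * (l + 3))) I.
Proof.
  induction i as [|i IH]; intros Hi.
  - exists [(1%nat, 1)]. apply (block_weaken _ _ 0 _ 1); [simpl; lra| |apply trivial_block].
    simpl. replace (th * (1 - 1) * S0 - 0 * (l + 3)) with 0 by ring. rewrite exp_0. lra.
  - destruct (IH ltac:(lia)) as [I HI]. destruct (one_class i ltac:(lia)) as [I' HI'].
    exists (prod_resonator I I').
    assert (mono' : forall j, (u 0 <= u j)%nat).
    { induction j as [|j IHj]; [lia|]. pose proof (u_mono j). lia. }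
    pose proof (block_product _ _ _ _ _ _ _ I I' (conj (mono' i) (u_mono i))
      (Rlt_le _ _ (exp_pos _)) (Rlt_le _ _ (exp_pos _)) HI HI') as HB.
    refine (block_weaken _ _ _ _ _ _ _ _ _ HB).
    + simpl. right. ring.
    + rewrite <- exp_plus. apply exp_le_mono. rewrite S_INR. simpl. right. ring.
Qed.

End Classes.

Lemma exp_fifth l : 0 <= l -> (l / 5) ^ 5 <= exp l.
Proof.
  intros H.
  replace (exp l) with (exp (l / 5) ^ 5).
  - apply pow_incr. pose proof (exp_ineq1_le (l / 5)). lra.
  - simpl. rewrite Rmult_1_r, <- !exp_plus. f_equal. field.
Qed.

Lemma sqrt_ratio_lower x : 1 <= ln x ->
  ln x * ln x * (ln x * ln x) / 3125 <= x / ln x /\ ln x * ln x / 56 <= sqrt (x / ln x).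
Proof.
  intros Hl.
  assert (Hx : 0 < x).
  { apply Rnot_le_lt. intros H. unfold ln in Hl. destruct (Rlt_dec 0 x); lra. }
  pose proof (exp_fifth (ln x) ltac:(lra)) as E. rewrite exp_ln in E by assumption.
  set (l := ln x) in *.
  assert (A : l * l * (l * l) / 3125 <= x / l).
  { apply Rmult_le_reg_r with l; [lra|]. replace (x / l * l) with x by (field; lra).
    eapply Rle_trans; [|exact E]. right. simpl. field. }
  split; [exact A|].
  apply Rsqr_incr_0_var; [|apply sqrt_pos]. unfold Rsqr.
  assert (0 <= l * l * (l * l)) by (apply Rmult_le_pos; nra).
  rewrite sqrt_sqrt by lra. lra.
Qed.

(** The number of classes J and their ratio are fixed first; then X is taken
    large enough for the error terms of all J classes to be negligible. *)
Lemma resonator_exists eps : 0 < eps < 1 -> exists l0, 1 <= l0 /\ forall X, 0 < X -> l0 <= ln X ->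
  exists I : list (nat * R), NoDup (map fst I) /\
    (forall p, In p I -> (1 <= fst p)%nat /\ 0 <= snd p /\ ln (INR (fst p)) <= X) /\
    0 < den I /\ exp ((1 - eps) * sqrt (X / ln X)) * den I <= num I.
Proof.
  intros He. set (de := eps / 4). set (th := / (1 + de)).
  assert (Hde : 0 < de <= 1) by (unfold de; lra).
  assert (Hth : th * (1 + de) = 1) by (unfold th; field; lra).
  assert (Ht : 0 < th < 1) by (split; nra).
  assert (Ht4 : 1 - eps / 4 <= th) by (fold de; nra).
  destruct (pow_lt_1_zero th) with (y := eps / 4) as [J HJ0]; [rewrite Rabs_right; lra|lra|].
  assert (HJ : th ^ J <= eps / 4).
  { specialize (HJ0 J (le_n _)). rewrite Rabs_right in HJ0 by (apply Rle_ge, pow_le; lra). lra. }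
  set (ka := de * th * th * (th ^ J * th ^ J)).
  assert (HtJ : 0 < th ^ J) by (apply pow_lt; lra).
  assert (Hka : 0 < ka) by (unfold ka; repeat apply Rmult_lt_0_compat; lra).
  assert (Hdt : 0 < (de * th) * (de * th)) by (repeat apply Rmult_lt_0_compat; lra).
  set (l0 := 1 + 9 / ((de * th) * (de * th)) + 3125 / ka + 448 * INR J / eps).
  assert (Q1 : 0 <= 9 / ((de * th) * (de * th))) by (apply Rdiv_le_0_compat; lra).
  assert (Q2 : 0 <= 3125 / ka) by (apply Rdiv_le_0_compat; lra).
  assert (Q3 : 0 <= 448 * INR J / eps).
  { apply Rdiv_le_0_compat; [|lra]. pose proof (pos_INR J). lra. }
  exists l0. split; [unfold l0; lra|]. intros X HX Hl. set (l := ln X) in *.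
  assert (Hl1 : 1 <= l) by (unfold l0 in Hl; lra).
  destruct (sqrt_ratio_lower X Hl1) as [R1 R2]. fold l in R1, R2.
  assert (Hl9 : 9 <= (de * th) * (de * th) * l).
  { apply Rle_trans with ((de * th) * (de * th) * (9 / ((de * th) * (de * th)))).
    - right. field. split; lra.
    - apply Rmult_le_compat_l; [lra|]. unfold l0 in Hl. lra. }
  assert (HJ1 : forall i, (i < J)%nat -> 1 <= de * th * th * (th ^ i * th ^ i) * (X / l)).
  { intros i Hi.
    assert (Hij : th ^ J <= th ^ i).
    { replace J with (i + (J - i))%nat by lia. rewrite pow_add.
      assert (0 < th ^ i) by (apply pow_lt; lra).
      assert (th ^ (J - i) <= 1) by (rewrite <- (pow1 (J - i)); apply pow_incr; lra). nra. }
    assert (Hsq : th ^ J * th ^ J <= th ^ i * th ^ i) by (apply Rmult_le_compat; lra).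
    assert (Hd2 : 0 < de * th * th) by (repeat apply Rmult_lt_0_compat; lra).
    assert (A : ka <= de * th * th * (th ^ i * th ^ i)) by (apply Rmult_le_compat_l; lra).
    assert (l / 3125 <= l * l * (l * l) / 3125).
    { assert (1 <= l * l) by nra. assert (l <= l * l * (l * l)) by nra. lra. }
    assert (B : 1 <= ka * (X / l)).
    { apply Rle_trans with (ka * (3125 / ka / 3125)); [right; field; lra|].
      apply Rmult_le_compat_l; [lra|]. unfold l0 in Hl. lra. }
    eapply Rle_trans; [exact B|]. apply Rmult_le_compat_r; [|assumption].
    left. apply Rdiv_lt_0_compat; lra. }
  destruct (all_classes de th X J Hde Hth HX Hl1 Hl9 HJ1 J (le_n _)) as [I [N [M [D G]]]].
  fold l in G. exists I. split; [assumption|]. split; [|split; [assumption|]].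
  - intros p Hp. destruct (M p Hp) as [A1 [A2 [A3 _]]]. repeat split; try assumption.
    eapply Rle_trans; [exact A3|]. nra.
  - eapply Rle_trans; [|exact G]. apply Rmult_le_compat_r; [lra|]. apply exp_le_mono.
    set (S0 := sqrt (X / l)) in *.
    assert (HS : 0 <= S0) by apply sqrt_pos.
    assert (A : (1 - eps / 2) * S0 <= th * (1 - th ^ J) * S0).
    { apply Rmult_le_compat_r; [assumption|]. nra. }
    assert (B : INR J * (l + 3) <= eps / 2 * S0).
    { apply Rle_trans with (eps / 2 * (l * l / 56)); [|apply Rmult_le_compat_l; lra].
      apply Rle_trans with (INR J * (4 * l)).
      { apply Rmult_le_compat_l; [apply pos_INR|lra]. }
      assert (448 * INR J <= eps * l).
      { apply Rle_trans with (eps * (448 * INR J / eps)); [right; field; lra|].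
        apply Rmult_le_compat_l; [lra|]. unfold l0 in Hl. lra. }
      nra. }
    lra.
Qed.

(** * Conclusion *)

Definition large_values (c : R) (q : nat) : Prop :=
  (exists chi : DirichletCharacter q, even_char chi /\
     exp (c * scrL q) <= Cmod (L chi (RtoC (1 / 2)))) /\
  (exists chi : DirichletCharacter q, odd_char chi /\
     exp (c * scrL q) <= Cmod (L chi (RtoC (1 / 2)))).

Lemma scrL_comparison y : 3 <= ln (ln y) ->
  sqrt (ln y / ln (ln y)) / sqrt 3 <= sqrt (ln y / 3 / ln (ln y / 3)) /\
  ln (ln y) - 2 <= ln (ln y / 3).
Proof.
  intros H.
  assert (Hy : 0 < ln y).
  { apply Rnot_le_lt. intros E. unfold ln at 1 in H. destruct (Rlt_dec 0 (ln y)); lra. }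
  assert (E3 : 0 < ln 3 <= 2).
  { split; [rewrite <- ln_1; apply ln_increasing; lra|].
    rewrite <- (ln_exp 2). apply ln_le; [lra|]. pose proof (exp_ineq1_le 2). lra. }
  assert (Ed : ln (ln y / 3) = ln (ln y) - ln 3) by (apply ln_div; lra).
  split; [|lra]. rewrite Ed. set (l := ln (ln y)) in *. set (x := ln y) in *.
  rewrite <- sqrt_div_alt by lra. apply sqrt_le_1_alt.
  replace (x / l / 3) with (x / 3 / l) by (field; lra).
  unfold Rdiv. apply Rmult_le_compat_l; [lra|]. apply Rinv_le_contravar; lra.
Qed.

(** The resonance inequality with [N = floor (q^(1/3))] and the resonator of
    logarithmic size [X = ln q / 3]; the factor 1/3 becomes the constant 1/sqrt 3. *)
Lemma large_values_eventually eps : 0 < eps -> exists q0 : nat, forall q : nat,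
  (q0 <= q)%nat -> prime_nat q -> large_values (1 / sqrt 3 - eps) q.
Proof.
  intros He. set (e := Rmin (1 / 2) (eps / 2)).
  assert (Hee : 0 < e <= 1 / 2).
  { unfold e. split; [apply Rmin_pos; lra|apply Rmin_l]. }
  assert (He2 : e <= eps / 2) by apply Rmin_r.
  destruct (resonator_exists e ltac:(lra)) as [l0 [Hl0 HR]].
  (* ln ln q >= K ensures ln X >= l0 and, as scrL q >= ln ln q / 56, also
     eps * scrL q >= 2 and scrL q >= 92. *)
  set (K := l0 + 2 + 56 * (92 + 2 / eps)).
  assert (He0 : 0 < 2 / eps) by (apply Rdiv_lt_0_compat; lra).
  destruct (nat_above (exp (exp K))) as [q1 Hq1]. exists (q1 + 16)%nat.
  intros q Hq Hp. unfold prime_nat in Hp.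
  assert (Hqq : exp (exp K) <= INR q).
  { left. eapply Rlt_le_trans; [exact Hq1|]. apply le_INR. lia. }
  set (x := ln (INR q)).
  assert (Hx : exp K <= x).
  { unfold x. rewrite <- (ln_exp (exp K)). apply ln_le; [apply exp_pos|assumption]. }
  assert (Hx0 : 0 < x) by (pose proof (exp_pos K); lra).
  assert (HlK : K <= ln x).
  { rewrite <- (ln_exp K). apply ln_le; [apply exp_pos|assumption]. }
  assert (HK : 5154 <= K) by (unfold K; lra).
  destruct (scrL_comparison (INR q)) as [C1 C2]; [fold x; lra|fold x in C1, C2].
  destruct (sqrt_ratio_lower x ltac:(lra)) as [_ C3].
  change (sqrt (x / ln x)) with (scrL q) in C1, C3.
  set (S1 := scrL q) in *.
  assert (HS1 : 92 + 2 / eps <= S1).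
  { eapply Rle_trans; [|exact C3].
    assert (ln x <= ln x * ln x) by nra.
    assert (56 * (92 + 2 / eps) <= ln x) by (unfold K in HlK; lra). lra. }
  set (X := x / 3) in *.
  assert (HX : 0 < X) by (unfold X; lra).
  assert (HlX : l0 <= ln X) by (unfold K in HlK; lra).
  destruct (HR X HX HlX) as [I [N1 [M1 [D1 G1]]]].
  set (S2 := sqrt (X / ln X)) in *.
  assert (s3 : 0 < sqrt 3) by (apply sqrt_lt_R0; lra).
  assert (s32 : 1 <= sqrt 3 <= 2).
  { split.
    - rewrite <- sqrt_1. apply sqrt_le_1_alt. lra.
    - rewrite <- (sqrt_square 2) by lra. apply sqrt_le_1_alt. lra. }
  assert (i3 : 1 / 2 <= / sqrt 3 <= 1).
  { split.
    - replace (1 / 2) with (/ 2) by field. apply Rinv_le_contravar; lra.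
    - rewrite <- Rinv_1. apply Rinv_le_contravar; lra. }
  unfold Rdiv at 1 in C1.
  assert (HS2 : 46 <= S2) by nra.
  assert (Hexp : 24 <= exp ((1 - e) * S2)).
  { pose proof (exp_ineq1_le ((1 - e) * S2)). assert (23 <= (1 - e) * S2) by nra. lra. }
  set (T := exp ((1 - e) * S2)) in *.
  (* 12 exceeds the loss 11 of the resonance inequality, and T >= 24. *)
  assert (Hgoal : exp ((1 / sqrt 3 - eps) * S1) <= T - 12).
  { apply Rle_trans with (exp ((1 - e) * S2 - 1)).
    - apply exp_le_mono.
      assert (A : (1 - e) * (S1 * / sqrt 3) <= (1 - e) * S2) by (apply Rmult_le_compat_l; lra).
      assert (B : 1 <= eps / 2 * S1).
      { apply Rle_trans with (eps / 2 * (2 / eps)); [right; field; lra|].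
        apply Rmult_le_compat_l; lra. }
      assert (C : e * (S1 * / sqrt 3) <= eps / 2 * S1).
      { apply Rmult_le_compat; try lra; nra. }
      unfold Rdiv at 1. lra.
    - unfold Rminus at 1. rewrite exp_plus. fold T.
      assert (exp (- (1)) <= 1 / 2).
      { rewrite exp_Ropp. replace (1 / 2) with (/ 2) by field. apply Rinv_le_contravar; [lra|].
        pose proof (exp_ineq1_le 1). lra. }
      assert (T * exp (- (1)) <= T * (1 / 2)) by (apply Rmult_le_compat_l; lra). lra. }
  set (N := nfloor (exp X)).
  destruct (nfloor_bounds (exp X) ltac:(left; apply exp_pos)) as [F1 F2]. fold N in F1, F2.
  assert (Hgood : good_resonator q N I).
  { split; [assumption|]. split.
    - apply INR_le. rewrite !mult_INR.
      apply Rle_trans with (exp X * exp X * exp X).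
      + pose proof (pos_INR N).
        apply Rmult_le_compat; try assumption; [now apply Rmult_le_pos|].
        apply Rmult_le_compat; assumption.
      + rewrite <- !exp_plus. replace (X + X + X) with x by (unfold X; field).
        unfold x. rewrite exp_ln; [lra|]. pose proof (exp_pos (exp K)). lra.
    - intros p Hpp. destruct (M1 p Hpp) as [A1 [A2 A3]]. split; [|assumption]. split; [assumption|].
      assert (INR (fst p) <= exp X).
      { rewrite <- (exp_ln (INR (fst p))) by (apply lt_0_INR; lia). now apply exp_le_mono. }
      assert (Hlt : INR (fst p) < INR (N + 1)) by (rewrite plus_INR; simpl; lra).
      apply INR_lt in Hlt. lia. }
  assert (Hwin : (T - 12 + 11) * den I < num I) by lra.
  assert (HTpos : 0 <= T - 12) by lra.
  split.
  - destruct (resonance q N I 1 (T - 12) Hp ltac:(lia) Hgood (or_introl eq_refl) HTpos Hwin)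
      as [chi [E H]].
    exists chi. split; [exact E|exact (Rle_trans _ _ _ Hgoal H)].
  - destruct (resonance q N I (-1) (T - 12) Hp ltac:(lia) Hgood (or_intror eq_refl) HTpos Hwin)
      as [chi [E H]].
    exists chi. split; [exact E|exact (Rle_trans _ _ _ Hgoal H)].
Qed.

(** Diagonal choice: at n, take the smallest tolerance 1/(k+1) with [k <= n] whose
    threshold is at most n. *)
Lemma vanishing_tolerance (D : nat -> Prop) (P : R -> nat -> Prop) :
  (forall eps, 0 < eps -> exists n0 : nat, forall n, (n0 <= n)%nat -> D n -> P eps n) ->
  exists e : nat -> R, is_lim_seq e 0 /\
    exists n0 : nat, forall n, (n0 <= n)%nat -> D n -> P (e n) n.
Proof.
  intros H.
  assert (Hk : forall k : nat, exists n0, forall n, (n0 <= n)%nat -> D n -> P (/ (INR k + 1)) n).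
  { intros k. apply H. apply Rinv_0_lt_compat. pose proof (pos_INR k). lra. }
  set (f := fun k => proj1_sig (constructive_indefinite_description _ (Hk k))).
  assert (Hf : forall k n, (f k <= n)%nat -> D n -> P (/ (INR k + 1)) n).
  { intros k. exact (proj2_sig (constructive_indefinite_description _ (Hk k))). }
  set (best := fix best (n m : nat) : nat := match m with
     | O => O | S m' => if Nat.leb (f (S m')) n then S m' else best n m' end).
  assert (B1 : forall n m, (f 0%nat <= n)%nat -> (f (best n m) <= n)%nat).
  { intros n m Hn. induction m as [|m IH]; [exact Hn|]. simpl.
    destruct (Nat.leb_spec (f (S m)) n); assumption. }
  assert (B2 : forall n m k, (f k <= n)%nat -> (k <= m)%nat -> (k <= best n m)%nat).
  { intros n m k Hn Hkm. induction m as [|m IH]; [simpl; lia|]. simpl.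
    destruct (Nat.leb_spec (f (S m)) n) as [Hle|Hlt]; [lia|].
    apply IH. destruct (Nat.eq_dec k (S m)) as [->|]; lia. }
  exists (fun n => / (INR (best n n) + 1)). split.
  - apply is_lim_seq_spec. intros [eps He]. destruct (nat_above (/ eps)) as [k Hk'].
    exists (k + f k)%nat. intros n Hn. simpl. rewrite Rminus_0_r.
    assert (Hb : INR k <= INR (best n n)) by (apply le_INR, B2; lia).
    assert (0 < / eps) by now apply Rinv_0_lt_compat.
    rewrite Rabs_right.
    + rewrite <- (Rinv_inv eps). apply Rinv_lt_contravar; [|lra]. apply Rmult_lt_0_compat; lra.
    + left. apply Rinv_0_lt_compat. lra.
  - exists (f 0%nat). intros n Hn HD. apply Hf; [|assumption]. now apply B1.
Qed.

Theorem mainTheorem3 :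
  exists o : nat -> R,
    filterlim o (within prime_nat eventually) (locally 0) /\
    exists q0 : nat, forall q : nat, (q0 <= q)%nat -> prime_nat q ->
      (exists chi : DirichletCharacter q,
         Cmod (L chi (RtoC (1 / 2))) >= exp ((1 / sqrt 3 + o q) * scrL q)) /\
      (exists chi : DirichletCharacter q, even_char chi /\
         Cmod (L chi (RtoC (1 / 2))) >= exp ((1 / sqrt 3 + o q) * scrL q)) /\
      (exists chi : DirichletCharacter q, odd_char chi /\
         Cmod (L chi (RtoC (1 / 2))) >= exp ((1 / sqrt 3 + o q) * scrL q)).
Proof.
  destruct (vanishing_tolerance prime_nat (fun eps q => large_values (1 / sqrt 3 - eps) q)
    large_values_eventually) as [e [He [q0 Hq0]]].
  exists (fun q => - e q). split.
  - apply is_lim_seq_opp in He. simpl in He. rewrite Ropp_0 in He.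
    intros P HP. destruct (He P HP) as [N HN]. exists N. intros n Hn _. now apply HN.
  - exists q0. intros q Hq Hp. destruct (Hq0 q Hq Hp) as [[chi [E1 H1]] [chi' [E2 H2]]].
    split; [|split].
    + exists chi. apply Rle_ge. exact H1.
    + exists chi. split; [exact E1|]. apply Rle_ge. exact H1.
    + exists chi'. split; [exact E2|]. apply Rle_ge. exact H2.
Qed.
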